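(* TDS and CTDS, restricted to instances whose discount factor is $\lambda=\frac1n$ for a natural number $n\ge 2$, are in PSPACE.
   Context: An instance of TDS consists of a rational discount factor $0<\lambda<1$, a rational target $t$, and rational weights $a,b$; it asks whether there exists an infinite sequence $w\in\{a,b\}^\omega$ with $\sum_{i=0}^\infty w(i)\lambda^i=t$. CTDS additionally takes an $\omega$-regular expression $e$ over $\{a,b\}$ and requires $w$ to belong to the language of $e$. *)

(* Defs.v *)
From Stdlib Require Import Reals QArith ZArith List Arith.
Import ListNotations.
Local Open Scope nat_scope.

(* Words over the two-letter alphabet {a,b}: letter false = a, true = b *)

Inductive regex : Type :=
  | REmpty : regex
  | REps : regex
  | RSym : bool -> regex
  | RCat : regex -> regex -> regex
  | RUnion : regex -> regex -> regex
  | RStar : regex -> regex.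

Fixpoint regex_lang (r : regex) (w : list bool) : Prop :=
  match r with
  | REmpty => False
  | REps => w = []
  | RSym c => w = [c]
  | RCat r1 r2 => exists u v, w = u ++ v /\ regex_lang r1 u /\ regex_lang r2 v
  | RUnion r1 r2 => regex_lang r1 w \/ regex_lang r2 w
  | RStar r1 => exists ws : list (list bool),
                  w = concat ws /\ Forall (regex_lang r1) ws
  end.

Inductive oregex : Type :=
  | OOmega : regex -> oregex
  | OCat : regex -> oregex -> oregex
  | OUnion : oregex -> oregex -> oregex.

Definition segment (w : nat -> bool) (i j : nat) : list bool :=
  map w (seq i (j - i)).

Definition prepend (u : list bool) (w' : nat -> bool) : nat -> bool :=
  fun i => if Nat.ltb i (length u) then nth i u false else w' (i - length u).

Fixpoint oregex_lang (e : oregex) (w : nat -> bool) : Prop :=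
  match e with
  | OOmega r => exists p : nat -> nat,
      p 0 = 0 /\ (forall k, p k < p (S k)) /\
      (forall k, regex_lang r (segment w (p k) (p (S k))))
  | OCat r e1 => exists u w', regex_lang r u /\ oregex_lang e1 w' /\
      (forall i, w i = prepend u w' i)
  | OUnion e1 e2 => oregex_lang e1 w \/ oregex_lang e2 w
  end.

Definition weight (a b : Q) (c : bool) : Q := if c then b else a.

Definition disc_sum_eq (lam t a b : Q) (w : nat -> bool) : Prop :=
  infinite_sum (fun i => (Q2R (weight a b (w i)) * (Q2R lam) ^ i)%R) (Q2R t).

Definition TDS_yes (lam t a b : Q) : Prop :=
  (0 < Q2R lam < 1)%R /\ exists w : nat -> bool, disc_sum_eq lam t a b w.

Definition CTDS_yes (lam t a b : Q) (e : oregex) : Prop :=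
  (0 < Q2R lam < 1)%R /\
  exists w : nat -> bool, oregex_lang e w /\ disc_sum_eq lam t a b w.

(* Binary encodings of instances (self-delimiting, bit-doubling)       *)

Fixpoint enc_pos (p : positive) : list bool :=
  match p with
  | xI p' => false :: true :: enc_pos p'
  | xO p' => false :: false :: enc_pos p'
  | xH => [true; true]
  end.

Definition enc_Z (z : Z) : list bool :=
  match z with
  | Z0 => [false; false]
  | Zpos p => false :: true :: enc_pos p
  | Zneg p => true :: false :: enc_pos p
  end.

Definition enc_Q (q : Q) : list bool := enc_Z (Qnum q) ++ enc_pos (Qden q).

Fixpoint enc_regex (r : regex) : list bool :=
  match r with
  | REmpty => [false; false; false]
  | REps => [false; false; true]
  | RSym c => [false; true; false; c]
  | RCat r1 r2 => [false; true; true] ++ enc_regex r1 ++ enc_regex r2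
  | RUnion r1 r2 => [true; false; false] ++ enc_regex r1 ++ enc_regex r2
  | RStar r1 => [true; false; true] ++ enc_regex r1
  end.

Fixpoint enc_oregex (e : oregex) : list bool :=
  match e with
  | OOmega r => [false; false] ++ enc_regex r
  | OCat r e1 => [false; true] ++ enc_regex r ++ enc_oregex e1
  | OUnion e1 e2 => [true; false] ++ enc_oregex e1 ++ enc_oregex e2
  end.

Definition enc_TDS (lam t a b : Q) : list bool :=
  enc_Q lam ++ enc_Q t ++ enc_Q a ++ enc_Q b.

Definition enc_CTDS (lam t a b : Q) (e : oregex) : list bool :=
  enc_TDS lam t a b ++ enc_oregex e.

Definition TDS_inv_lang (x : list bool) : Prop :=
  exists (n : nat) (lam t a b : Q),
    (2 <= n)%nat /\ Q2R lam = (/ INR n)%R /\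
    x = enc_TDS lam t a b /\ TDS_yes lam t a b.

Definition CTDS_inv_lang (x : list bool) : Prop :=
  exists (n : nat) (lam t a b : Q) (e : oregex),
    (2 <= n)%nat /\ Q2R lam = (/ INR n)%R /\
    x = enc_CTDS lam t a b e /\ CTDS_yes lam t a b e.

Inductive dir : Type := DLeft | DStay | DRight.

(* States are 0..nQ-1 (start state 0); tape symbols are 0..nG-1, with
   0 = blank, 1 = input bit false, 2 = input bit true. *)
Record TM : Type := {
  tm_nQ : nat;
  tm_nG : nat;
  tm_delta : nat -> nat -> nat * nat * dir;
  tm_acc : nat;
  tm_rej : nat
}.

Definition TM_wf (M : TM) : Prop :=
  0 < tm_nQ M /\ 3 <= tm_nG M /\ tm_acc M < tm_nQ M /\ tm_rej M < tm_nQ M /\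
  tm_acc M <> tm_rej M /\
  forall q g, q < tm_nQ M -> g < tm_nG M ->
    match tm_delta M q g with
    | (q', g', _) => q' < tm_nQ M /\ g' < tm_nG M
    end.

Record config : Type := { c_state : nat; c_head : nat; c_tape : nat -> nat }.

Definition halted (M : TM) (c : config) : bool :=
  Nat.eqb (c_state c) (tm_acc M) || Nat.eqb (c_state c) (tm_rej M).

Definition move (h : nat) (d : dir) : nat :=
  match d with DLeft => pred h | DStay => h | DRight => S h end.

Definition step (M : TM) (c : config) : config :=
  if halted M c then c else
  match tm_delta M (c_state c) (c_tape c (c_head c)) with
  | (q', g', d) =>
      {| c_state := q';
         c_head := move (c_head c) d;
         c_tape := fun i => if Nat.eqb i (c_head c) then g' else c_tape c i |}
  end.

Definition init_config (x : list bool) : config :=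
  {| c_state := 0; c_head := 0;
     c_tape := fun i => if Nat.ltb i (length x)
                        then (if nth i x false then 2 else 1) else 0 |}.

Definition run (M : TM) (x : list bool) (t : nat) : config :=
  Nat.iter t (step M) (init_config x).

Definition decides_in_space (M : TM) (s : nat -> nat)
    (L : list bool -> Prop) : Prop :=
  forall x : list bool, exists T : nat,
    halted M (run M x T) = true /\
    (forall t, t <= T -> c_head (run M x t) < s (length x)) /\
    (c_state (run M x T) = tm_acc M <-> L x).

Definition PSPACE (L : list bool -> Prop) : Prop :=
  exists (M : TM) (c k : nat), TM_wf M /\
    decides_in_space M (fun n => c * (S n) ^ k) L.

(* Main.v *)
(* Writing x_i for the indicator of the letter b, the equation sum_i w(i)/n^i = t says
   that s = c * sum_i x_i/n^i for s = (n-1)t - na and c = (n-1)(b-a). With a common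
   denominator and signs removed, s and c become natural numbers P and D, and the
   equation holds iff the remainders Y_0 = P, Y_{i+1} = n(Y_i - x_i D) satisfy
   x_i D <= Y_i <= 2D for all i. The remainder is a number of polynomial length, and
   membership in the omega-regular language is followed by a stack machine that
   rewrites the Polish notation of the expression and never needs more than quadratic
   room. So the question is whether a graph on exponentially many nodes contains a
   lasso through a node at which the omega-power restarts, the cycle reading at least
   one letter; by Savitch's theorem this is decidable in polynomial space.

   To reach an actual Turing machine, functions on numbers of polynomial length are
   closed under composition and bounded recursion, hence predicates under bounded
   quantification (by exhaustive search) and reachability. They are computed by
   while programs over increment, reset and equality test, whose registers are tape
   tracks holding bijective base 2 numerals; the input word is then already the
   numeral of register 0. *)
Require Import Defs.
From Stdlib Require Import Reals QArith ZArith List Arith Lia Lra Classical.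
Import ListNotations.
Local Open Scope nat_scope.

(** * Register programs on a Turing machine *)

(** A discount 1/n is special because undoing it is multiplication by n, which keeps remainders
    integral; for a discount p/q with p > 1 denominators may grow with every letter. The bound 2D is
    what the remaining letters can still pay: D(1 + 1/n + ...) = Dn/(n-1), at most 2D since n >= 2.
    Conversely any fixed bound on the remainders forces convergence to t, the error after i letters
    being of the order of the remainder divided by n^i. A lasso exists because among infinitely many
    restarts of the omega-power two carry the same remainder. Space is measured through values:
    inputs up to 2^m must keep all registers below 2^poly(m). Time is not counted, so addition may
    be repeated increment and search may be exhaustive. The price is that a recursion with
    exponentially many rounds needs a bound on its iterates in advance; this is why Savitch's
    recursion is run on an explicit stack of capped size, and why every quantifier below carries a
    bound. *)

Fixpoint dgt (r g : nat) : nat :=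
  match r with 0 => g mod 3 | S r' => dgt r' (g / 3) end.

Fixpoint setd (r d g : nat) : nat :=
  match r with 0 => 3 * (g / 3) + d | S r' => 3 * setd r' d (g / 3) + g mod 3 end.

Lemma divmod3 q d : d < 3 -> (3 * q + d) / 3 = q /\ (3 * q + d) mod 3 = d.
Proof.
  intros H. split.
  - symmetry. apply (Nat.div_unique _ _ _ d); lia.
  - symmetry. apply (Nat.mod_unique _ _ q); lia.
Qed.

Lemma dgt_setd r d g : d < 3 -> dgt r (setd r d g) = d.
Proof.
  revert g. induction r as [|r IH]; intros g Hd; cbn [dgt setd].
  - apply divmod3, Hd.
  - destruct (divmod3 (setd r d (g / 3)) (g mod 3)) as [-> _]; auto.
    apply Nat.mod_upper_bound; lia.
Qed.

Lemma dgt_setd_neq r r' d g : d < 3 -> r' <> r -> dgt r' (setd r d g) = dgt r' g.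
Proof.
  revert r' g. induction r as [|r IH]; intros [|r'] g Hd Hn; cbn [dgt setd]; try lia.
  - now destruct (divmod3 (g / 3) d Hd) as [-> _].
  - apply divmod3, Nat.mod_upper_bound; lia.
  - destruct (divmod3 (setd r d (g / 3)) (g mod 3)) as [-> _].
    + apply Nat.mod_upper_bound; lia.
    + apply IH; lia.
Qed.

Lemma setd_bound r d g K : d < 3 -> r < K -> g < 3 ^ K -> setd r d g < 3 ^ K.
Proof.
  revert g K. induction r as [|r IH]; intros g [|K] Hd Hr Hg; try lia; cbn [setd];
    rewrite Nat.pow_succ_r' in *.
  - assert (g / 3 < 3 ^ K) by (apply Nat.Div0.div_lt_upper_bound; lia). lia.
  - assert (g / 3 < 3 ^ K) by (apply Nat.Div0.div_lt_upper_bound; lia).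
    assert (setd r d (g / 3) < 3 ^ K) by (apply IH; lia).
    assert (g mod 3 < 3) by (apply Nat.mod_upper_bound; lia). lia.
Qed.

Lemma dgt_lt r g : dgt r g < 3.
Proof.
  revert g. induction r; intros g; cbn; [apply (Nat.mod_upper_bound g 3); lia | apply IHr].
Qed.

(** Digits 1 and 2 only, with 0 as the end of the numeral: blank cells stand for the number 0 on
    every register track, and a scan recognises the end of a numeral without knowing its length. *)
Fixpoint dig (i x : nat) : nat :=
  match i with
  | 0 => if x =? 0 then 0 else if Nat.odd x then 1 else 2
  | S i' => dig i' (Nat.pred x / 2)
  end.

Lemma bij_cases x : x = 0 \/ (exists y, x = 2 * y + 1) \/ (exists y, x = 2 * y + 2).
Proof.
  destruct (Nat.Even_or_Odd x) as [[y Hy]|[y Hy]].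
  - destruct y as [|y]; [left; lia|]. right; right. exists y. lia.
  - right; left. now exists y.
Qed.

Lemma dig_zero i : dig i 0 = 0.
Proof. induction i; cbn; auto. Qed.

Lemma dig_odd0 y : dig 0 (2 * y + 1) = 1.
Proof.
  cbn [dig]. destruct (Nat.eqb_spec (2 * y + 1) 0); [lia|]. now rewrite Nat.odd_odd.
Qed.

Lemma dig_even0 y : dig 0 (2 * y + 2) = 2.
Proof.
  cbn [dig]. destruct (Nat.eqb_spec (2 * y + 2) 0); [lia|].
  replace (2 * y + 2) with (2 * (y + 1)) by lia. now rewrite Nat.odd_even.
Qed.

Lemma dig_oddS i y : dig (S i) (2 * y + 1) = dig i y.
Proof.
  cbn [dig]. f_equal. symmetry. apply (Nat.div_unique _ _ _ 0); lia.
Qed.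

Lemma dig_evenS i y : dig (S i) (2 * y + 2) = dig i y.
Proof.
  cbn [dig]. f_equal. symmetry. apply (Nat.div_unique _ _ _ 1); lia.
Qed.

(** * Instructions and the machine that runs them *)

Inductive instr : Type :=
  | IZero (r : nat)
  | IInc (r : nat)
  | IEq (r1 r2 t1 t2 : nat).

(* One left-to-right pass: new symbol, and 0 = keep going, 1 = exit to the
   first target, 2 = exit to the second target. *)
Definition scan (K : nat) (ins : instr) (g : nat) : nat * nat :=
  match ins with
  | IZero r => if dgt r g =? 0 then (g, 1)
               else ((if r <? K then setd r 0 g else g), 0)
  | IInc r => if dgt r g =? 2 then ((if r <? K then setd r 1 g else g), 0)
              else ((if r <? K then setd r (S (dgt r g)) g else g), 1)
  | IEq r1 r2 _ _ => if dgt r1 g =? dgt r2 g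
                     then (g, if dgt r1 g =? 0 then 1 else 0) else (g, 2)
  end.

Definition target (ins : instr) (pc mu : nat) : nat :=
  match ins with
  | IEq _ _ t1 t2 => if mu =? 1 then t1 else t2
  | _ => S pc
  end.

(** State 0 is the start state, which only marks cell 0. Instruction [pc] owns the three states
    [st pc + mu]: scanning to the right for mu = 0, and walking home with exit 1 or 2 remembered for
    the other two. *)
Definition st (pc : nat) : nat := S (3 * pc).

(* Symbols are K+1 base-3 digits: track r < K is register r in bijective base 2
   (digit 0 = end of the numeral), track K marks cell 0. *)
Definition mdelta (code : list instr) (K q g : nat) : nat * nat * dir :=
  match q with
  | 0 => (st 0, setd K 1 g, DStay)
  | S q' =>
      match nth_error code (q' / 3) with
      | None => (0, g, DStay)
      | Some ins =>
          if q' mod 3 =? 0 then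
            match scan K ins g with
            | (g', 0) => (q, g', DRight)
            | (g', mu) => (q + mu, g', DStay)
            end
          else if dgt K g =? 1
               then (st (Nat.min (target ins (q' / 3) (q' mod 3)) (S (length code))), g, DStay)
               else (q, g, DLeft)
      end
  end.

Definition machine (code : list instr) (K : nat) : TM :=
  {| tm_nQ := st (S (S (length code)));
     tm_nG := 3 ^ S K;
     tm_delta := mdelta code K;
     tm_acc := st (S (length code));
     tm_rej := st (length code) |}.

(** Valid for every instruction list, sensible or not: the tests [r <? K] in [scan] keep symbols
    within K+1 digits, and [Nat.min] in [mdelta] keeps jumps within the program and the two
    addresses behind it, of which the first rejects and the second accepts. *)
Lemma machine_wf code K : TM_wf (machine code K).
Proof.
  unfold TM_wf, machine, st; cbn [tm_nQ tm_nG tm_delta tm_acc tm_rej].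
  assert (0 < 3 ^ K) by (apply Nat.neq_0_lt_0, Nat.pow_nonzero; lia).
  repeat split; try lia. { rewrite Nat.pow_succ_r'. lia. }
  intros q g Hq Hg. unfold mdelta.
  destruct q as [|q]. { unfold st. split; [lia|]. apply setd_bound; lia. }
  destruct (nth_error code (q / 3)) as [ins|] eqn:E; [|split; lia].
  assert (Hlt : q / 3 < length code) by (apply nth_error_Some; congruence).
  assert (Hm : q mod 3 < 3) by (apply Nat.mod_upper_bound; lia).
  assert (Hdm : q = 3 * (q / 3) + q mod 3) by (apply Nat.div_mod; lia).
  destruct (Nat.eqb_spec (q mod 3) 0) as [E0|E0].
  - assert (Hs : fst (scan K ins g) < 3 ^ S K /\ snd (scan K ins g) < 3).
    { assert (HS : forall r d, d < 3 -> (if r <? K then setd r d g else g) < 3 ^ S K).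
      { intros r d Hd. destruct (Nat.ltb_spec r K); [apply setd_bound; lia | lia]. }
      destruct ins as [r|r|r1 r2 t1 t2]; cbn [scan].
      - destruct (dgt r g =? 0); cbn [fst snd]; split; auto; lia.
      - pose proof (dgt_lt r g).
        destruct (Nat.eqb_spec (dgt r g) 2); cbn [fst snd]; split; try lia; apply HS; lia.
      - destruct (dgt r1 g =? dgt r2 g), (dgt r1 g =? 0); cbn [fst snd]; lia. }
    destruct (scan K ins g) as [g' mu]. cbn [fst snd] in Hs.
    destruct mu; lia.
  - destruct (dgt K g =? 1); unfold st; split; lia.
Qed.

Definition mkc (q h : nat) (tape : nat -> nat) : config :=
  {| c_state := q; c_head := h; c_tape := tape |}.

Definition steps (M : TM) (sp : nat) (c c' : config) : Prop :=
  exists t, Nat.iter t (step M) c = c' /\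
            forall t', t' <= t -> c_head (Nat.iter t' (step M) c) < sp.

Lemma steps_trans M sp c1 c2 c3 : steps M sp c1 c2 -> steps M sp c2 c3 -> steps M sp c1 c3.
Proof.
  intros [t1 [E1 H1]] [t2 [E2 H2]]. exists (t2 + t1). split.
  - rewrite Nat.iter_add, E1. exact E2.
  - intros t' Ht. destruct (Nat.le_gt_cases t' t1) as [L|L]; [auto|].
    replace t' with ((t' - t1) + t1) by lia. rewrite Nat.iter_add, E1. apply H2. lia.
Qed.

Lemma steps_one M sp c c' : c_head c < sp -> step M c = c' -> c_head c' < sp -> steps M sp c c'.
Proof.
  intros H E H'. exists 1. split; [exact E|].
  intros [|t'] Ht; [exact H|]. replace t' with 0 by lia. cbn. now rewrite E.
Qed.

Section Simulation.
Variables (code : list instr) (K sp : nat).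
Let M := machine code K.

Lemma mstep pc ins mu h tape :
  nth_error code pc = Some ins -> mu < 3 ->
  step M (mkc (st pc + mu) h tape) =
  match mdelta code K (st pc + mu) (tape h) with
  | (q', g', d) => mkc q' (move h d) (fun i => if i =? h then g' else tape i)
  end.
Proof.
  intros E Hmu. assert (pc < length code) by (apply nth_error_Some; congruence).
  unfold step, halted, M. cbn [machine tm_acc tm_rej c_state mkc tm_delta c_tape c_head].
  unfold st at 1 2 3 4.
  destruct (Nat.eqb_spec (S (3 * pc) + mu) (S (3 * S (length code)))); [lia|].
  destruct (Nat.eqb_spec (S (3 * pc) + mu) (S (3 * length code))); [lia|].
  reflexivity.
Qed.

Lemma mdelta_st pc ins mu g :
  nth_error code pc = Some ins -> mu < 3 ->
  mdelta code K (st pc + mu) g =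
  if mu =? 0 then
    match scan K ins g with
    | (g', 0) => (st pc + mu, g', DRight)
    | (g', mu') => (st pc + mu + mu', g', DStay)
    end
  else if dgt K g =? 1
       then (st (Nat.min (target ins pc mu) (S (length code))), g, DStay)
       else (st pc + mu, g, DLeft).
Proof.
  intros E Hmu. unfold mdelta, st. cbn [Nat.add].
  destruct (divmod3 pc mu Hmu) as [-> ->]. now rewrite E.
Qed.

Definition repr (s : nat -> nat) (tape : nat -> nat) : Prop :=
  (forall i r, r < K -> dgt r (tape i) = dig i (s r)) /\
  (forall i, dgt K (tape i) = if i =? 0 then 1 else 0).

(* The tape is rewritten pointwise in place, hence agreement up to digits. *)
Definition tape_eq (t1 t2 : nat -> nat) : Prop := forall i r, r <= K -> dgt r (t1 i) = dgt r (t2 i).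

(** [move] keeps the head on cell 0 when it steps left there, so the left end shows only through the
    mark on track K. *)
Lemma return_home pc ins mu h : nth_error code pc = Some ins -> 0 < mu < 3 -> h < sp ->
  forall tape, (forall i, dgt K (tape i) = if i =? 0 then 1 else 0) ->
  exists tape', steps M sp (mkc (st pc + mu) h tape)
     (mkc (st (Nat.min (target ins pc mu) (S (length code)))) 0 tape') /\ tape_eq tape' tape.
Proof.
  intros E Hmu. induction h as [|h IH]; intros Hsp tape Hm.
  - eexists. split.
    + apply steps_one; [exact Hsp| |exact Hsp].
      rewrite (mstep pc ins) by (auto; lia). rewrite (mdelta_st pc ins) by (auto; lia).
      rewrite Hm. cbn [Nat.eqb]. destruct (Nat.eqb_spec mu 0); [lia|]. reflexivity.
    + intros i r _. cbn. destruct (Nat.eqb_spec i 0); now subst.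
  - set (tape1 := fun i => if i =? S h then tape (S h) else tape i).
    assert (Heq : forall i, tape1 i = tape i).
    { intros i. unfold tape1. destruct (Nat.eqb_spec i (S h)); now subst. }
    destruct (IH ltac:(lia) tape1) as [tape' [H1 H2]].
    { intros i. rewrite Heq. apply Hm. }
    exists tape'. split.
    + eapply steps_trans; [|exact H1].
      apply steps_one; [exact Hsp| |cbn; lia].
      rewrite (mstep pc ins) by (auto; lia). rewrite (mdelta_st pc ins) by (auto; lia).
      rewrite Hm. cbn [Nat.eqb]. destruct (Nat.eqb_spec mu 0); [lia|]. reflexivity.
    + intros i r Hr. rewrite H2 by auto. now rewrite Heq.
Qed.

Lemma step_scan pc ins h tape :
  nth_error code pc = Some ins ->
  step M (mkc (st pc) h tape) =
  match scan K ins (tape h) with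
  | (g', 0) => mkc (st pc) (S h) (fun i => if i =? h then g' else tape i)
  | (g', mu) => mkc (st pc + mu) h (fun i => if i =? h then g' else tape i)
  end.
Proof.
  intros E. pose proof (mstep pc ins 0 h tape E ltac:(lia)) as H.
  rewrite (mdelta_st pc ins) in H by (auto; lia). cbn [Nat.eqb] in H.
  rewrite Nat.add_0_r in H. rewrite H.
  destruct (scan K ins (tape h)) as [g' [|mu]]; reflexivity.
Qed.

(** A digit 2 turns into 1 and passes the carry on, because 2y + 3 = 2(y + 1) + 1; digits 0 and 1
    absorb it. With [S x < 2 ^ n] this happens within n cells. *)
Lemma scan_inc pc r : nth_error code pc = Some (IInc r) -> r < K ->
  forall n x h tape, S x < 2 ^ n -> h + n <= sp ->
  (forall i, dgt r (tape (h + i)) = dig i x) ->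
  exists h' tape', h' < sp /\ steps M sp (mkc (st pc) h tape) (mkc (st pc + 1) h' tape') /\
    (forall i, dgt r (tape' (h + i)) = dig i (S x)) /\
    (forall i, i < h -> tape' i = tape i) /\
    (forall i r', r' <> r -> dgt r' (tape' i) = dgt r' (tape i)).
Proof.
  intros E Hr. induction n as [|n IH]; intros x h tape Hx Hsp Hd; [cbn in Hx; lia|].
  pose proof (Hd 0) as Hd0. rewrite Nat.add_0_r in Hd0.
  assert (HK : (r <? K) = true) by now apply Nat.ltb_lt.
  assert (Hstop : forall d, dig 0 x = d -> d <> 2 -> dig 0 (S x) = S d ->
            (forall i, dig (S i) (S x) = dig (S i) x) ->
  exists h' tape', h' < sp /\ steps M sp (mkc (st pc) h tape) (mkc (st pc + 1) h' tape') /\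
    (forall i, dgt r (tape' (h + i)) = dig i (S x)) /\
    (forall i, i < h -> tape' i = tape i) /\
    (forall i r', r' <> r -> dgt r' (tape' i) = dgt r' (tape i))).
  { intros d Hdx Hd2 Hs0 HsS.
    assert (Hd3 : d < 3) by (rewrite <- Hdx, <- Hd0; apply dgt_lt).
    eexists h, _. split; [lia|]. split; [|split; [|split]].
    - apply steps_one; [cbn; lia| |].
      + rewrite (step_scan pc (IInc r)) by auto. cbn [scan]. rewrite Hd0, Hdx, HK.
        destruct (Nat.eqb_spec d 2); [lia|]. reflexivity.
      + cbn; lia.
    - intros [|i]; cbn beta.
      + rewrite Nat.add_0_r, Nat.eqb_refl, Hs0. apply dgt_setd. lia.
      + destruct (Nat.eqb_spec (h + S i) h); [lia|]. now rewrite Hd, HsS.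
    - intros i Hi. cbn beta. destruct (Nat.eqb_spec i h); [lia|auto].
    - intros i r' Hr'. cbn beta. destruct (Nat.eqb_spec i h); [subst|auto].
      apply dgt_setd_neq; lia. }
  destruct (bij_cases x) as [->|[[y ->]|[y ->]]].
  - apply (Hstop 0); auto.
  - apply (Hstop 1); [apply dig_odd0 | lia | |].
    + replace (S (2 * y + 1)) with (2 * y + 2) by lia. apply dig_even0.
    + intros i. replace (S (2 * y + 1)) with (2 * y + 2) by lia.
      now rewrite dig_evenS, dig_oddS.
  - rewrite dig_even0 in Hd0. rewrite Nat.pow_succ_r' in Hx.
    set (tape1 := fun i => if i =? h then setd r 1 (tape h) else tape i).
    destruct (IH y (S h) tape1) as (h' & tape' & Hh' & Hst & H1 & H2 & H3); [lia|lia| |].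
    { intros i. unfold tape1. destruct (Nat.eqb_spec (S h + i) h); [lia|].
      replace (S h + i) with (h + S i) by lia. now rewrite Hd, dig_evenS. }
    assert (n <> 0) by (intros ->; cbn in Hx; lia).
    exists h', tape'. split; [auto|]. split; [|split; [|split]].
    + eapply steps_trans; [|exact Hst]. apply steps_one; [cbn; lia| |cbn; lia].
      rewrite (step_scan pc (IInc r)) by auto. cbn [scan]. rewrite Hd0, HK. reflexivity.
    + replace (S (2 * y + 2)) with (2 * (S y) + 1) by lia. intros [|i].
      * rewrite dig_odd0, Nat.add_0_r, H2 by lia. unfold tape1. rewrite Nat.eqb_refl.
        apply dgt_setd; lia.
      * rewrite dig_oddS. replace (h + S i) with (S h + i) by lia. apply H1.
    + intros i Hi. rewrite H2 by lia. unfold tape1. destruct (Nat.eqb_spec i h); [lia|auto].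
    + intros i r' Hr'. rewrite H3 by auto. unfold tape1.
      destruct (Nat.eqb_spec i h); [subst|auto]. apply dgt_setd_neq; lia.
Qed.

Lemma dig0_eq0 x : dig 0 x = 0 -> x = 0.
Proof.
  destruct (bij_cases x) as [->|[[y ->]|[y ->]]]; auto; rewrite ?dig_odd0, ?dig_even0; lia.
Qed.

Lemma dig_pred_half x n : 0 < x < 2 ^ S n -> Nat.pred x / 2 < 2 ^ n.
Proof.
  rewrite Nat.pow_succ_r'. intros H. apply Nat.Div0.div_lt_upper_bound. lia.
Qed.

(** The scan has to see the end digit behind a numeral of at most n digits; hence room for n + 1
    cells, one more than for an increment. *)
Lemma scan_zero pc r : nth_error code pc = Some (IZero r) -> r < K ->
  forall n x h tape, x < 2 ^ n -> h + n < sp ->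
  (forall i, dgt r (tape (h + i)) = dig i x) ->
  exists h' tape', h' < sp /\ steps M sp (mkc (st pc) h tape) (mkc (st pc + 1) h' tape') /\
    (forall i, dgt r (tape' (h + i)) = 0) /\
    (forall i, i < h -> tape' i = tape i) /\
    (forall i r', r' <> r -> dgt r' (tape' i) = dgt r' (tape i)).
Proof.
  intros E Hr. assert (HK : (r <? K) = true) by now apply Nat.ltb_lt.
  induction n as [|n IH]; intros x h tape Hx Hsp Hd;
    pose proof (Hd 0) as Hd0; rewrite Nat.add_0_r in Hd0;
    destruct (Nat.eqb_spec (dig 0 x) 0) as [E0|E0].
  1,3: apply dig0_eq0 in E0; subst x; eexists h, _; (split; [lia|]; split; [|split; [|split]]);
    [ apply steps_one; [cbn; lia| |];
      [ rewrite (step_scan pc (IZero r)) by auto; cbn [scan]; rewrite Hd0; reflexivity | cbn; lia ]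
    | intros i; cbn beta; destruct (Nat.eqb_spec (h + i) h);
      [ now rewrite Hd0 | now rewrite Hd, dig_zero ]
    | intros i Hi; cbn beta; destruct (Nat.eqb_spec i h); [lia|auto]
    | intros i r' _; cbn beta; destruct (Nat.eqb_spec i h); [now subst|auto] ].
  - cbn in Hx. replace x with 0 in E0 by lia. now cbn in E0.
  - assert (x <> 0) by (intros ->; now cbn in E0).
    set (tape1 := fun i => if i =? h then setd r 0 (tape h) else tape i).
    destruct (IH (Nat.pred x / 2) (S h) tape1) as (h' & tape' & Hh' & Hst & H1 & H2 & H3);
      [apply dig_pred_half; lia|lia| |].
    { intros i. unfold tape1. destruct (Nat.eqb_spec (S h + i) h); [lia|].
      replace (S h + i) with (h + S i) by lia. now rewrite Hd. }
    exists h', tape'. split; [auto|]. split; [|split; [|split]].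
    + eapply steps_trans; [|exact Hst]. apply steps_one; [cbn; lia| |cbn; lia].
      rewrite (step_scan pc (IZero r)) by auto. cbn [scan]. rewrite Hd0, HK.
      destruct (Nat.eqb_spec (dig 0 x) 0); [lia|]. reflexivity.
    + intros [|i].
      * rewrite Nat.add_0_r, H2 by lia. unfold tape1. rewrite Nat.eqb_refl.
        apply dgt_setd; lia.
      * replace (h + S i) with (S h + i) by lia. apply H1.
    + intros i Hi. rewrite H2 by lia. unfold tape1. destruct (Nat.eqb_spec i h); [lia|auto].
    + intros i r' Hr'. rewrite H3 by auto. unfold tape1.
      destruct (Nat.eqb_spec i h); [subst|auto]. apply dgt_setd_neq; lia.
Qed.

Lemma dig0_inj x y : dig 0 x = dig 0 y -> Nat.pred x / 2 = Nat.pred y / 2 -> x = y.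
Proof.
  destruct (bij_cases x) as [->|[[a ->]|[a ->]]], (bij_cases y) as [->|[[b ->]|[b ->]]];
    rewrite ?dig_odd0, ?dig_even0; cbn [dig Nat.eqb]; try (intros; lia); intros _ H; auto.
  - assert (forall c, Nat.pred (2 * c + 1) / 2 = c) as Hc
      by (intros c; symmetry; apply (Nat.div_unique _ _ _ 0); lia).
    rewrite !Hc in H. lia.
  - assert (forall c, Nat.pred (2 * c + 2) / 2 = c) as Hc
      by (intros c; symmetry; apply (Nat.div_unique _ _ _ 1); lia).
    rewrite !Hc in H. lia.
Qed.

(** A differing digit decides at once, a common end digit means equality. Correctness rests on the
    uniqueness of bijective numerals, [dig0_inj]. *)
Lemma scan_eq pc r1 r2 t1 t2 : nth_error code pc = Some (IEq r1 r2 t1 t2) ->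
  forall n x y h tape, x < 2 ^ n -> y < 2 ^ n -> h + n < sp ->
  (forall i, dgt r1 (tape (h + i)) = dig i x) ->
  (forall i, dgt r2 (tape (h + i)) = dig i y) ->
  exists h' tape', h' < sp /\
    steps M sp (mkc (st pc) h tape) (mkc (st pc + (if x =? y then 1 else 2)) h' tape') /\
    (forall i, tape' i = tape i).
Proof.
  intros E. induction n as [|n IH]; intros x y h tape Hx Hy Hsp Hd1 Hd2;
    pose proof (Hd1 0) as Ha; pose proof (Hd2 0) as Hb; rewrite Nat.add_0_r in Ha, Hb;
    set (tape1 := fun i => if i =? h then tape h else tape i);
    assert (Hid : forall i, tape1 i = tape i)
      by (intros i; unfold tape1; destruct (Nat.eqb_spec i h); now subst).
  - cbn in Hx, Hy. replace x with 0 in * by lia. replace y with 0 in * by lia.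
    exists h, tape1. split; [lia|]. split; [|exact Hid].
    apply steps_one; [cbn; lia| |cbn; lia].
    rewrite (step_scan pc (IEq r1 r2 t1 t2)) by auto. cbn [scan]. rewrite Ha, Hb. reflexivity.
  - destruct (Nat.eqb_spec (dig 0 x) (dig 0 y)) as [E1|E1].
    + destruct (Nat.eqb_spec (dig 0 x) 0) as [E0|E0].
      * assert (x = 0) by now apply dig0_eq0. assert (y = 0) by (apply dig0_eq0; congruence).
        subst. exists h, tape1. split; [lia|]. split; [|exact Hid].
        apply steps_one; [cbn; lia| |cbn; lia].
        rewrite (step_scan pc (IEq r1 r2 t1 t2)) by auto. cbn [scan]. rewrite Ha, Hb. reflexivity.
      * assert (x <> 0) by (intros ->; now cbn in E0).
        assert (y <> 0) by (intros ->; rewrite E1 in E0; now cbn in E0).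
        destruct (IH (Nat.pred x / 2) (Nat.pred y / 2) (S h) tape1) as (h' & tape' & Hh' & Hst & H1);
          [apply dig_pred_half; lia | apply dig_pred_half; lia | lia | | |].
        { intros i. rewrite Hid. replace (S h + i) with (h + S i) by lia. now rewrite Hd1. }
        { intros i. rewrite Hid. replace (S h + i) with (h + S i) by lia. now rewrite Hd2. }
        exists h', tape'. split; [auto|]. split; [|intros i; now rewrite H1].
        eapply steps_trans.
        { apply steps_one with (c' := mkc (st pc) (S h) tape1); [cbn; lia| |cbn; lia].
          rewrite (step_scan pc (IEq r1 r2 t1 t2)) by auto. cbn [scan]. rewrite Ha, Hb, E1, Nat.eqb_refl.
          rewrite E1 in E0. destruct (Nat.eqb_spec (dig 0 y) 0); [lia|]. reflexivity. }
        replace (x =? y) with (Nat.pred x / 2 =? Nat.pred y / 2); [exact Hst|].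
        destruct (Nat.eqb_spec x y), (Nat.eqb_spec (Nat.pred x / 2) (Nat.pred y / 2));
          try congruence. exfalso. auto using dig0_inj.
    + exists h, tape1. split; [lia|]. split; [|exact Hid].
      apply steps_one; [cbn; lia| |cbn; lia].
      rewrite (step_scan pc (IEq r1 r2 t1 t2)) by auto. cbn [scan]. rewrite Ha, Hb.
      destruct (Nat.eqb_spec (dig 0 x) (dig 0 y)); [lia|].
      destruct (Nat.eqb_spec x y); [congruence|]. reflexivity.
Qed.


End Simulation.

(** * While programs and their compilation *)

Inductive cmd : Type :=
  | CZero (r : nat)
  | CInc (r : nat)
  | CSeq (c1 c2 : cmd)
  | CWhile (r1 r2 : nat) (c : cmd). (* loops as long as r1 <> r2 *)

Definition upd (s : nat -> nat) (r v : nat) : nat -> nat :=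
  fun x => if x =? r then v else s x.

(** Overflow blocks: [CInc] has no transition at [B]. If the initial values fit, the mere existence
    of an execution certifies that all later ones do, and thereby bounds the space. *)
Inductive exec (B : nat) : cmd -> (nat -> nat) -> (nat -> nat) -> Prop :=
  | XZero r s : exec B (CZero r) s (upd s r 0)
  | XInc r s : s r < B -> exec B (CInc r) s (upd s r (S (s r)))
  | XSeq c1 c2 s1 s2 s3 : exec B c1 s1 s2 -> exec B c2 s2 s3 -> exec B (CSeq c1 c2) s1 s3
  | XWhileF r1 r2 c s : s r1 = s r2 -> exec B (CWhile r1 r2 c) s s
  | XWhileT r1 r2 c s1 s2 s3 : s1 r1 <> s1 r2 -> exec B c s1 s2 ->
      exec B (CWhile r1 r2 c) s2 s3 -> exec B (CWhile r1 r2 c) s1 s3.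

Lemma exec_bound B c s s' : exec B c s s' -> (forall r, s r <= B) -> forall r, s' r <= B.
Proof.
  induction 1; intros Hs r'; auto; unfold upd; destruct (r' =? _); auto; lia.
Qed.

Fixpoint csize (c : cmd) : nat :=
  match c with
  | CZero _ | CInc _ => 1
  | CSeq c1 c2 => csize c1 + csize c2
  | CWhile _ _ c => 2 + csize c
  end.

(** Jump addresses are absolute, hence the argument [base]. The closing [IEq r1 r1 base base] is an
    unconditional jump back to the loop test. *)
Fixpoint comp (c : cmd) (base : nat) : list instr :=
  match c with
  | CZero r => [IZero r]
  | CInc r => [IInc r]
  | CSeq c1 c2 => comp c1 base ++ comp c2 (base + csize c1)
  | CWhile r1 r2 c =>
      IEq r1 r2 (base + (2 + csize c)) (S base) ::
      comp c (S base) ++ [IEq r1 r1 base base]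
  end.

Fixpoint regs_lt (K : nat) (c : cmd) : Prop :=
  match c with
  | CZero r | CInc r => r < K
  | CSeq c1 c2 => regs_lt K c1 /\ regs_lt K c2
  | CWhile r1 r2 c => r1 < K /\ r2 < K /\ regs_lt K c
  end.

Lemma comp_length c base : length (comp c base) = csize c.
Proof.
  revert base. induction c; intros base; cbn; rewrite ?length_app; cbn; auto.
  rewrite IHc. lia.
Qed.

Lemma regs_lt_mono K K' c : K <= K' -> regs_lt K c -> regs_lt K' c.
Proof. intros HK. induction c; cbn; intros; try lia; intuition (auto; lia). Qed.

Lemma regs_lt_ex c : exists K, regs_lt K c.
Proof.
  induction c as [r|r|c1 [K1 H1] c2 [K2 H2]|r1 r2 c [K H]].
  - exists (S r). cbn. lia.
  - exists (S r). cbn. lia.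
  - exists (K1 + K2). cbn. split; eapply regs_lt_mono; try eassumption; lia.
  - exists (K + S r1 + S r2). cbn. repeat split; try lia.
    eapply regs_lt_mono; try eassumption; lia.
Qed.

Lemma nth_error_mid {A} (pre post : list A) a n : length pre = n ->
  nth_error (pre ++ a :: post) n = Some a.
Proof. intros <-. rewrite nth_error_app2, Nat.sub_diag; auto. Qed.

Section Compile.
Variables (code : list instr) (K n : nat).
Let sp := n + 1.
Let M := machine code K.

Lemma run_zero pc r s tape : nth_error code pc = Some (IZero r) -> r < K ->
  s r < 2 ^ n -> repr K s tape -> exists tape',
  steps M sp (mkc (st pc) 0 tape) (mkc (st (S pc)) 0 tape') /\ repr K (upd s r 0) tape'.
Proof.
  intros E Hr Hs [R1 R2].
  assert (Hpc : pc < length code) by (apply nth_error_Some; congruence).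
  destruct (scan_zero code K sp pc r E Hr n (s r) 0 tape) as (h & t1 & Hh & H1 & H2 & _ & H3);
    [auto | unfold sp; lia | intros i; apply R1, Hr |].
  assert (R2' : forall i, dgt K (t1 i) = if i =? 0 then 1 else 0)
    by (intros i; rewrite H3 by lia; apply R2).
  destruct (return_home code K sp pc _ 1 h E ltac:(lia) Hh t1 R2') as (t2 & H4 & H5).
  exists t2. split.
  - eapply steps_trans; [exact H1|]. cbn [target] in H4. rewrite Nat.min_l in H4 by lia. exact H4.
  - split; [|intros i; rewrite H5 by lia; apply R2'].
    intros i r' Hr'. rewrite H5 by lia. unfold upd. destruct (Nat.eqb_spec r' r) as [->|Hn].
    + rewrite dig_zero. apply H2.
    + rewrite H3 by auto. now apply R1.
Qed.

Lemma run_inc pc r s tape : nth_error code pc = Some (IInc r) -> r < K ->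
  S (s r) < 2 ^ n -> repr K s tape -> exists tape',
  steps M sp (mkc (st pc) 0 tape) (mkc (st (S pc)) 0 tape') /\ repr K (upd s r (S (s r))) tape'.
Proof.
  intros E Hr Hs [R1 R2].
  assert (Hpc : pc < length code) by (apply nth_error_Some; congruence).
  destruct (scan_inc code K sp pc r E Hr n (s r) 0 tape) as (h & t1 & Hh & H1 & H2 & _ & H3);
    [auto | unfold sp; lia | intros i; apply R1, Hr |].
  assert (R2' : forall i, dgt K (t1 i) = if i =? 0 then 1 else 0)
    by (intros i; rewrite H3 by lia; apply R2).
  destruct (return_home code K sp pc _ 1 h E ltac:(lia) Hh t1 R2') as (t2 & H4 & H5).
  exists t2. split.
  - eapply steps_trans; [exact H1|]. cbn [target] in H4. rewrite Nat.min_l in H4 by lia. exact H4.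
  - split; [|intros i; rewrite H5 by lia; apply R2'].
    intros i r' Hr'. rewrite H5 by lia. unfold upd. destruct (Nat.eqb_spec r' r) as [->|Hn].
    + apply H2.
    + rewrite H3 by auto. now apply R1.
Qed.

Lemma run_eq pc r1 r2 t1 t2 s tape : nth_error code pc = Some (IEq r1 r2 t1 t2) ->
  r1 < K -> r2 < K -> t1 <= S (length code) -> t2 <= S (length code) ->
  s r1 < 2 ^ n -> s r2 < 2 ^ n -> repr K s tape -> exists tape',
  steps M sp (mkc (st pc) 0 tape) (mkc (st (if s r1 =? s r2 then t1 else t2)) 0 tape') /\
  repr K s tape'.
Proof.
  intros E Hr1 Hr2 Ht1 Ht2 Hs1 Hs2 [R1 R2].
  destruct (scan_eq code K sp pc r1 r2 t1 t2 E n (s r1) (s r2) 0 tape) as (h & u1 & Hh & H1 & H3);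
    [auto | auto | unfold sp; lia | intros i; apply R1, Hr1 | intros i; apply R1, Hr2 |].
  assert (R2' : forall i, dgt K (u1 i) = if i =? 0 then 1 else 0)
    by (intros i; rewrite H3; apply R2).
  destruct (return_home code K sp pc _ (if s r1 =? s r2 then 1 else 2) h E
              ltac:(destruct (s r1 =? s r2); lia) Hh u1 R2') as (u2 & H4 & H5).
  exists u2. split.
  - eapply steps_trans; [exact H1|]. cbn [target] in H4.
    rewrite Nat.min_l in H4 by (destruct (s r1 =? s r2); cbn [Nat.eqb]; lia).
    destruct (s r1 =? s r2); exact H4.
  - split; [|intros i; rewrite H5 by lia; apply R2'].
    intros i r' Hr'. rewrite H5 by lia. rewrite H3. now apply R1.
Qed.

(** Induction on the execution, not on the program, since a loop recurs to itself. The code before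
    and after is arbitrary because subprograms sit inside larger ones. [B < 2 ^ n] makes every
    numeral fit into n cells, and [sp] has one more for its end digit. *)
Lemma comp_correct B c s s' : B < 2 ^ n -> exec B c s s' ->
  forall base pre post tape, code = pre ++ comp c base ++ post -> length pre = base ->
  regs_lt K c -> (forall r, s r <= B) -> repr K s tape ->
  exists tape', steps M sp (mkc (st base) 0 tape) (mkc (st (base + csize c)) 0 tape') /\
                repr K s' tape'.
Proof.
  intros HB. induction 1 as [r s|r s Hs|c1 c2 s1 s2 s3 X1 IH1 X2 IH2|r1 r2 c s Hs
                            |r1 r2 c s1 s2 s3 Hs X1 IH1 X2 IH2];
    intros base pre post tape Hc Hpre Hr HsB Ht; cbn [csize comp regs_lt app] in *.
  - rewrite Nat.add_1_r. apply run_zero; auto.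
    + rewrite Hc. now apply nth_error_mid.
    + specialize (HsB r). lia.
  - rewrite Nat.add_1_r. apply run_inc; auto; [|lia].
    rewrite Hc. now apply nth_error_mid.
  - destruct Hr as [Hr1 Hr2].
    destruct (IH1 base pre (comp c2 (base + csize c1) ++ post) tape) as (t1 & S1 & R1); auto.
    { now rewrite Hc, <- app_assoc. }
    destruct (IH2 (base + csize c1) (pre ++ comp c1 base) post t1) as (t2 & S2 & R2); auto.
    { rewrite Hc. now rewrite !app_assoc. }
    { rewrite length_app, comp_length. lia. }
    { now apply (exec_bound B c1 s1). }
    exists t2. split; [|auto]. eapply steps_trans; [exact S1|].
    now replace (base + (csize c1 + csize c2)) with (base + csize c1 + csize c2) by lia.
  - assert (Hl : length code = base + (2 + csize c) + length post).
    { rewrite Hc, length_app, Hpre. cbn [length]. rewrite !length_app, comp_length. cbn [length]. lia. }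
    pose proof (HsB r1). pose proof (HsB r2).
    destruct (run_eq base r1 r2 (base + (2 + csize c)) (S base) s tape) as (t1 & S1 & R1);
      try (auto; lia).
    { rewrite Hc. now apply nth_error_mid. }
    exists t1. split; auto. rewrite Hs, Nat.eqb_refl in S1. exact S1.
  - assert (Hl : length code = base + (2 + csize c) + length post).
    { rewrite Hc, length_app, Hpre. cbn [length]. rewrite !length_app, comp_length. cbn [length]. lia. }
    pose proof (HsB r1). pose proof (HsB r2).
    destruct (run_eq base r1 r2 (base + (2 + csize c)) (S base) s1 tape) as (t1 & S1 & R1);
      try (auto; lia).
    { rewrite Hc. now apply nth_error_mid. }
    destruct (Nat.eqb_spec (s1 r1) (s1 r2)) as [|_]; [contradiction|].
    destruct (IH1 (S base) (pre ++ [IEq r1 r2 (base + (2 + csize c)) (S base)])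
                (IEq r1 r1 base base :: post) t1) as (t2 & S2 & R2); try tauto.
    { rewrite Hc, <- !app_assoc. reflexivity. }
    { rewrite length_app. cbn [length]. lia. }
    assert (HsB2 : forall r, s2 r <= B) by (eapply exec_bound; eauto).
    pose proof (HsB2 r1).
    destruct (run_eq (S base + csize c) r1 r1 base base s2 t2) as (t3 & S3 & R3);
      try (auto; lia).
    { assert (Hc' : code = (pre ++ IEq r1 r2 (base + (2 + csize c)) (S base) :: comp c (S base)) ++
                        IEq r1 r1 base base :: post).
      { rewrite Hc, <- !app_assoc. reflexivity. }
      rewrite Hc'. apply nth_error_mid. rewrite length_app. cbn [length]. rewrite comp_length. lia. }
    destruct (IH2 base pre post t3) as (t4 & S4 & R4); auto.
    exists t4. split; auto.
    eapply steps_trans; [exact S1|]. eapply steps_trans; [exact S2|].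
    eapply steps_trans; [|exact S4]. destruct (s2 r1 =? s2 r1); exact S3.
Qed.
End Compile.

(** * Words as numbers, and the machine for a program *)

Fixpoint code (x : list bool) : nat :=
  match x with [] => 0 | b :: l => 2 * code l + 1 + Nat.b2n b end.

Lemma dig_code x i : dig i (code x) =
  if Nat.ltb i (length x) then (if nth i x false then 2 else 1) else 0.
Proof.
  revert i. induction x as [|b x IH]; intros i; cbn [code]; [apply dig_zero|].
  destruct i as [|i].
  - destruct b; cbn [Nat.b2n].
    + replace (2 * code x + 1 + 1) with (2 * code x + 2) by lia. apply dig_even0.
    + rewrite Nat.add_0_r. apply dig_odd0.
  - transitivity (dig i (code x)).
    + destruct b; cbn [Nat.b2n].
      * replace (2 * code x + 1 + 1) with (2 * code x + 2) by lia. apply dig_evenS.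
      * rewrite Nat.add_0_r. apply dig_oddS.
    + now rewrite IH.
Qed.

Lemma code_lt x : S (code x) < 2 ^ S (length x).
Proof.
  induction x as [|b x IH]; [cbn; lia|]. cbn [code length]. rewrite Nat.pow_succ_r'.
  destruct b; cbn [Nat.b2n]; lia.
Qed.

Lemma dgt_small r g : g < 3 -> dgt (S r) g = 0.
Proof.
  intros H. cbn [dgt]. rewrite Nat.div_small by lia.
  induction r; cbn; auto.
Qed.

(** Two appended instructions turn the result into a verdict: a register is zeroed and register 1
    compared with it. Equality jumps to the address [length prog], which rejects, inequality to the
    one behind it, which accepts. *)
Lemma PSPACE_of_cmd (L : list bool -> Prop) (c : cmd) (a k : nat) :
  (forall x, exists s', exec (2 ^ (a * S (length x) ^ k)) c (fun r => if r =? 0 then code x else 0) s' /\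
     code x <= 2 ^ (a * S (length x) ^ k) /\
     (s' 1 <> 0 <-> L x)) ->
  PSPACE L.
Proof.
  intros H. destruct (regs_lt_ex c) as [K0 HK0].
  (* The offset 2 keeps [z] apart from the result register 1. *)
  set (z := K0 + 2). set (K := S z).
  set (prog := comp c 0 ++ [IZero z; IEq 1 z (csize c + 2) (csize c + 3)]).
  assert (Hlen : length prog = csize c + 2).
  { unfold prog. rewrite length_app, comp_length. reflexivity. }
  assert (HK : regs_lt K c) by (eapply regs_lt_mono; [|exact HK0]; unfold K, z; lia).
  exists (machine prog K), (a + 3), k. split; [apply machine_wf|].
  intros x. destruct (H x) as (s' & X & Hx & HL).
  set (p := a * S (length x) ^ k) in *.
  set (s := fun r => if r =? 0 then code x else 0) in *.
  assert (Hpow : 0 < S (length x) ^ k) by (apply Nat.neq_0_lt_0, Nat.pow_nonzero; lia).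
  (* Values up to 2^p have at most p + 1 digits; with the end digit this makes p + 2 cells, which
     the summand 3 in [a + 3] pays for. *)
  assert (Hsp : p + 2 < (a + 3) * S (length x) ^ k) by (unfold p; lia).
  assert (HB : 2 ^ p < 2 ^ (p + 1)) by (apply Nat.pow_lt_mono_r; lia).
  assert (Hs : forall r, s r <= 2 ^ p) by (intros r; unfold s; destruct (r =? 0); lia).
  (* The tape after the first step, which puts the mark on cell 0 and leaves the input word on track
     0. *)
  set (tape0 := fun i => if i =? 0 then setd K 1 (c_tape (init_config x) 0)
                         else c_tape (init_config x) i).
  assert (HG : forall i, c_tape (init_config x) i < 3).
  { intros i. cbn [init_config c_tape]. destruct (Nat.ltb i (length x)), (nth i x false); lia. }
  assert (R0 : repr K s tape0).
  { split.
    - intros i r Hr. unfold tape0.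
      transitivity (dgt r (c_tape (init_config x) i)).
      + destruct (Nat.eqb_spec i 0) as [->|]; auto. apply dgt_setd_neq; lia.
      + unfold s. destruct r as [|r]; cbn [Nat.eqb].
        * rewrite dig_code. cbn [dgt init_config c_tape].
          rewrite Nat.mod_small; [auto|]. apply HG.
        * rewrite dgt_small, dig_zero; auto.
    - intros i. unfold tape0. destruct (i =? 0).
      + apply dgt_setd. lia.
      + unfold K. now apply dgt_small. }
  destruct (comp_correct prog K (p + 1) (2 ^ p) c s s' HB X 0 []
              [IZero z; IEq 1 z (csize c + 2) (csize c + 3)] tape0) as (t1 & S1 & R1); auto.
  cbn [Nat.add] in S1.
  assert (Hs' : forall r, s' r <= 2 ^ p) by (eapply exec_bound; eauto).
  destruct (run_zero prog K (p + 1) (csize c) z s' t1) as (t2 & S2 & R2); auto.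
  { unfold prog. apply nth_error_mid, comp_length. }
  { specialize (Hs' z). lia. }
  destruct (run_eq prog K (p + 1) (S (csize c)) 1 z (csize c + 2) (csize c + 3) (upd s' z 0) t2)
    as (t3 & S3 & R3); auto; try (unfold K, z; lia); try lia.
  { unfold prog. change [IZero z; IEq 1 z (csize c + 2) (csize c + 3)] with
      ([IZero z] ++ [IEq 1 z (csize c + 2) (csize c + 3)]).
    rewrite app_assoc. apply nth_error_mid. rewrite length_app, comp_length. cbn; lia. }
  { unfold upd. destruct (Nat.eqb_spec 1 z); [unfold z in *; lia|]. specialize (Hs' 1). lia. }
  { unfold upd. rewrite Nat.eqb_refl. apply Nat.neq_0_lt_0, Nat.pow_nonzero; lia. }
  assert (E : (upd s' z 0 1 =? upd s' z 0 z) = (s' 1 =? 0)).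
  { unfold upd. rewrite Nat.eqb_refl. destruct (Nat.eqb_spec 1 z); [unfold z in *; lia|auto]. }
  rewrite E in S3.
  assert (S0 : steps (machine prog K) (p + 1 + 1) (init_config x) (mkc (st 0) 0 tape0)).
  { apply steps_one; [cbn; lia| |cbn; lia].
    unfold step, halted. cbn [c_state init_config machine tm_acc tm_rej].
    unfold st at 1 2. cbn [Nat.eqb orb]. reflexivity. }
  pose proof (steps_trans _ _ _ _ _ S0 (steps_trans _ _ _ _ _ S1
               (steps_trans _ _ _ _ _ S2 S3))) as [T [ET HT]].
  exists T. unfold run. rewrite ET.
  unfold halted. cbn [c_state mkc machine tm_acc tm_rej]. rewrite Hlen.
  split; [|split].
  - destruct (s' 1 =? 0); apply Bool.orb_true_iff; [right|left]; apply Nat.eqb_eq; f_equal; lia.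
  - intros t Ht. specialize (HT t Ht). lia.
  - rewrite <- HL. unfold st. destruct (Nat.eqb_spec (s' 1) 0); split; intros; lia.
Qed.

(** * Polynomially space bounded functions *)

Definition polyn (p : nat -> nat) : Prop := exists c k, forall m, p m <= c * S m ^ k.

Lemma pow_ge1 m k : 1 <= S m ^ k.
Proof. apply Nat.neq_0_lt_0, Nat.pow_nonzero. lia. Qed.

Lemma poly_le p q : (forall m, p m <= q m) -> polyn q -> polyn p.
Proof. intros H [c [k Hq]]. exists c, k. intros m. eapply Nat.le_trans; eauto. Qed.

Lemma poly_const a : polyn (fun _ => a).
Proof. exists a, 0. intros m. cbn. lia. Qed.

Lemma poly_id : polyn (fun m => m).
Proof. exists 1, 1. intros m. cbn. lia. Qed.

Lemma poly_mul p q : polyn p -> polyn q -> polyn (fun m => p m * q m).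
Proof.
  intros [c [k H]] [c' [k' H']]. exists (c * c'), (k + k'). intros m.
  rewrite Nat.pow_add_r. specialize (H m). specialize (H' m).
  transitivity ((c * S m ^ k) * (c' * S m ^ k')); [now apply Nat.mul_le_mono|].
  apply Nat.eq_le_incl. ring.
Qed.

Lemma poly_add p q : polyn p -> polyn q -> polyn (fun m => p m + q m).
Proof.
  intros Hp Hq.
  apply poly_le with (fun m => (1 + p m) * (1 + q m)); [intros m; lia|].
  assert (HS : forall r, polyn r -> polyn (fun m => 1 + r m)).
  { intros r [c [k H]]. exists (S c), k. intros m. specialize (H m).
    pose proof (pow_ge1 m k). lia. }
  apply poly_mul; auto.
Qed.

Lemma poly_pow p k : polyn p -> polyn (fun m => p m ^ k).
Proof.
  intros H. induction k as [|k IH]; cbn; [apply poly_const|]. now apply poly_mul.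
Qed.

Lemma poly_comp p q : polyn p -> polyn q -> polyn (fun m => p (q m)).
Proof.
  intros [c [k H]] Hq. apply poly_le with (fun m => c * (1 + q m) ^ k); [intros m; apply H|].
  apply poly_mul; [apply poly_const|]. apply poly_pow, poly_add; auto using poly_const.
Qed.

Definition vbounded (B : nat) (v : list nat) : Prop := Forall (fun x => x <= B) v.

Definition PB (f : list nat -> nat) : Prop :=
  exists p, polyn p /\ forall m v, vbounded (2 ^ m) v -> f v <= 2 ^ p m.

Lemma pow2_mono a b : a <= b -> 2 ^ a <= 2 ^ b.
Proof. intros. apply Nat.pow_le_mono_r; lia. Qed.

Lemma bounded_mono B B' v : B <= B' -> vbounded B v -> vbounded B' v.
Proof. intros H. apply Forall_impl. intros; lia. Qed.

Lemma PB_le f g : (forall v, f v <= g v) -> PB g -> PB f.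
Proof.
  intros H [p [Hp Hg]]. exists p. split; auto. intros m v Hv.
  eapply Nat.le_trans; [apply H|auto].
Qed.

Lemma PB_add f g : PB f -> PB g -> PB (fun v => f v + g v).
Proof.
  intros [p [Hp Hf]] [q [Hq Hg]]. exists (fun m => 1 + (p m + q m)).
  split; [auto using poly_add, poly_const|]. intros m v Hv.
  specialize (Hf m v Hv). specialize (Hg m v Hv).
  pose proof (pow2_mono (p m) (p m + q m)). pose proof (pow2_mono (q m) (p m + q m)).
  rewrite Nat.pow_add_r. change (2 ^ 1) with 2. lia.
Qed.

Lemma PB_mul f g : PB f -> PB g -> PB (fun v => f v * g v).
Proof.
  intros [p [Hp Hf]] [q [Hq Hg]]. exists (fun m => p m + q m).
  split; [auto using poly_add|]. intros m v Hv. rewrite Nat.pow_add_r.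
  apply Nat.mul_le_mono; auto.
Qed.

Lemma PB_const a : PB (fun _ => a).
Proof.
  exists (fun _ => a). split; [apply poly_const|]. intros m v _.
  apply Nat.lt_le_incl, Nat.pow_gt_lin_r. lia.
Qed.

(* The polynomially space bounded functions. The program receives its arguments
   in the registers L, leaves the registers below d alone, returns its result in
   register d, and never stores a value above 2^poly(m) if its arguments are
   at most 2^m. *)
Definition PS (f : list nat -> nat) : Prop :=
  PB f /\
  exists p, polyn p /\ forall L d, Forall (fun r => r < d) L ->
  exists c, forall m B s, 2 ^ p m <= B -> vbounded (2 ^ m) (map s L) -> (forall r, s r <= B) ->
  exists s', exec B c s s' /\ s' d = f (map s L) /\ forall r, r < d -> s' r = s r.

Lemma PS_PB f : PS f -> PB f.
Proof. intros [H _]. exact H. Qed.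

Lemma PS_ext f g : (forall v, f v = g v) -> PS f -> PS g.
Proof.
  intros E [Hb [p [Hp H]]]. split.
  - apply PB_le with f; auto. intros v. now rewrite E.
  - exists p. split; auto. intros L d HL. destruct (H L d HL) as [c Hc]. exists c.
    intros m B s HB Hm Hs. destruct (Hc m B s HB Hm Hs) as [s' Hs']. exists s'. now rewrite <- E.
Qed.

(** * Composition and bounded recursion *)

Definition CCopy (r r' : nat) : cmd := CSeq (CZero r) (CWhile r r' (CInc r)).

(** Counting [r] up to [r'] may take exponentially many steps, but stores no value beyond [s r']. *)
Lemma exec_copy B r r' s : r <> r' -> s r' <= B ->
  exists s', exec B (CCopy r r') s s' /\ s' r = s r' /\ forall x, x <> r -> s' x = s x.
Proof.
  intros Hn HB.
  assert (Hloop : forall k s1, s1 r + k = s1 r' -> s1 r' <= B ->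
            exists s', exec B (CWhile r r' (CInc r)) s1 s' /\ s' r = s1 r' /\
                       forall x, x <> r -> s' x = s1 x).
  { induction k as [|k IH]; intros s1 Hk HB1.
    - exists s1. repeat split; [apply XWhileF; lia|lia].
    - destruct (IH (upd s1 r (S (s1 r)))) as (s' & X & H1 & H2).
      + unfold upd. rewrite Nat.eqb_refl. destruct (Nat.eqb_spec r' r); lia.
      + unfold upd. destruct (Nat.eqb_spec r' r); lia.
      + exists s'. split; [|split].
        * eapply XWhileT; [lia| |exact X]. apply XInc. lia.
        * rewrite H1. unfold upd. destruct (Nat.eqb_spec r' r); lia.
        * intros x Hx. rewrite H2 by auto. unfold upd. destruct (Nat.eqb_spec x r); lia. }
  destruct (Hloop (s r') (upd s r 0)) as (s' & X & H1 & H2).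
  - unfold upd. rewrite Nat.eqb_refl. destruct (Nat.eqb_spec r' r); lia.
  - unfold upd. destruct (Nat.eqb_spec r' r); lia.
  - exists s'. split; [|split].
    + eapply XSeq; [apply XZero|exact X].
    + rewrite H1. unfold upd. destruct (Nat.eqb_spec r' r); lia.
    + intros x Hx. rewrite H2 by auto. unfold upd. destruct (Nat.eqb_spec x r); lia.
Qed.

Lemma map_ext_lt (s s' : nat -> nat) L d :
  Forall (fun r => r < d) L -> (forall r, r < d -> s' r = s r) -> map s' L = map s L.
Proof.
  intros HL H. apply map_ext_in. intros r Hr. apply H. eapply Forall_forall in HL; eauto.
Qed.

Lemma PS_zero : PS (fun _ => 0).
Proof.
  split; [apply PB_const|]. exists (fun _ => 0). split; [apply poly_const|].
  intros L d HL. exists (CZero d). intros m B s HB Hm Hs. eexists. split; [apply XZero|].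
  unfold upd. rewrite Nat.eqb_refl. split; auto. intros r Hr. destruct (Nat.eqb_spec r d); lia.
Qed.

Lemma PS_succ f : PS f -> PS (fun v => S (f v)).
Proof.
  intros [Hb [p [Hp H]]]. split.
  - apply PB_le with (fun v => f v + 1); [intros; lia|]. apply PB_add; auto using PB_const.
  - destruct Hb as [q [Hq Hf]]. exists (fun m => 1 + (p m + q m)).
    split; [auto using poly_add, poly_const|]. intros L d HL. destruct (H L d HL) as [c Hc].
    exists (CSeq c (CInc d)). intros m B s HB Hm Hs.
    rewrite Nat.pow_add_r in HB. change (2 ^ 1) with 2 in HB.
    pose proof (pow2_mono (p m) (p m + q m)). pose proof (pow2_mono (q m) (p m + q m)).
    assert (0 < 2 ^ (p m + q m)) by (apply Nat.neq_0_lt_0, Nat.pow_nonzero; lia).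
    destruct (Hc m B s) as (s' & X & E & E'); [lia|auto|auto|].
    specialize (Hf m _ Hm).
    eexists. split; [eapply XSeq; [exact X|apply XInc; lia]|].
    unfold upd. rewrite Nat.eqb_refl. split; [lia|]. intros r Hr.
    destruct (Nat.eqb_spec r d); [lia|auto].
Qed.

Lemma PS_const a : PS (fun _ => a).
Proof. induction a; [apply PS_zero|now apply PS_succ]. Qed.

Lemma PS_var j : PS (fun v => nth j v 0).
Proof.
  split.
  - exists (fun m => m). split; [apply poly_id|]. intros m v Hv. destruct (nth_in_or_default j v 0) as [Hi| ->].
    + eapply Forall_forall in Hv; eauto.
    + lia.
  - exists (fun m => m). split; [apply poly_id|]. intros L d HL.
    destruct (Nat.lt_ge_cases j (length L)) as [Hj|Hj].
    + exists (CCopy d (nth j L 0)). intros m B s HB Hm Hs.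
      assert (Hin : In (nth j L 0) L) by now apply nth_In.
      assert (nth j L 0 < d) by (eapply Forall_forall in HL; eauto).
      destruct (exec_copy B d (nth j L 0) s) as (s' & X & E & E'); [lia|auto|].
      exists s'. split; auto. split.
      * rewrite E. rewrite (nth_indep (map s L) 0 (s 0)) by now rewrite length_map.
        now rewrite map_nth.
      * intros r Hr. apply E'. lia.
    + exists (CZero d). intros m B s HB Hm Hs. eexists. split; [apply XZero|].
      unfold upd. rewrite Nat.eqb_refl, nth_overflow by now rewrite length_map.
      split; auto. intros r Hr. destruct (Nat.eqb_spec r d); lia.
Qed.

Lemma bounded_tl B v : vbounded B v -> vbounded B (tl v).
Proof. intros H. destruct H; cbn; [constructor|auto]. Qed.

Lemma PS_wk f : PS f -> PS (fun v => f (tl v)).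
Proof.
  intros [[q [Hq Hf]] [p [Hp H]]]. split.
  - exists q. split; auto. intros m v Hv. apply Hf. now apply bounded_tl.
  - exists p. split; auto. intros L d HL. destruct (H (tl L) d) as [c Hc].
    { destruct HL; cbn; [constructor|auto]. }
    exists c. intros m B s HB Hm Hs.
    assert (E : tl (map s L) = map s (tl L)) by now destruct L. rewrite E.
    apply Hc with m; auto. rewrite <- E. now apply bounded_tl.
Qed.

Lemma Forall_itl (P : nat -> Prop) k v : Forall P v -> Forall P (Nat.iter k (@tl nat) v).
Proof.
  intros H. induction k as [|k IH]; [exact H|]. rewrite Nat.iter_succ.
  destruct IH; [constructor|auto].
Qed.

Lemma map_itl (s : nat -> nat) k v : map s (Nat.iter k (@tl nat) v) = Nat.iter k (@tl nat) (map s v).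
Proof.
  induction k as [|k IH]; [reflexivity|]. rewrite !Nat.iter_succ, <- IH.
  now destruct (Nat.iter k (@tl nat) v).
Qed.

(** Environments are lists of values, and binders push at the front. Testing an edge between two
    computed nodes means dropping the k innermost entries and pushing the two values, as the search
    step for reachability does with k = 2. *)
Lemma PS_subst2 f g h k : PS f -> PS g -> PS h ->
  PS (fun v => h (f v :: g v :: Nat.iter k (@tl nat) v)).
Proof.
  intros [[pf [Hpf Bf]] [p [Hp Cf]]] [[pg [Hpg Bg]] [q [Hq Cg]]] [[ph [Hph Bh]] [r [Hr Ch]]].
  set (w := fun m => m + (pf m + pg m)).
  assert (Hw : polyn w) by (unfold w; auto using poly_add, poly_id).
  assert (Hb : forall m v, vbounded (2 ^ m) v ->
            vbounded (2 ^ w m) (f v :: g v :: Nat.iter k (@tl nat) v)).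
  { intros m v Hv. constructor; [|constructor].
    - eapply Nat.le_trans; [apply Bf, Hv|]. apply pow2_mono. unfold w; lia.
    - eapply Nat.le_trans; [apply Bg, Hv|]. apply pow2_mono. unfold w; lia.
    - apply Forall_itl. eapply bounded_mono; [|exact Hv]. apply pow2_mono. unfold w; lia. }
  split.
  - exists (fun m => ph (w m)). split; [now apply poly_comp|]. intros m v Hv. apply Bh, Hb, Hv.
  - exists (fun m => p m + (q m + r (w m))). split.
    { apply poly_add; auto. apply poly_add; auto. now apply poly_comp. }
    intros L d HL. destruct (Cf L d HL) as [c1 H1].
    assert (HL1 : Forall (fun r => r < S d) L)
      by (eapply Forall_impl; [|exact HL]; cbn; intros; lia).
    destruct (Cg L (S d) HL1) as [c2 H2].
    destruct (Ch (d :: S d :: Nat.iter k (@tl nat) L) (S (S d))) as [c3 H3].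
    { constructor; [lia|]. constructor; [lia|]. apply Forall_itl.
      eapply Forall_impl; [|exact HL]. cbn; intros; lia. }
    exists (CSeq c1 (CSeq c2 (CSeq c3 (CCopy d (S (S d)))))). intros m B s HB Hm Hs.
    destruct (H1 m B s) as (s1 & X1 & E1 & F1); auto.
    { eapply Nat.le_trans; [|exact HB]. apply pow2_mono. lia. }
    assert (V1 : map s1 L = map s L) by now apply map_ext_lt with d.
    assert (B1 : forall r, s1 r <= B) by (eapply exec_bound; eauto).
    destruct (H2 m B s1) as (s2 & X2 & E2 & F2); auto.
    { eapply Nat.le_trans; [|exact HB]. apply pow2_mono. lia. }
    { now rewrite V1. }
    assert (V2 : map s2 L = map s L) by (rewrite <- V1; now apply map_ext_lt with (S d)).
    assert (B2 : forall r, s2 r <= B) by (eapply exec_bound; eauto).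
    assert (Em : map s2 (d :: S d :: Nat.iter k (@tl nat) L) =
                 f (map s L) :: g (map s L) :: Nat.iter k (@tl nat) (map s L)).
    { cbn [map]. now rewrite map_itl, V2, E2, V1, F2, E1 by lia. }
    destruct (H3 (w m) B s2) as (s3 & X3 & E3 & F3); auto.
    { eapply Nat.le_trans; [|exact HB]. apply pow2_mono. lia. }
    { rewrite Em. now apply Hb. }
    assert (B3 : forall r, s3 r <= B) by (eapply exec_bound; eauto).
    destruct (exec_copy B d (S (S d)) s3) as (s4 & X4 & E4 & F4); [lia|auto|].
    exists s4. split; [|split].
    + eapply XSeq; [exact X1|]. eapply XSeq; [exact X2|]. eapply XSeq; [exact X3|exact X4].
    + now rewrite E4, E3, Em.
    + intros x Hx. now rewrite F4, F3, F2, F1 by lia.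
Qed.

Definition iterv (z : nat) (h : nat -> nat -> nat) (n : nat) : nat :=
  nat_rect (fun _ => nat) z h n.

(** The number of rounds may be exponential, so composing the growth of [h] with itself gives no
    useful bound; the size of the iterates comes from [b] alone. A plain counting loop implements
    the recursion. *)
Lemma PS_iter_env (N Z : list nat -> nat) (h b : list nat -> nat) :
  PS N -> PS Z -> PS h -> PB b ->
  (forall v i, i <= N v -> iterv (Z v) (fun i a => h (a :: i :: v)) i <= b v) ->
  PS (fun v => iterv (Z v) (fun i a => h (a :: i :: v)) (N v)).
Proof.
  intros [[pn [Hpn Bn]] [qn [Hqn CN]]] [_ [qz [Hqz CZ]]] [_ [qh [Hqh CH]]] [pb [Hpb Bb]] Hit.
  split.
  { exists pb. split; auto. intros m v Hv. eapply Nat.le_trans; [apply Hit|]; auto. }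
  set (w := fun m => m + (pn m + pb m)).
  assert (Hw : polyn w) by (unfold w; auto using poly_add, poly_id).
  exists (fun m => w m + (qn m + (qz m + qh (w m)))). split.
  { apply poly_add; auto. apply poly_add; auto. apply poly_add; auto. now apply poly_comp. }
  intros L d HL.
  destruct (CN L d HL) as [cN XN].
  destruct (CZ L (S (S d))) as [cZ XZ].
  { eapply Forall_impl; [|exact HL]. cbn; intros; lia. }
  destruct (CH (S (S d) :: S d :: L) (S (S (S d)))) as [cH XH].
  { constructor; [lia|constructor; [lia|]]. eapply Forall_impl; [|exact HL]. cbn; intros; lia. }
  (* Register d holds the number of rounds, d+1 the counter, d+2 the accumulator, and d+3 the value
     just computed by [h]. *)
  set (body := CSeq cH (CSeq (CCopy (S (S d)) (S (S (S d)))) (CInc (S d)))).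
  exists (CSeq cN (CSeq cZ (CSeq (CZero (S d))
            (CSeq (CWhile (S d) d body) (CCopy d (S (S d))))))).
  intros m B s HB Hm Hs. set (v := map s L) in *.
  assert (HBw : 2 ^ w m <= B) by (eapply Nat.le_trans; [|exact HB]; apply pow2_mono; lia).
  assert (HBn : 2 ^ pn m <= B) by (eapply Nat.le_trans; [|exact HBw]; apply pow2_mono; unfold w; lia).
  assert (HBb : 2 ^ pb m <= B) by (eapply Nat.le_trans; [|exact HBw]; apply pow2_mono; unfold w; lia).
  destruct (XN m B s) as (s1 & X1 & E1 & F1); auto.
  { eapply Nat.le_trans; [|exact HB]. apply pow2_mono. lia. }
  fold v in E1.
  assert (V1 : map s1 L = v) by now apply map_ext_lt with d.
  assert (B1 : forall r, s1 r <= B) by (eapply exec_bound; eauto).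
  destruct (XZ m B s1) as (s2 & X2 & E2 & F2); auto.
  { eapply Nat.le_trans; [|exact HB]. apply pow2_mono. lia. }
  { now rewrite V1. }
  rewrite V1 in E2.
  assert (B2 : forall r, s2 r <= B) by (eapply exec_bound; eauto).
  set (s3 := upd s2 (S d) 0).
  assert (X3 : exec B (CZero (S d)) s2 s3) by apply XZero.
  assert (B3 : forall r, s3 r <= B) by (eapply exec_bound; eauto).
  assert (Hloop : forall k i t, i + k = N v -> t d = N v -> t (S d) = i ->
     t (S (S d)) = iterv (Z v) (fun i a => h (a :: i :: v)) i ->
     (forall r, r < d -> t r = s r) -> (forall r, t r <= B) ->
     exists t', exec B (CWhile (S d) d body) t t' /\
       t' (S (S d)) = iterv (Z v) (fun i a => h (a :: i :: v)) (N v) /\ (forall r, r < d -> t' r = s r)).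
  { induction k as [|k IH]; intros i t Hk Td Ti Ta Tr Tb.
    - exists t. split; [apply XWhileF; lia|]. split; auto. rewrite Ta. f_equal. lia.
    - assert (V2 : map t L = v) by now apply map_ext_lt with d.
      destruct (XH (w m) B t) as (t1 & Y1 & G1 & K1); auto.
      { eapply Nat.le_trans; [|exact HB]. apply pow2_mono. lia. }
      { cbn [map]. rewrite V2, Ta, Ti. constructor; [|constructor].
        - eapply Nat.le_trans; [apply Hit; lia|]. eapply Nat.le_trans; [apply Bb, Hm|].
          apply pow2_mono. unfold w. lia.
        - transitivity (N v); [lia|]. eapply Nat.le_trans; [apply Bn, Hm|].
          apply pow2_mono. unfold w. lia.
        - eapply bounded_mono; [|exact Hm]. apply pow2_mono. unfold w; lia. }
      cbn [map nth tl] in G1. rewrite V2, Ta, Ti in G1.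
      assert (Tb1 : forall r, t1 r <= B) by (eapply exec_bound; eauto).
      destruct (exec_copy B (S (S d)) (S (S (S d))) t1) as (t2 & Y2 & G2 & K2); auto.
      assert (Tb2 : forall r, t2 r <= B) by (eapply exec_bound; eauto).
      assert (T2i : t2 (S d) = i) by (rewrite K2, K1 by lia; auto).
      assert (HNB : N v <= B) by (eapply Nat.le_trans; [apply Bn, Hm|auto]).
      assert (Y3 : exec B (CInc (S d)) t2 (upd t2 (S d) (S (t2 (S d))))) by (apply XInc; lia).
      destruct (IH (S i) (upd t2 (S d) (S (t2 (S d))))) as (t' & Y' & G' & K').
      { lia. }
      { unfold upd. destruct (Nat.eqb_spec d (S d)); [lia|]. rewrite K2, K1 by lia. auto. }
      { unfold upd. rewrite Nat.eqb_refl. lia. }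
      { unfold upd. destruct (Nat.eqb_spec (S (S d)) (S d)); [lia|]. rewrite G2, G1. reflexivity. }
      { intros r Hr. unfold upd. destruct (Nat.eqb_spec r (S d)); [lia|].
        rewrite K2, K1 by lia. auto. }
      { eapply exec_bound; [exact Y3|auto]. }
      exists t'. split; auto. eapply XWhileT; [lia| |exact Y'].
      eapply XSeq; [exact Y1|]. eapply XSeq; [exact Y2|exact Y3]. }
  destruct (Hloop (N v) 0 s3) as (s4 & X4 & E4 & F4); auto.
  { unfold s3, upd. destruct (Nat.eqb_spec d (S d)); [lia|]. rewrite F2 by lia. auto. }
  { unfold s3, upd. now rewrite Nat.eqb_refl. }
  { unfold s3, upd. destruct (Nat.eqb_spec (S (S d)) (S d)); [lia|]. rewrite E2. reflexivity. }
  { intros r Hr. unfold s3, upd. destruct (Nat.eqb_spec r (S d)); [lia|]. rewrite F2, F1 by lia. auto. }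
  assert (B4 : forall r, s4 r <= B).
  { eapply exec_bound; [exact X4|auto]. }
  destruct (exec_copy B d (S (S d)) s4) as (s5 & X5 & E5 & F5); [lia|auto|].
  exists s5. split; [|split].
  - eapply XSeq; [exact X1|]. eapply XSeq; [exact X2|]. eapply XSeq; [exact X3|].
    eapply XSeq; [exact X4|exact X5].
  - now rewrite E5.
  - intros r Hr. rewrite F5 by lia. auto.
Qed.

Lemma PSPACE_of_PS (L : list bool -> Prop) (f : list nat -> nat) :
  PS f -> (forall x, f [code x] <> 0 <-> L x) -> PSPACE L.
Proof.
  intros [_ [p [Hp H]]] HL. destruct (H [0] 1) as [c Hc]; [constructor; auto|].
  (* [code x] is below 2^(|x| + 1), so the program is used with m = |x| + 1; the summand m makes
     room for the input itself. *)
  destruct (poly_comp (fun m => m + p m) S) as [a [k Ha]].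
  { apply poly_add; auto using poly_id. }
  { apply poly_le with (fun m => 1 + m); auto. apply poly_add; auto using poly_id, poly_const. }
  apply PSPACE_of_cmd with c a k. intros x. specialize (Ha (length x)).
  pose proof (code_lt x) as Hx.
  assert (Hx' : code x <= 2 ^ (a * S (length x) ^ k)).
  { transitivity (2 ^ S (length x)); [lia|]. apply pow2_mono. lia. }
  destruct (Hc (S (length x)) (2 ^ (a * S (length x) ^ k)) (fun r => if r =? 0 then code x else 0))
    as (s' & X & E & _).
  - apply pow2_mono. lia.
  - cbn [map Nat.eqb]. constructor; [lia|constructor].
  - intros r. destruct (r =? 0); lia.
  - exists s'. split; [exact X|]. split; auto. rewrite E. cbn [map Nat.eqb]. apply HL.
Qed.

(** * Arithmetic, predicates and bounded search *)

Lemma PS_iter (N Z : list nat -> nat) (H : nat -> nat -> list nat -> nat) (b : list nat -> nat) :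
  PS N -> PS Z -> PS (fun v => H (nth 1 v 0) (nth 0 v 0) (tl (tl v))) -> PB b ->
  (forall v i, i <= N v -> iterv (Z v) (fun i a => H i a v) i <= b v) ->
  PS (fun v => iterv (Z v) (fun i a => H i a v) (N v)).
Proof.
  intros HN HZ HH Hb Hle.
  exact (PS_iter_env N Z (fun v => H (nth 1 v 0) (nth 0 v 0) (tl (tl v))) b HN HZ HH Hb Hle).
Qed.

Lemma PS_wkn k f : PS f -> PS (fun v => f (Nat.iter k (@tl nat) v)).
Proof.
  revert f. induction k as [|k IH]; intros f Hf; [exact Hf|].
  exact (IH (fun v => f (tl v)) (PS_wk f Hf)).
Qed.

Definition PSB (b : list nat -> bool) : Prop := PS (fun v => Nat.b2n (b v)).

(** With the decision procedure hidden, formulas with bounded quantifiers belong to the class by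
    their syntax; the tactic [ps] finds such proofs from the closure lemmas. *)
Definition PSP (P : list nat -> Prop) : Prop :=
  exists b, PSB b /\ forall v, b v = true <-> P v.

Lemma PSP_wkn k P : PSP P -> PSP (fun v => P (Nat.iter k (@tl nat) v)).
Proof.
  intros [b [Hb H]]. exists (fun v => b (Nat.iter k (@tl nat) v)). split.
  - exact (PS_wkn k (fun v => Nat.b2n (b v)) Hb).
  - intros v. apply H.
Qed.

Create HintDb ps.

(** A function mentioned below k binders shows up composed with the k-fold tail, but only up to
    conversion; hence the separate attempts for each k in [ps_leaf]. *)
Ltac ps_wk k :=
  match goal with
  | |- PS (fun v => nth _ _ 0) => exact (PS_wkn k (fun v => nth _ v 0) (PS_var _))
  | H : PS ?f |- PS (fun v => ?f (@?a v)) => exact (PS_wkn k f H)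
  | H : PSP ?f |- PSP (fun v => ?f (@?a v)) => exact (PSP_wkn k f H)
  end.

Ltac ps_leaf :=
  first [ simple apply PS_const | assumption | simple apply PS_var | ps_wk 1 | ps_wk 2 | ps_wk 3 | ps_wk 4
        | ps_wk 5 | ps_wk 6 | ps_wk 7 | ps_wk 8 | ps_wk 9 | ps_wk 10 | ps_wk 11 | ps_wk 12
        | ps_wk 13 | ps_wk 14 | ps_wk 15 | ps_wk 16 | ps_wk 17 | ps_wk 18 | ps_wk 19 | ps_wk 20 ].

#[export] Hint Extern 0 (PS _) => solve [ps_leaf] : ps.
#[export] Hint Extern 0 (PSP _) => solve [ps_leaf] : ps.
#[export] Hint Resolve PS_succ : ps.

Ltac ps := cbv beta; auto 100 with ps.

Lemma PS_add f g : PS f -> PS g -> PS (fun v => f v + g v).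
Proof.
  intros Hf Hg.
  assert (E : forall v i, iterv (f v) (fun _ a => S a) i = f v + i).
  { intros v i. induction i as [|i IH]; cbn; [lia|]. fold (iterv (f v) (fun _ a => S a) i). lia. }
  eapply PS_ext; [intros v; exact (E v (g v))|].
  apply (PS_iter g f (fun _ a _ => S a) (fun v => f v + g v)); [ps|ps|ps| |].
  - apply PB_add; now apply PS_PB.
  - intros v i Hi. rewrite E. lia.
Qed.
#[export] Hint Resolve PS_add : ps.

Lemma PS_mul f g : PS f -> PS g -> PS (fun v => f v * g v).
Proof.
  intros Hf Hg.
  assert (E : forall v i, iterv 0 (fun _ a => a + f v) i = f v * i).
  { intros v i. induction i as [|i IH]; cbn; [lia|]. fold (iterv 0 (fun _ a => a + f v) i). lia. }
  eapply PS_ext; [intros v; exact (E v (g v))|].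
  apply (PS_iter g (fun _ => 0) (fun _ a v => a + f v) (fun v => f v * g v)); [ps|ps|ps| |].
  - apply PB_mul; now apply PS_PB.
  - intros v i Hi. rewrite E. now apply Nat.mul_le_mono_l.
Qed.
#[export] Hint Resolve PS_mul : ps.

(** The recursion forgets its accumulator and returns the counter, whose last value is the
    predecessor. *)
Lemma PS_pred f : PS f -> PS (fun v => Nat.pred (f v)).
Proof.
  intros Hf.
  assert (E : forall i, iterv 0 (fun i _ => i) i = Nat.pred i) by now destruct i.
  eapply PS_ext; [intros v; exact (E (f v))|].
  apply (PS_iter f (fun _ => 0) (fun i _ _ => i) f); [ps|ps|ps|now apply PS_PB|].
  intros v i Hi. rewrite E. lia.
Qed.
#[export] Hint Resolve PS_pred : ps.

Lemma PS_sub f g : PS f -> PS g -> PS (fun v => f v - g v).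
Proof.
  intros Hf Hg.
  assert (E : forall v i, iterv (f v) (fun _ a => Nat.pred a) i = f v - i).
  { intros v i. induction i as [|i IH]; cbn; [lia|].
    fold (iterv (f v) (fun _ a => Nat.pred a) i). lia. }
  eapply PS_ext; [intros v; exact (E v (g v))|].
  apply (PS_iter g f (fun _ a _ => Nat.pred a) f); [ps|ps|ps|now apply PS_PB|].
  intros v i Hi. rewrite E. lia.
Qed.
#[export] Hint Resolve PS_sub : ps.

(** A conditional is a recursion of at most one round, with the else branch as initial value. *)
Lemma PS_if b f g : PSB b -> PS f -> PS g -> PS (fun v => if b v then f v else g v).
Proof.
  intros Hb Hf Hg.
  assert (E : forall v, iterv (g v) (fun _ _ => f v) (Nat.b2n (b v)) = if b v then f v else g v).
  { intros v. now destruct (b v). }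
  eapply PS_ext; [exact E|]. unfold PSB in Hb.
  apply (PS_iter (fun v => Nat.b2n (b v)) g (fun _ _ v => f v) (fun v => f v + g v)); [ps|ps|ps| |].
  - apply PB_add; now apply PS_PB.
  - intros v [|i] Hi; cbn; lia.
Qed.
#[export] Hint Resolve PS_if : ps.

Lemma PS_b2n b : PSB b -> PS (fun v => Nat.b2n (b v)).
Proof. auto. Qed.
#[export] Hint Resolve PS_b2n : ps.

Lemma PSB_leb f g : PS f -> PS g -> PSB (fun v => f v <=? g v).
Proof.
  intros Hf Hg. unfold PSB.
  apply PS_ext with (fun v => 1 - (f v - g v)); [|ps].
  intros v. destruct (Nat.leb_spec (f v) (g v)); cbn [Nat.b2n]; lia.
Qed.

Lemma PSB_eqb f g : PS f -> PS g -> PSB (fun v => f v =? g v).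
Proof.
  intros Hf Hg. unfold PSB.
  apply PS_ext with (fun v => 1 - ((f v - g v) + (g v - f v))); [|ps].
  intros v. destruct (Nat.eqb_spec (f v) (g v)); cbn [Nat.b2n]; lia.
Qed.

Lemma PSB_andb b c : PSB b -> PSB c -> PSB (fun v => b v && c v)%bool.
Proof.
  unfold PSB. intros Hb Hc. apply PS_ext with (fun v => Nat.b2n (b v) * Nat.b2n (c v)); [|ps].
  intros v. now destruct (b v), (c v).
Qed.

Lemma PSB_negb b : PSB b -> PSB (fun v => negb (b v)).
Proof.
  unfold PSB. intros Hb. apply PS_ext with (fun v => 1 - Nat.b2n (b v)); [|ps].
  intros v. now destruct (b v).
Qed.
#[export] Hint Resolve PSB_leb PSB_eqb PSB_andb PSB_negb : ps.

Lemma PSP_iff P Q : (forall v, P v <-> Q v) -> PSP P -> PSP Q.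
Proof. intros H [b [Hb HP]]. exists b. split; auto. intros v. now rewrite HP. Qed.

Lemma PSP_eq f g : PS f -> PS g -> PSP (fun v => f v = g v).
Proof. intros. exists (fun v => f v =? g v). split; [ps|]. intros v. apply Nat.eqb_eq. Qed.

Lemma PSP_le f g : PS f -> PS g -> PSP (fun v => f v <= g v).
Proof. intros. exists (fun v => f v <=? g v). split; [ps|]. intros v. apply Nat.leb_le. Qed.

Lemma PSP_lt f g : PS f -> PS g -> PSP (fun v => f v < g v).
Proof. intros. apply (PSP_le (fun v => S (f v))); ps. Qed.

Lemma PSP_and P Q : PSP P -> PSP Q -> PSP (fun v => P v /\ Q v).
Proof.
  intros [b [Hb HP]] [c [Hc HQ]]. exists (fun v => b v && c v)%bool. split; [ps|].
  intros v. rewrite Bool.andb_true_iff, HP, HQ. tauto.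
Qed.

Lemma PSP_or P Q : PSP P -> PSP Q -> PSP (fun v => P v \/ Q v).
Proof.
  intros [b [Hb HP]] [c [Hc HQ]]. exists (fun v => negb (negb (b v) && negb (c v)))%bool.
  split; [ps|]. intros v. rewrite <- HP, <- HQ. destruct (b v), (c v); cbn; intuition congruence.
Qed.
#[export] Hint Resolve PSP_eq PSP_le PSP_lt PSP_and PSP_or : ps.

Lemma PSP_ex N P : PS N -> PSP (fun v => P (nth 0 v 0) (tl v)) ->
  PSP (fun v => exists i, i <= N v /\ P i v).
Proof.
  intros HN [b [Hb HP]].
  set (F := fun v n => iterv 0 (fun i a => if b (i :: v) then 1 else a) n).
  assert (E : forall v n, F v n <= 1 /\ (F v n = 1 <-> exists i, i < n /\ P i v)).
  { intros v n. induction n as [|n [IH1 IH2]].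
    - cbn. split; [lia|]. split; [lia|]. intros [i [Hi _]]. lia.
    - change (F v (S n)) with (if b (n :: v) then 1 else F v n).
      pose proof (HP (n :: v)) as Hn. cbn [nth tl] in Hn.
      destruct (b (n :: v)).
      + split; [lia|]. split; auto. intros _. exists n. split; [lia|]. now apply Hn.
      + split; auto. rewrite IH2. split; intros [i [Hi Hp]].
        * exists i. split; [lia|auto].
        * exists i. split; auto. enough (i <> n) by lia. intros ->. apply Hn in Hp. discriminate. }
  exists (fun v => F v (S (N v)) =? 1). split.
  - apply (PSB_eqb (fun v => F v (S (N v))) (fun _ => 1)); [|ps].
    apply (PS_iter_env (fun v => S (N v)) (fun _ => 0)
             (fun v => if b (tl v) then 1 else nth 0 v 0) (fun _ => 1)); [ps|ps| |apply PB_const|].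
    + apply PS_if; [|ps|ps]. exact (PS_wk (fun v => Nat.b2n (b v)) Hb).
    + intros v i _. apply E.
  - intros v. rewrite Nat.eqb_eq, (proj2 (E v _)).
    split; intros [i [Hi Hp]]; exists i; split; auto; lia.
Qed.
#[export] Hint Resolve PSP_ex : ps.

(** The value is found by trying all candidates up to [N]. Quotient and logarithm enter in this way,
    through the inequalities that characterise them. *)
Lemma PS_graph f N : PS N -> (forall v, f v <= N v) ->
  PSP (fun v => nth 0 v 0 = f (tl v)) -> PS f.
Proof.
  intros HN Hle [b [Hb HP]].
  set (F := fun v n => iterv 0 (fun i a => if b (i :: v) then i else a) n).
  assert (E : forall v n, F v n = if f v <? n then f v else 0).
  { intros v n. induction n as [|n IH]; [reflexivity|].
    change (F v (S n)) with (if b (n :: v) then n else F v n).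
    pose proof (HP (n :: v)) as Hn. cbn [nth tl] in Hn. rewrite IH.
    destruct (b (n :: v)).
    - assert (n = f v) as -> by now apply Hn. destruct (Nat.ltb_spec (f v) (S (f v))); lia.
    - assert (n <> f v) by (intros E; apply Hn in E; discriminate).
      destruct (Nat.ltb_spec (f v) n), (Nat.ltb_spec (f v) (S n)); lia. }
  apply PS_ext with (fun v => F v (S (N v))).
  - intros v. rewrite E. specialize (Hle v). destruct (Nat.ltb_spec (f v) (S (N v))); lia.
  - apply (PS_iter_env (fun v => S (N v)) (fun _ => 0)
             (fun v => if b (tl v) then nth 1 v 0 else nth 0 v 0) N); [ps|ps| |now apply PS_PB|].
    + apply PS_if; [|ps|ps]. exact (PS_wk (fun v => Nat.b2n (b v)) Hb).
    + intros v i _. change (F v i <= N v). rewrite E. specialize (Hle v).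
      destruct (f v <? i); lia.
Qed.

Lemma PS_div f g : PS f -> PS g -> PS (fun v => f v / g v).
Proof.
  intros Hf Hg. apply PS_graph with f; auto.
  { intros v. destruct (Nat.eq_dec (g v) 0) as [->|]; [cbn; lia|]. apply Nat.Div0.div_le_upper_bound. nia. }
  (* Division by 0 yields 0, hence the first case. *)
  apply PSP_iff with (fun v => (g (tl v) = 0 /\ nth 0 v 0 = 0) \/
    (0 < g (tl v) /\ g (tl v) * nth 0 v 0 <= f (tl v) /\ f (tl v) < g (tl v) * S (nth 0 v 0))); [|ps].
  intros v. generalize (f (tl v)) (g (tl v)) (nth 0 v 0). intros a b q.
  destruct (Nat.eq_dec b 0) as [->|Hb]; [cbn; lia|].
  split.
  - intros [|[_ [H1 H2]]]; [lia|]. apply (Nat.div_unique a b q (a - b * q)); lia.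
  - intros ->. right. split; [lia|]. split; [apply Nat.Div0.mul_div_le|apply Nat.mul_succ_div_gt; auto].
Qed.
#[export] Hint Resolve PS_div : ps.

Lemma PS_mod f g : PS f -> PS g -> PS (fun v => f v mod g v).
Proof.
  intros Hf Hg. apply PS_ext with (fun v => f v - g v * (f v / g v)); [|ps].
  intros v. symmetry. apply Nat.Div0.mod_eq.
Qed.
#[export] Hint Resolve PS_mod : ps.

Lemma PS_min f g : PS f -> PS g -> PS (fun v => Nat.min (f v) (g v)).
Proof.
  intros Hf Hg. apply PS_ext with (fun v => f v - (f v - g v)); [intros; lia|ps].
Qed.
#[export] Hint Resolve PS_min : ps.

(** * Powers and logarithms *)

Lemma PS_pow f g : PS f -> PS g -> PB (fun v => f v ^ g v) -> PS (fun v => f v ^ g v).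
Proof.
  intros Hf Hg Hb.
  assert (E : forall v i, iterv 1 (fun _ a => f v * a) i = f v ^ i).
  { intros v i. induction i as [|i IH]; cbn; auto. }
  eapply PS_ext; [intros v; exact (E v (g v))|].
  apply (PS_iter g (fun _ => 1) (fun _ a v => f v * a) (fun v => f v ^ g v + 1)); [ps|ps|ps| |].
  - apply PB_add; auto using PB_const.
  - intros v i Hi. rewrite E. destruct (Nat.eq_dec (f v) 0) as [->|].
    + destruct i; cbn; [lia|]. lia.
    + transitivity (f v ^ g v); [|lia]. now apply Nat.pow_le_mono_r.
Qed.

(** Powers leave the class in general. They stay inside when the exponent is polynomial in the
    length m of the arguments, not merely in their value; exponents built from logarithms are of
    this kind. *)
Definition Small (f : list nat -> nat) : Prop :=
  exists p, polyn p /\ forall m v, vbounded (2 ^ m) v -> f v <= p m.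

Lemma Small_const a : Small (fun _ => a).
Proof. exists (fun _ => a). split; [apply poly_const|auto]. Qed.

Lemma Small_add f g : Small f -> Small g -> Small (fun v => f v + g v).
Proof.
  intros [p [Hp Hf]] [q [Hq Hg]]. exists (fun m => p m + q m). split; [now apply poly_add|].
  intros. apply Nat.add_le_mono; auto.
Qed.

Lemma Small_mul f g : Small f -> Small g -> Small (fun v => f v * g v).
Proof.
  intros [p [Hp Hf]] [q [Hq Hg]]. exists (fun m => p m * q m). split; [now apply poly_mul|].
  intros. apply Nat.mul_le_mono; auto.
Qed.

Lemma Small_log2 f : PB f -> Small (fun v => Nat.log2 (f v)).
Proof.
  intros [p [Hp Hf]]. exists p. split; auto. intros m v Hv.
  rewrite <- (Nat.log2_pow2 (p m)) by lia. apply Nat.log2_le_mono. auto.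
Qed.

Lemma PB_pow f g : PB f -> Small g -> PB (fun v => f v ^ g v).
Proof.
  intros [p [Hp Hf]] [q [Hq Hg]]. exists (fun m => p m * q m). split; [now apply poly_mul|].
  intros m v Hv. specialize (Hf m v Hv). specialize (Hg m v Hv). rewrite Nat.pow_mul_r.
  transitivity ((2 ^ p m) ^ g v); [now apply Nat.pow_le_mono_l|].
  apply Nat.pow_le_mono_r; auto. apply Nat.pow_nonzero. lia.
Qed.
#[export] Hint Resolve Small_const Small_add Small_mul Small_log2 PB_pow PB_add PB_mul PS_PB : ps.
#[export] Hint Resolve PS_pow : ps.

(** In the graph of the logarithm the candidate exponent may be as large as the argument, so its
    power is cut off by taking the minimum in every round. *)
Lemma PS_cpow f B : PS f -> PS B -> PS (fun v => Nat.min (2 ^ f v) (B v)).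
Proof.
  intros Hf HB.
  assert (E : forall v i, iterv (Nat.min 1 (B v)) (fun _ a => Nat.min (2 * a) (B v)) i =
                          Nat.min (2 ^ i) (B v)).
  { intros v i. induction i as [|i IH]; auto.
    change (iterv (Nat.min 1 (B v)) (fun _ a => Nat.min (2 * a) (B v)) (S i)) with
      (Nat.min (2 * iterv (Nat.min 1 (B v)) (fun _ a => Nat.min (2 * a) (B v)) i) (B v)).
    rewrite IH. rewrite Nat.pow_succ_r'. lia. }
  eapply PS_ext; [intros v; exact (E v (f v))|].
  apply (PS_iter f (fun v => Nat.min 1 (B v)) (fun _ a v => Nat.min (2 * a) (B v)) B); [ps|ps|ps|ps|].
  intros v i Hi. rewrite E. lia.
Qed.
#[export] Hint Resolve PS_cpow : ps.

Lemma PS_log2 f : PS f -> PS (fun v => Nat.log2 (f v)).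
Proof.
  intros Hf. apply PS_graph with f; auto.
  { intros v. destruct (Nat.eq_dec (f v) 0) as [->|]; [cbn; lia|].
    apply Nat.lt_le_incl, Nat.log2_lt_lin. lia. }
  (* The cap 2f + 1 exceeds f, so both comparisons with f have the same truth value as for the
     uncapped powers. *)
  apply PSP_iff with (fun v => (f (tl v) = 0 /\ nth 0 v 0 = 0) \/ (0 < f (tl v) /\
     Nat.min (2 ^ nth 0 v 0) (2 * f (tl v) + 1) <= f (tl v) /\
     f (tl v) < Nat.min (2 ^ S (nth 0 v 0)) (2 * f (tl v) + 1))); [|ps].
  intros v. generalize (f (tl v)) (nth 0 v 0). intros a k.
  destruct (Nat.eq_dec a 0) as [->|Ha]; [cbn; lia|].
  split.
  - intros [|[_ [H1 H2]]]; [lia|]. symmetry. apply Nat.log2_unique; lia.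
  - intros ->. right. pose proof (Nat.log2_spec a ltac:(lia)). lia.
Qed.
#[export] Hint Resolve PS_log2 : ps.

(** * Savitch's theorem *)

Inductive reach (R : nat -> nat -> Prop) (N : nat) : nat -> nat -> Prop :=
  | reach_refl x : x <= N -> reach R N x x
  | reach_step x y z : x <= N -> R x y -> reach R N y z -> reach R N x z.

Lemma reach_le R N x y : reach R N x y -> x <= N /\ y <= N.
Proof. induction 1; tauto. Qed.

Section Savitch.
Variables (N K : nat) (Rb : nat -> nat -> bool).
Let B := N + K + 3.

Fixpoint rch (k u v : nat) : bool :=
  match k with
  | 0 => ((u =? v) || Rb u v)%bool
  | S k' => existsb (fun w => rch k' u w && rch k' w v)%bool (seq 0 (S N))
  end.

Fixpoint path (x : nat) (l : list nat) (y : nat) : Prop :=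
  match l with
  | [] => x = y
  | z :: l' => Rb x z = true /\ z <= N /\ path z l' y
  end.

Lemma path_app x l1 y l2 z : path x l1 y -> path y l2 z -> path x (l1 ++ l2) z.
Proof.
  revert x. induction l1 as [|a l1 IH]; cbn; intros x H1 H2; [now subst|].
  intuition auto.
Qed.

Lemma path_split l1 : forall x l2 z, path x (l1 ++ l2) z -> exists y, path x l1 y /\ path y l2 z.
Proof.
  induction l1 as [|a l1 IH]; intros x l2 z H; [now exists x|].
  cbn in H. destruct H as [H1 [H2 H3]]. destruct (IH a l2 z H3) as [y [H4 H5]].
  exists y. cbn. tauto.
Qed.

Lemma path_end_le x l y : x <= N -> path x l y -> y <= N.
Proof.
  revert x. induction l as [|a l IH]; cbn; intros x Hx H; [now subst|]. apply (IH a); tauto.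
Qed.

(** A path of at most 2^(k+1) edges is cut after its first 2^k, or at its end if it is shorter; this
    works because level 0 admits the empty path as well as a single edge. *)
Lemma rch_path k u v : u <= N -> v <= N ->
  rch k u v = true <-> exists l, path u l v /\ length l <= 2 ^ k.
Proof.
  revert u v. induction k as [|k IH]; intros u v Hu Hv; cbn [rch].
  - rewrite Bool.orb_true_iff, Nat.eqb_eq. split.
    + intros [->|H]; [exists []; cbn; auto|]. exists [v]. cbn. auto.
    + intros [[|z [|z' l]] [Hp Hl]]; cbn in *; [auto| |lia].
      destruct Hp as [H1 [_ ->]]. auto.
  - rewrite existsb_exists. split.
    + intros [w [Hw H]]. apply in_seq in Hw. apply Bool.andb_true_iff in H. destruct H as [H1 H2].
      apply IH in H1; [|lia|lia]. apply IH in H2; [|lia|lia].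
      destruct H1 as [l1 [P1 L1]], H2 as [l2 [P2 L2]]. exists (l1 ++ l2).
      split; [now apply path_app with w|]. rewrite length_app, Nat.pow_succ_r'. lia.
    + intros [l [Hp Hl]]. rewrite <- (firstn_skipn (2 ^ k) l) in Hp.
      apply path_split in Hp. destruct Hp as [w [P1 P2]]. exists w.
      assert (Hw : w <= N) by exact (path_end_le _ _ _ Hu P1).
      split; [apply in_seq; lia|]. apply Bool.andb_true_iff. split; apply IH; auto.
      * exists (firstn (2 ^ k) l). split; auto. apply firstn_le_length.
      * exists (skipn (2 ^ k) l). split; auto. rewrite length_skipn.
        rewrite Nat.pow_succ_r' in Hl. lia.
Qed.

Lemma path_in x l y a : path x l y -> In a l -> exists l', path a l' y /\ incl l' l /\
  (NoDup l -> NoDup (a :: l')).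
Proof.
  intros Hp Ha. apply in_split in Ha. destruct Ha as [l1 [l2 ->]].
  replace (l1 ++ a :: l2) with ((l1 ++ [a]) ++ l2) in Hp by now rewrite <- app_assoc.
  apply path_split in Hp. destruct Hp as [b [H1 H2]].
  apply path_split in H1. destruct H1 as [c [_ H3]]. cbn in H3. destruct H3 as [_ [_ <-]].
  exists l2. split; auto. split.
  - intros t Ht. apply in_or_app. right. now right.
  - intros Hn. now apply NoDup_app_remove_l in Hn.
Qed.

(** Cycles are cut starting from the far end: if the start reappears on the rest, already free of
    repetitions, the path continues from that occurrence. *)
Lemma path_NoDup x l y : path x l y -> exists l', path x l' y /\ incl l' l /\ NoDup (x :: l').
Proof.
  revert x. induction l as [|a l IH]; intros x H.
  - exists []. cbn in *. repeat split; auto using incl_nil_l. constructor; [auto|constructor].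
  - cbn in H. destruct H as [H1 [H2 H3]]. destruct (IH a H3) as [l' [P1 [I1 D1]]].
    destruct (in_dec Nat.eq_dec x (a :: l')) as [Hx|Hx].
    + destruct (path_in x (a :: l') y x) as [l2 [P2 [I2 D2]]]; auto.
      { cbn. auto. }
      exists l2. split; auto. split; auto. intros t Ht. apply I2 in Ht. destruct Ht as [->|Ht].
      * now left.
      * right. auto.
    + exists (a :: l'). split; [cbn; auto|]. split; [|now constructor].
      intros t [->|Ht]; [now left|right; auto].
Qed.

Lemma path_all_le x l y : path x l y -> Forall (fun z => z <= N) l.
Proof.
  revert x. induction l as [|a l IH]; intros x; cbn; [constructor|].
  intros [_ [H1 H2]]. constructor; eauto.
Qed.

(** A path without repetitions visits at most N + 1 nodes and so has at most N < 2^K edges. *)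
Lemma reach_rch R u v : (forall x y, Rb x y = true <-> R x y) -> N < 2 ^ K -> u <= N -> v <= N ->
  rch K u v = true <-> reach R N u v.
Proof.
  intros HR HK Hu Hv. rewrite rch_path by auto. split.
  - intros [l [Hp _]]. revert u Hu Hp. induction l as [|a l IH]; cbn; intros u Hu Hp.
    + subst. now constructor.
    + destruct Hp as [H1 [H2 H3]]. apply reach_step with a; auto. now apply HR.
  - intros Hr.
    assert (Hp : exists l, path u l v).
    { clear - Hr Hv HR. induction Hr as [x Hx|x y z Hx H1 H2 IH]; [now exists []|].
      destruct (IH Hv) as [l Hl]. exists (y :: l). cbn. split; [now apply HR|]. split; auto.
      destruct H2; auto. }
    destruct Hp as [l Hl]. apply path_NoDup in Hl. destruct Hl as [l' [P1 [_ D1]]].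
    exists l'. split; auto.
    assert (length (u :: l') <= length (seq 0 (S N))).
    { apply NoDup_incl_length; auto. intros t Ht. apply in_seq.
      pose proof (path_all_le _ _ _ P1) as F. destruct Ht as [->|Ht]; [lia|].
      eapply Forall_forall in F; eauto. cbn in F. lia. }
    rewrite length_seq in H. cbn in H. lia.
Qed.

(* A state of the recursion [rch] is a number whose base-B digits are
   [0, k, u, v] (evaluate rch k u v) or [1, k, b, 0] (return b from level k),
   followed by the frames [u, v, w, phase] of the pending calls. *)
Definition mk (a b c d r : nat) : nat := a + B * (b + B * (c + B * (d + B * r))).

Definition el (i s : nat) : nat := Nat.iter i (fun s => s / B) s mod B.
Definition rest (s : nat) : nat := s / B / B / B / B.

(** Phase 0 of the top frame awaits the first half [rch k u w], phase 1 the second half [rch k w v].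
    A failed half moves on to the midpoint w + 1, or reports failure one level up if w = N. A return
    at level K is a fixed point, so surplus rounds do no harm. The nested negations spell a
    disjunction in connectives that have closure lemmas. *)
Definition sv_next (s : nat) : nat :=
  let r := rest s in
  if el 0 s =? 0 then
    if el 1 s =? 0
    then mk 1 0 (Nat.b2n (negb (negb (el 2 s =? el 3 s) && negb (Rb (el 2 s) (el 3 s))))) 0 r
    else mk 0 (Nat.pred (el 1 s)) (el 2 s) 0 (mk (el 2 s) (el 3 s) 0 0 r)
  else if el 1 s =? K then s
  else if el 2 s =? 0 then
    if el 2 r =? N then mk 1 (S (el 1 s)) 0 0 (rest r)
    else mk 0 (el 1 s) (el 0 r) (S (el 2 r)) (mk (el 0 r) (el 1 r) (S (el 2 r)) 0 (rest r))
  else if el 3 r =? 0 then mk 0 (el 1 s) (el 2 r) (el 1 r) (mk (el 0 r) (el 1 r) (el 2 r) 1 (rest r))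
  else mk 1 (S (el 1 s)) 1 0 (rest r).

(** The cap bounds the result of every step without an invariant on states. Genuine runs never meet
    it: at most K frames and the current state, of four digits each, stay below B^(4K + 4). *)
Definition sv_step (s : nat) : nat := Nat.min (sv_next s) (B ^ (4 * K + 8)).

Lemma mk_div a q : a < B -> (a + B * q) / B = q /\ (a + B * q) mod B = a.
Proof.
  intros H. split.
  - symmetry. apply (Nat.div_unique _ _ _ a); lia.
  - symmetry. apply (Nat.mod_unique _ _ q); lia.
Qed.

Lemma mk_el a b c d r : a < B -> b < B -> c < B -> d < B ->
  el 0 (mk a b c d r) = a /\ el 1 (mk a b c d r) = b /\ el 2 (mk a b c d r) = c /\
  el 3 (mk a b c d r) = d /\ rest (mk a b c d r) = r.
Proof.
  intros Ha Hb Hc Hd. unfold el, rest, mk. cbn [Nat.iter nat_rect].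
  destruct (mk_div a (b + B * (c + B * (d + B * r))) Ha) as [-> ->].
  destruct (mk_div b (c + B * (d + B * r)) Hb) as [-> ->].
  destruct (mk_div c (d + B * r) Hc) as [-> ->].
  destruct (mk_div d r Hd) as [-> ->]. auto.
Qed.

Lemma mk_bound a b c d r e : a < B -> b < B -> c < B -> d < B -> r < B ^ e ->
  mk a b c d r < B ^ (4 + e).
Proof.
  assert (H : forall x y e, x < B -> y < B ^ e -> x + B * y < B ^ S e).
  { intros x y e' Hx Hy. rewrite Nat.pow_succ_r'. nia. }
  intros Ha Hb Hc Hd Hr. unfold mk. cbn [Nat.add]. auto.
Qed.

Lemma sv_step_mk a b c d r s' k : a < B -> b < B -> c < B -> d < B ->
  sv_next (mk a b c d r) = s' -> s' < B ^ k -> k <= 4 * K + 8 -> sv_step (mk a b c d r) = s'.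
Proof.
  intros Ha Hb Hc Hd E Hs Hk. unfold sv_step. rewrite E. apply Nat.min_l.
  apply Nat.lt_le_incl. eapply Nat.lt_le_trans; [exact Hs|]. apply Nat.pow_le_mono_r; [|exact Hk].
  unfold B; lia.
Qed.

Definition runs (T s s' : nat) : Prop := exists t, t <= T /\ Nat.iter t sv_step s = s'.

Lemma runs_trans T1 T2 s1 s2 s3 : runs T1 s1 s2 -> runs T2 s2 s3 -> runs (T1 + T2) s1 s3.
Proof.
  intros [t1 [H1 E1]] [t2 [H2 E2]]. exists (t2 + t1). split; [lia|].
  now rewrite Nat.iter_add, E1.
Qed.

Lemma runs_one s s' : sv_step s = s' -> runs 1 s s'.
Proof. intros H. now exists 1. Qed.

Lemma runs_le T T' s s' : T <= T' -> runs T s s' -> runs T' s s'.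
Proof. intros H [t [Ht E]]. exists t. split; [lia|auto]. Qed.

(** Level k+1 takes at most 1 + (N+1)(2T + 2) steps, T being the time for level k: N+1 midpoints,
    each with two calls and two further steps. The factor 4N + 8 covers this because T >= 1. *)
Definition sv_time (k : nat) : nat := (4 * N + 8) ^ k.

(** The rest [r] of the stack is arbitrary and handed back unchanged, so the induction hypothesis
    serves both halves inside a pushed frame. At level k there are at most K - k pending frames. *)
Lemma sv_call k : forall u v r, k <= K -> u <= N -> v <= N -> r < B ^ (4 * (K - k)) ->
  runs (sv_time k) (mk 0 k u v r) (mk 1 k (Nat.b2n (rch k u v)) 0 r).
Proof.
  assert (HB : forall b, Nat.b2n b < B) by (intros []; unfold B; cbn; lia).
  induction k as [|k IH]; intros u v r Hk Hu Hv Hr.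
  - apply runs_one. destruct (mk_el 0 0 u v r) as (E0 & E1 & E2 & E3 & E4); try (unfold B; lia).
    apply sv_step_mk with (4 + 4 * (K - 0)); try (unfold B; lia).
    + unfold sv_next. rewrite E0, E1, E2, E3, E4. cbn [Nat.eqb rch].
      do 2 f_equal. now destruct (u =? v), (Rb u v).
    + apply mk_bound; try (unfold B; lia); auto.
  - set (T := sv_time k) in *.
    set (F := fun w => (rch k u w && rch k w v)%bool).
    assert (Hfr : forall w ph, w <= N -> ph < 2 -> mk u v w ph r < B ^ (4 * (K - k))).
    { intros w ph Hw Hph. replace (4 * (K - k)) with (4 + 4 * (K - S k)) by lia.
      apply mk_bound; unfold B; try lia. exact Hr. }
    assert (HT : 1 <= T) by (unfold T, sv_time; apply Nat.neq_0_lt_0, Nat.pow_nonzero; lia).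
    (* The j + 1 midpoints from w to N are still to be tried. *)
    assert (Hloop : forall j w, w + j = N ->
       runs (S j * (2 * T + 2)) (mk 0 k u w (mk u v w 0 r))
            (mk 1 (S k) (Nat.b2n (existsb F (seq w (S j)))) 0 r)).
    { assert (Hend : forall b w ph, w <= N -> ph < 2 -> (b = true -> ph = 1) -> (b = false -> w = N) ->
        sv_step (mk 1 k (Nat.b2n b) 0 (mk u v w ph r)) = mk 1 (S k) (Nat.b2n b) 0 r).
      { intros b w ph Hw Hph Hb1 Hb2.
        destruct (mk_el 1 k (Nat.b2n b) 0 (mk u v w ph r)) as (E0 & E1 & E2 & E3 & E4); try (unfold B; lia); auto.
        destruct (mk_el u v w ph r) as (G0 & G1 & G2 & G3 & G4); try (unfold B; lia).
        apply sv_step_mk with (4 + 4 * (K - S k)); try (unfold B; lia); auto.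
        - unfold sv_next. rewrite E0, E1, E2, E4, G0, G1, G2, G3, G4. cbn [Nat.eqb].
          destruct (Nat.eqb_spec k K); [lia|]. destruct b; cbn [Nat.b2n Nat.eqb].
          + now rewrite Hb1.
          + now rewrite Hb2, Nat.eqb_refl.
        - apply mk_bound; auto; unfold B; lia. }
      assert (Hnext : forall w ph, w < N -> ph < 2 ->
        sv_step (mk 1 k 0 0 (mk u v w ph r)) = mk 0 k u (S w) (mk u v (S w) 0 r)).
      { intros w ph Hw Hph.
        destruct (mk_el 1 k 0 0 (mk u v w ph r)) as (E0 & E1 & E2 & E3 & E4); try (unfold B; lia).
        destruct (mk_el u v w ph r) as (G0 & G1 & G2 & G3 & G4); try (unfold B; lia).
        apply sv_step_mk with (4 + 4 * (K - k)); try (unfold B; lia).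
        - unfold sv_next. rewrite E0, E1, E2, E4, G0, G1, G2, G4. cbn [Nat.eqb].
          destruct (Nat.eqb_spec k K); [lia|]. destruct (Nat.eqb_spec w N); [lia|]. reflexivity.
        - apply mk_bound; try (unfold B; lia). apply Hfr; lia. }
      assert (Hsecond : forall w, w <= N ->
        sv_step (mk 1 k 1 0 (mk u v w 0 r)) = mk 0 k w v (mk u v w 1 r)).
      { intros w Hw.
        destruct (mk_el 1 k 1 0 (mk u v w 0 r)) as (E0 & E1 & E2 & E3 & E4); try (unfold B; lia).
        destruct (mk_el u v w 0 r) as (G0 & G1 & G2 & G3 & G4); try (unfold B; lia).
        apply sv_step_mk with (4 + 4 * (K - k)); try (unfold B; lia).
        - unfold sv_next. rewrite E0, E1, E2, E4, G0, G1, G2, G3, G4. cbn [Nat.eqb].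
          destruct (Nat.eqb_spec k K); [lia|]. reflexivity.
        - apply mk_bound; try (unfold B; lia). apply Hfr; lia. }
      assert (Hfirst : forall w, w <= N ->
        exists ph, ph < 2 /\ (F w = true -> ph = 1) /\
        runs (2 * T + 1) (mk 0 k u w (mk u v w 0 r)) (mk 1 k (Nat.b2n (F w)) 0 (mk u v w ph r))).
      { intros w Hw.
        pose proof (IH u w (mk u v w 0 r) ltac:(lia) Hu Hw (Hfr w 0 Hw ltac:(lia))) as R1.
        unfold F. destruct (rch k u w); cbn [andb Nat.b2n] in *.
        - exists 1. split; [lia|]. split; auto.
          pose proof (IH w v (mk u v w 1 r) ltac:(lia) Hw Hv (Hfr w 1 Hw ltac:(lia))) as R2.
          replace (2 * T + 1) with (T + (1 + T)) by lia.
          eapply runs_trans; [exact R1|]. eapply runs_trans; [|exact R2].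
          now apply runs_one, Hsecond.
        - exists 0. split; [lia|]. split; [discriminate|].
          eapply runs_le; [|exact R1]. lia. }
      induction j as [|j IHj]; intros w Hw; destruct (Hfirst w ltac:(lia)) as (ph & Hph & Hph1 & R1).
      - cbn [seq existsb]. rewrite Bool.orb_false_r.
        eapply runs_le; [|eapply runs_trans; [exact R1|apply runs_one, Hend; auto; lia]]. lia.
      - change (existsb F (seq w (S (S j)))) with (F w || existsb F (seq (S w) (S j)))%bool.
        destruct (F w) eqn:EF; cbn [orb].
        + eapply runs_le; [|eapply runs_trans; [exact R1|apply runs_one, Hend; auto; try lia; discriminate]]. lia.
        + specialize (IHj (S w) ltac:(lia)).
          eapply runs_le; [|eapply runs_trans; [exact R1|
             eapply runs_trans; [apply runs_one, Hnext; lia|exact IHj]]]. lia. }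
    assert (Hstart : sv_step (mk 0 (S k) u v r) = mk 0 k u 0 (mk u v 0 0 r)).
    { destruct (mk_el 0 (S k) u v r) as (E0 & E1 & E2 & E3 & E4); try (unfold B; lia).
      apply sv_step_mk with (4 + 4 * (K - k)); try (unfold B; lia).
      - unfold sv_next. rewrite E0, E1, E2, E3, E4. reflexivity.
      - apply mk_bound; try (unfold B; lia). apply Hfr; lia. }
    eapply runs_le; [|eapply runs_trans; [apply runs_one, Hstart|apply (Hloop N 0); lia]].
    unfold sv_time. rewrite Nat.pow_succ_r'. fold (sv_time k). fold T. nia.
Qed.

Lemma sv_result u v : u <= N -> v <= N ->
  el 2 (Nat.iter (sv_time K) sv_step (mk 0 K u v 0)) = Nat.b2n (rch K u v).
Proof.
  intros Hu Hv.
  destruct (sv_call K u v 0) as (t & Ht & E); auto.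
  { rewrite Nat.sub_diag. cbn. lia. }
  set (s := mk 1 K (Nat.b2n (rch K u v)) 0 0) in *.
  assert (Hb : Nat.b2n (rch K u v) < B) by (destruct (rch K u v); unfold B; cbn; lia).
  destruct (mk_el 1 K (Nat.b2n (rch K u v)) 0 0) as (E0 & E1 & E2 & _ & E4); try (unfold B; lia); auto.
  fold s in E0, E1, E2.
  assert (Hfix : sv_step s = s).
  { apply sv_step_mk with (4 + 0); try (unfold B; lia); auto.
    - unfold sv_next. fold s. rewrite E0, E1. cbn [Nat.eqb]. now rewrite Nat.eqb_refl.
    - apply mk_bound; auto; try (unfold B; lia). }
  replace (sv_time K) with ((sv_time K - t) + t) by lia. rewrite Nat.iter_add, E.
  rewrite <- E2. f_equal. generalize (sv_time K - t). intros j.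
  induction j as [|j IH]; auto. now rewrite Nat.iter_succ, IH.
Qed.
End Savitch.

(** * Reachability as a closure property *)

Definition sv_depth (N : nat) : nat := S (Nat.log2 N).

Lemma sv_depth_spec N : N < 2 ^ sv_depth N.
Proof.
  destruct (Nat.eq_dec N 0) as [->|]; [cbn; lia|]. apply Nat.log2_spec. lia.
Qed.

Lemma PS_mk N K a b c d r : PS N -> PS K -> PS a -> PS b -> PS c -> PS d -> PS r ->
  PS (fun v => mk (N v) (K v) (a v) (b v) (c v) (d v) (r v)).
Proof. intros. unfold mk. ps. Qed.

Lemma PS_rest N K r : PS N -> PS K -> PS r -> PS (fun v => rest (N v) (K v) (r v)).
Proof. intros. unfold rest. ps. Qed.

Lemma PS_el N K i r : PS N -> PS K -> PS r -> PS (fun v => el (N v) (K v) i (r v)).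
Proof.
  intros HN HK Hr. unfold el. apply PS_mod; [|ps].
  revert r Hr. induction i as [|i IH]; intros r Hr; [exact Hr|]. cbn.
  pose proof (IH r Hr). ps.
Qed.
#[export] Hint Resolve PS_mk PS_rest PS_el : ps.

Lemma PSP_reach N a b R : PS N -> PS a -> PS b ->
  PSP (fun v => R (nth 0 v 0) (nth 1 v 0) (tl (tl v))) ->
  PSP (fun v => reach (fun x y => R x y v) (N v) (a v) (b v)).
Proof.
  intros HN Ha Hb [rb [Hrb HR]].
  set (Rb := fun v x y => rb (x :: y :: v)).
  set (K := fun v => sv_depth (N v)).
  assert (HK : PS K) by (unfold K, sv_depth; ps).
  set (res := fun v => iterv (mk (N v) (K v) 0 (K v) (a v) (b v) 0)
                (fun _ s => sv_step (N v) (K v) (Rb v) s) (sv_time (N v) (K v))).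
  assert (SK : Small (fun v => 1 + Nat.log2 (N v))) by ps.
  assert (Hres : PS res).
  { set (bd := fun v => (N v + K v + 3) ^ (4 * K v + 8)).
    assert (Hbd : PS bd) by (unfold bd, K, sv_depth; apply PS_pow; ps;
      apply PB_pow; ps; apply Small_add; ps; apply (Small_mul (fun _ => 4) (fun v => 1 + Nat.log2 (N v))); ps).
    (* The initial state is not capped, so it is added to the bound on the iterates. *)
    apply (PS_iter (fun v => sv_time (N v) (K v)) (fun v => mk (N v) (K v) 0 (K v) (a v) (b v) 0)
             (fun _ s v => sv_step (N v) (K v) (Rb v) s) (fun v => bd v + mk (N v) (K v) 0 (K v) (a v) (b v) 0)).
    - unfold sv_time. apply PS_pow; ps.
    - ps.
    - unfold sv_step. apply PS_min; [|exact (PS_wkn 2 bd Hbd)].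
      assert (HN2 := PS_wkn 2 N HN). assert (HK2 := PS_wkn 2 K HK). cbn in HN2, HK2.
      set (N2 := fun v => N (tl (tl v))) in *. set (K2 := fun v => K (tl (tl v))) in *.
      change (PS (fun v => sv_next (N2 v) (K2 v) (Rb (tl (tl v))) (nth 0 v 0))).
      unfold sv_next. cbv zeta.
      assert (HRb : PSB (fun v => Rb (tl (tl v)) (el (N2 v) (K2 v) 2 (nth 0 v 0)) (el (N2 v) (K2 v) 3 (nth 0 v 0)))).
      { exact (PS_subst2 (fun v => el (N2 v) (K2 v) 2 (nth 0 v 0)) (fun v => el (N2 v) (K2 v) 3 (nth 0 v 0))
                 (fun v => Nat.b2n (rb v)) 2 ltac:(ps) ltac:(ps) Hrb). }
      ps.
    - ps.
    - intros v [|i] _; [cbn; lia|].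
      change (sv_step (N v) (K v) (Rb v) (iterv (mk (N v) (K v) 0 (K v) (a v) (b v) 0)
                (fun _ s => sv_step (N v) (K v) (Rb v) s) i) <= bd v + mk (N v) (K v) 0 (K v) (a v) (b v) 0).
      unfold sv_step at 1, bd. lia. }
  (* [reach] implies that both ends are at most N, while [rch] restricts only the midpoints; hence
     the first two conjuncts. *)
  apply PSP_iff with (fun v => (a v <= N v /\ b v <= N v) /\ el (N v) (K v) 2 (res v) = 1); [|ps].
  intros v.
  assert (HRb : forall x y, Rb v x y = true <-> R x y v) by (intros x y; apply (HR (x :: y :: v))).
  split.
  - intros [[H1 H2] H3]. unfold res in H3.
    change (el (N v) (K v) 2 (Nat.iter (sv_time (N v) (K v)) (sv_step (N v) (K v) (Rb v))
              (mk (N v) (K v) 0 (K v) (a v) (b v) 0)) = 1) in H3.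
    rewrite sv_result in H3 by auto.
    apply (reach_rch (N v) (K v) (Rb v)); auto; [apply sv_depth_spec|].
    destruct (rch (N v) (Rb v) (K v) (a v) (b v)); [auto|discriminate].
  - intros Hr.
    destruct (reach_le _ _ _ _ Hr) as [H1 H2].
    split; auto. unfold res.
    change (el (N v) (K v) 2 (Nat.iter (sv_time (N v) (K v)) (sv_step (N v) (K v) (Rb v))
              (mk (N v) (K v) 0 (K v) (a v) (b v) 0)) = 1).
    rewrite sv_result by auto.
    rewrite (proj2 (reach_rch (N v) (K v) (Rb v) _ (a v) (b v) HRb (sv_depth_spec _) H1 H2)); auto.
Qed.
#[export] Hint Resolve PSP_reach : ps.

(** * Recognizing encodings *)

Definition cb0 (x : nat) : nat := 2 * x + 1.
Definition cb1 (x : nat) : nat := 2 * x + 2.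

Lemma code_c0 l : code (false :: l) = cb0 (code l).
Proof. unfold cb0. cbn [code Nat.b2n]. lia. Qed.

Lemma code_c1 l : code (true :: l) = cb1 (code l).
Proof. unfold cb1. cbn [code Nat.b2n]. lia. Qed.

Lemma code_inj l l' : code l = code l' -> l = l'.
Proof.
  revert l'. induction l as [|b l IH]; intros [|b' l']; cbn [code]; intros H; auto; try lia.
  destruct b, b'; cbn [Nat.b2n] in H; try lia; f_equal; apply IH; lia.
Qed.

Lemma code_surj x : exists l, x = code l.
Proof.
  induction x as [x IH] using lt_wf_ind.
  destruct (bij_cases x) as [->|[[y ->]|[y ->]]].
  - now exists [].
  - destruct (IH y) as [l ->]; [lia|]. exists (false :: l). now rewrite code_c0.
  - destruct (IH y) as [l ->]; [lia|]. exists (true :: l). now rewrite code_c1.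
Qed.

Lemma code_ge l : 2 ^ length l <= S (code l).
Proof.
  induction l as [|b l IH]; [cbn; lia|]. cbn [length code]. rewrite Nat.pow_succ_r'. lia.
Qed.

Lemma log2_code l : Nat.log2 (S (code l)) = length l.
Proof. apply Nat.log2_unique; [lia|]. split; [apply code_ge|apply code_lt]. Qed.

Lemma length_le_code l : length l <= code l.
Proof.
  induction l as [|b l IH]; [cbn; lia|]. cbn [length code]. lia.
Qed.

(** Words of length k have the codes 2^k - 1 to 2^(k+1) - 2, so [log2 (S x)] is the length of the
    word coded by x, and y is shifted by that many places. *)
Definition cat (x y : nat) : nat := x + 2 ^ Nat.log2 (S x) * y.

Lemma code_app l l' : code (l ++ l') = cat (code l) (code l').
Proof.
  unfold cat. rewrite log2_code. induction l as [|b l IH]; cbn [app code length]; [cbn; lia|].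
  rewrite IH, Nat.pow_succ_r'. lia.
Qed.

Lemma cat_ge x y : x <= cat x y /\ y <= cat x y.
Proof.
  unfold cat. assert (2 ^ Nat.log2 (S x) <> 0) by (apply Nat.pow_nonzero; lia). nia.
Qed.

Lemma PS_c0 f : PS f -> PS (fun v => cb0 (f v)).
Proof. intros. unfold cb0. ps. Qed.
Lemma PS_c1 f : PS f -> PS (fun v => cb1 (f v)).
Proof. intros. unfold cb1. ps. Qed.
Lemma PS_cat f g : PS f -> PS g -> PS (fun v => cat (f v) (g v)).
Proof. intros. unfold cat. ps. Qed.
#[export] Hint Resolve PS_c0 PS_c1 PS_cat : ps.

(** Injective because x < 2(x+y) + 1, which makes x + y the integer square root of the value.
    Components are not projected out but searched for below the value, by [pr_ge]. *)
Definition pr (x y : nat) : nat := (x + y) * (x + y) + x.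
Definition pr3 (x y z : nat) : nat := pr x (pr y z).

Lemma pr_inj x y x' y' : pr x y = pr x' y' -> x = x' /\ y = y'.
Proof.
  unfold pr. intros H. destruct (Nat.lt_trichotomy (x + y) (x' + y')) as [L|[L|L]]; [nia| |nia].
  rewrite L in H. lia.
Qed.

Lemma pr_ge x y : x <= pr x y /\ y <= pr x y.
Proof. unfold pr. nia. Qed.

Lemma pr_mono x y x' y' : x <= x' -> y <= y' -> pr x y <= pr x' y'.
Proof. unfold pr. nia. Qed.

Lemma pr3_inj x y z x' y' z' : pr3 x y z = pr3 x' y' z' -> x = x' /\ y = y' /\ z = z'.
Proof. intros H. apply pr_inj in H. destruct H as [-> H]. now apply pr_inj in H. Qed.

Lemma pr3_ge x y z : x <= pr3 x y z /\ y <= pr3 x y z /\ z <= pr3 x y z.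
Proof.
  unfold pr3. pose proof (pr_ge x (pr y z)). pose proof (pr_ge y z). lia.
Qed.

Lemma pr3_mono x y z x' y' z' : x <= x' -> y <= y' -> z <= z' -> pr3 x y z <= pr3 x' y' z'.
Proof. intros. now repeat apply pr_mono. Qed.

Lemma PS_pr f g : PS f -> PS g -> PS (fun v => pr (f v) (g v)).
Proof. intros. unfold pr. ps. Qed.
#[export] Hint Resolve PS_pr : ps.

Lemma PS_pr3 f g h : PS f -> PS g -> PS h -> PS (fun v => pr3 (f v) (g v) (h v)).
Proof. intros. unfold pr3. ps. Qed.
#[export] Hint Resolve PS_pr3 : ps.

(** An edge removes the lowest bit of the number and its two-letter group from the string at once.
    So reachability relates a number to its encoding, and both components shrink on the way. *)
Definition pos_step (x y : nat) : Prop :=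
  exists p, p <= y /\ exists s, s <= y /\ (y = pr p s /\ 1 <= p /\
    (x = pr (2 * p) (cb0 (cb0 s)) \/ x = pr (2 * p + 1) (cb0 (cb1 s)))).

Definition is_pos (p s : nat) : Prop :=
  reach pos_step (pr p s) (pr p s) (pr 1 (cb1 (cb1 0))).

Lemma PSP_is_pos p s : PS p -> PS s -> PSP (fun v => is_pos (p v) (s v)).
Proof.
  intros. apply (PSP_reach _ _ _ (fun x y _ => pos_step x y)); [ps|ps|ps|]. unfold pos_step. ps.
Qed.
#[export] Hint Resolve PSP_is_pos : ps.

Lemma is_pos_spec p s : is_pos p s <-> exists q, p = Pos.to_nat q /\ s = code (enc_pos q).
Proof.
  split.
  - enough (Hn : forall N x z, reach pos_step N x z -> forall p s, x = pr p s -> z = pr 1 (cb1 (cb1 0)) ->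
              exists q, p = Pos.to_nat q /\ s = code (enc_pos q)) by (intros H; exact (Hn _ _ _ H _ _ eq_refl eq_refl)).
    clear p s. intros N x z H.
    induction H as [x _|x y z _ (p' & _ & s' & _ & Hy & Hp & Hx) _ IH]; intros p s Ex Ez; subst.
    + apply pr_inj in Ez. destruct Ez as [-> ->]. now exists xH.
    + destruct (IH p' s' eq_refl eq_refl) as (q & -> & ->).
      destruct Hx as [Hx|Hx]; apply pr_inj in Hx; destruct Hx as [-> ->].
      * exists (xO q). split; [lia|]. cbn [enc_pos]. now rewrite !code_c0.
      * exists (xI q). split; [lia|]. cbn [enc_pos]. now rewrite code_c0, code_c1.
  - intros (q & -> & ->). unfold is_pos.
    enough (H : forall N, pr (Pos.to_nat q) (code (enc_pos q)) <= N ->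
              reach pos_step N (pr (Pos.to_nat q) (code (enc_pos q))) (pr 1 (cb1 (cb1 0)))) by auto.
    assert (Hs : forall q', pos_step (pr (Pos.to_nat (xI q')) (code (enc_pos (xI q'))))
                                     (pr (Pos.to_nat q') (code (enc_pos q'))) /\
                            pos_step (pr (Pos.to_nat (xO q')) (code (enc_pos (xO q'))))
                                     (pr (Pos.to_nat q') (code (enc_pos q')))).
    { intros q'. pose proof (pr_ge (Pos.to_nat q') (code (enc_pos q'))).
      split; exists (Pos.to_nat q'); (split; [lia|]); exists (code (enc_pos q'));
        (split; [lia|]); (split; [auto|]); (split; [lia|]); cbn [enc_pos];
        rewrite !code_c0, ?code_c1.
      - right. f_equal. lia.
      - left. f_equal. lia. }
    induction q as [q IH|q IH|]; intros N HN.
    + eapply reach_step; [exact HN|apply Hs|]. apply IH. etransitivity; [|exact HN].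
      cbn [enc_pos]. rewrite code_c0, code_c1. apply pr_mono; [lia|]. unfold cb0, cb1. lia.
    + eapply reach_step; [exact HN|apply Hs|]. apply IH. etransitivity; [|exact HN].
      cbn [enc_pos]. rewrite !code_c0. apply pr_mono; [lia|]. unfold cb0. lia.
    + now constructor.
Qed.

(** [p] and [m] are the positive and the negative part of the integer, so that later arithmetic
    stays within the natural numbers. *)
Definition is_int (p m s : nat) : Prop :=
  (p = 0 /\ m = 0 /\ s = cb0 (cb0 0)) \/
  (m = 0 /\ exists s', s' <= s /\ (s = cb0 (cb1 s') /\ is_pos p s')) \/
  (p = 0 /\ exists s', s' <= s /\ (s = cb1 (cb0 s') /\ is_pos m s')).

Lemma PSP_is_int p m s : PS p -> PS m -> PS s -> PSP (fun v => is_int (p v) (m v) (s v)).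
Proof. intros. unfold is_int. ps. Qed.
#[export] Hint Resolve PSP_is_int : ps.

Lemma is_int_spec p m s : is_int p m s <->
  exists z, p = Z.to_nat z /\ m = Z.to_nat (- z) /\ s = code (enc_Z z).
Proof.
  unfold is_int. split.
  - intros [(-> & -> & ->)|[(-> & s' & _ & -> & H)|(-> & s' & _ & -> & H)]].
    + now exists 0%Z.
    + apply is_pos_spec in H. destruct H as (q & -> & ->). exists (Zpos q).
      cbn [enc_Z]. rewrite code_c0, code_c1. auto.
    + apply is_pos_spec in H. destruct H as (q & -> & ->). exists (Zneg q).
      cbn [enc_Z]. rewrite code_c1, code_c0. auto.
  - intros ([|q|q] & -> & -> & ->); cbn [enc_Z].
    + left. auto.
    + right; left. split; [reflexivity|]. exists (code (enc_pos q)). rewrite code_c0, code_c1.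
      split; [unfold cb0, cb1; lia|]. split; auto. apply is_pos_spec. now exists q.
    + right; right. split; [reflexivity|]. exists (code (enc_pos q)). rewrite code_c1, code_c0.
      split; [unfold cb0, cb1; lia|]. split; auto. apply is_pos_spec. now exists q.
Qed.

Definition is_rat (p m d s : nat) : Prop :=
  exists s1, s1 <= s /\ exists s2, s2 <= s /\ (s = cat s1 s2 /\ is_int p m s1 /\ is_pos d s2).

Lemma PSP_is_rat p m d s : PS p -> PS m -> PS d -> PS s ->
  PSP (fun v => is_rat (p v) (m v) (d v) (s v)).
Proof. intros. unfold is_rat. ps. Qed.
#[export] Hint Resolve PSP_is_rat : ps.

Lemma is_rat_spec p m d s : is_rat p m d s <->
  exists q, p = Z.to_nat (Qnum q) /\ m = Z.to_nat (- Qnum q) /\ d = Pos.to_nat (Qden q) /\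
            s = code (enc_Q q).
Proof.
  unfold is_rat. split.
  - intros (s1 & _ & s2 & _ & -> & H1 & H2).
    apply is_int_spec in H1. apply is_pos_spec in H2.
    destruct H1 as (z & -> & -> & ->), H2 as (e & -> & ->).
    exists (z # e)%Q. cbn [Qnum Qden]. unfold enc_Q. cbn [Qnum Qden]. rewrite code_app. auto.
  - intros (q & -> & -> & -> & ->). unfold enc_Q. rewrite code_app.
    exists (code (enc_Z (Qnum q))). split; [apply cat_ge|].
    exists (code (enc_pos (Qden q))). split; [apply cat_ge|]. split; auto. split.
    + apply is_int_spec. now exists (Qnum q).
    + apply is_pos_spec. now exists (Qden q).
Qed.

(* The parser state is [pr3 j k s]: the string s still has to be read as
   k regular expressions followed by j omega-regular ones. *)
Definition parse_step (x y : nat) : Prop :=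
  exists j, j <= y /\ exists k, k <= y /\ exists s, s <= y /\ (y = pr3 j k s /\
   ((x = pr3 j (S k) (cb0 (cb0 (cb0 s))) \/ x = pr3 j (S k) (cb0 (cb0 (cb1 s))) \/
     x = pr3 j (S k) (cb0 (cb1 (cb0 (cb0 s)))) \/ x = pr3 j (S k) (cb0 (cb1 (cb0 (cb1 s))))) \/
    (2 <= k /\ (x = pr3 j (Nat.pred k) (cb0 (cb1 (cb1 s))) \/ x = pr3 j (Nat.pred k) (cb1 (cb0 (cb0 s))))) \/
    (1 <= k /\ x = pr3 j k (cb1 (cb0 (cb1 s)))) \/
    (k = 1 /\ (x = pr3 (S j) 0 (cb0 (cb0 s)) \/ (1 <= j /\ x = pr3 j 0 (cb0 (cb1 s))))) \/
    (k = 0 /\ 2 <= j /\ x = pr3 (Nat.pred j) 0 (cb1 (cb0 s))))).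

(** Every expression takes at least one letter, so along a successful reading both counts are at
    most the length of the unread string, hence at most its code; this justifies the node bound. *)
Definition parses (j k s : nat) : Prop :=
  reach parse_step (pr3 (S s) (S s) s) (pr3 j k s) (pr3 0 0 0).

Lemma PSP_parses j k s : PS j -> PS k -> PS s -> PSP (fun v => parses (j v) (k v) (s v)).
Proof.
  intros. apply (PSP_reach _ _ _ (fun x y _ => parse_step x y)); [ps|ps|ps|]. unfold parse_step. ps.
Qed.
#[export] Hint Resolve PSP_parses : ps.

Definition str (rs : list regex) (es : list oregex) : list bool :=
  concat (map enc_regex rs) ++ concat (map enc_oregex es).

Lemma str_cons r rs es : str (r :: rs) es = enc_regex r ++ str rs es.
Proof. unfold str. cbn. now rewrite app_assoc. Qed.

Lemma str_nil_cons e es : str [] (e :: es) = enc_oregex e ++ str [] es.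
Proof. reflexivity. Qed.

Lemma length_le_str rs es : length rs <= length (str rs es) /\ length es <= length (str rs es).
Proof.
  assert (H1 : forall r, 1 <= length (enc_regex r)) by (intros []; cbn; lia).
  assert (H2 : forall e, 1 <= length (enc_oregex e)) by (intros []; cbn; lia).
  unfold str. rewrite length_app. split.
  - induction rs as [|r rs IH]; cbn; [lia|]. rewrite length_app. specialize (H1 r). lia.
  - induction es as [|e es IH]; cbn; [lia|]. rewrite length_app. specialize (H2 e). lia.
Qed.

(** Trees are built backwards from the empty string: each edge tells which constructor to apply to
    the trees found so far. *)
Lemma parse_sound N j k s : reach parse_step N (pr3 j k s) (pr3 0 0 0) ->
  exists rs es, length rs = k /\ length es = j /\ s = code (str rs es).
Proof.
  remember (pr3 j k s) as x eqn:Ex. remember (pr3 0 0 0) as z eqn:Ez. intros H.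
  revert j k s Ex Ez.
  induction H as [x _|x y z _ (j' & _ & k' & _ & s' & _ & Hy & Hx) _ IH]; intros j k s Ex Ez; subst.
  - apply pr3_inj in Ez. destruct Ez as (-> & -> & ->). now exists [], [].
  - destruct (IH j' k' s' eq_refl eq_refl) as (rs & es & Hk & Hj & ->). clear IH.
    destruct Hx as [Hx|[[H2 Hx]|[[H2 Hx]|[[H2 Hx]|(H2 & H3 & Hx)]]]].
    + destruct Hx as [Hx|[Hx|[Hx|Hx]]]; apply pr3_inj in Hx; destruct Hx as (-> & -> & ->).
      * exists (REmpty :: rs), es. rewrite str_cons. cbn [enc_regex app length].
        rewrite !code_c0. auto.
      * exists (REps :: rs), es. rewrite str_cons. cbn [enc_regex app length].
        rewrite !code_c0, code_c1. auto.
      * exists (RSym false :: rs), es. rewrite str_cons. cbn [enc_regex app length].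
        rewrite code_c0, code_c1, !code_c0. auto.
      * exists (RSym true :: rs), es. rewrite str_cons. cbn [enc_regex app length].
        rewrite code_c0, code_c1, code_c0, code_c1. auto.
    + destruct rs as [|r1 [|r2 rs]]; cbn [length] in Hk; try lia. subst k'.
      destruct Hx as [Hx|Hx]; apply pr3_inj in Hx; destruct Hx as (-> & -> & ->).
      * exists (RCat r1 r2 :: rs), es. rewrite !str_cons. cbn [enc_regex]. rewrite <- !app_assoc.
        cbn [app length]. rewrite code_c0, !code_c1. auto.
      * exists (RUnion r1 r2 :: rs), es. rewrite !str_cons. cbn [enc_regex]. rewrite <- !app_assoc.
        cbn [app length]. rewrite code_c1, !code_c0. auto.
    + destruct rs as [|r1 rs]; cbn [length] in Hk; try lia. subst k'.
      apply pr3_inj in Hx; destruct Hx as (-> & -> & ->).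
      exists (RStar r1 :: rs), es. rewrite !str_cons. cbn [enc_regex]. rewrite <- !app_assoc.
      cbn [app length]. rewrite code_c1, code_c0, code_c1. auto.
    + destruct rs as [|r1 [|r2 rs]]; cbn [length] in Hk; try lia.
      destruct Hx as [Hx|[H3 Hx]]; apply pr3_inj in Hx; destruct Hx as (-> & -> & ->).
      * exists [], (OOmega r1 :: es). rewrite str_cons, !str_nil_cons. cbn [enc_oregex]. rewrite <- !app_assoc.
        cbn [app length]. rewrite !code_c0. auto.
      * destruct es as [|e es]; cbn [length] in Hj; [lia|].
        exists [], (OCat r1 e :: es). rewrite str_cons, !str_nil_cons. cbn [enc_oregex]. rewrite <- !app_assoc.
        cbn [app length]. rewrite code_c0, code_c1. auto.
    + destruct rs as [|r1 rs]; cbn [length] in Hk; try lia.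
      destruct es as [|e1 [|e2 es]]; cbn [length] in Hj; try lia. subst j'.
      apply pr3_inj in Hx; destruct Hx as (-> & -> & ->).
      exists [], (OUnion e1 e2 :: es). rewrite !str_nil_cons. cbn [enc_oregex]. rewrite <- !app_assoc.
      cbn [app length]. rewrite code_c1, code_c0. auto.
Qed.

(** The constructor at the head of the first tree determines the edge, and its tag is consumed, so
    the length of the string decreases. [Hgo] settles the bounds once for all constructors. *)
Lemma parse_complete n : forall rs es N, length (str rs es) <= n ->
  pr3 (S (code (str rs es))) (S (code (str rs es))) (code (str rs es)) <= N ->
  reach parse_step N (pr3 (length es) (length rs) (code (str rs es))) (pr3 0 0 0).
Proof.
  induction n as [n IH] using lt_wf_ind. intros rs es N Hn HN.
  set (P := fun rs es => pr3 (length es) (length rs) (code (str rs es))).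
  assert (Hle : P rs es <= N).
  { etransitivity; [|exact HN]. pose proof (length_le_str rs es).
    pose proof (length_le_code (str rs es)). apply pr3_mono; lia. }
  assert (Hgo : forall rs' es' pre, str rs es = pre ++ str rs' es' -> pre <> [] ->
            (P rs' es' = pr3 (length es') (length rs') (code (str rs' es')) ->
             length es' <= P rs' es' -> length rs' <= P rs' es' -> code (str rs' es') <= P rs' es' ->
             parse_step (P rs es) (P rs' es')) ->
            reach parse_step N (P rs es) (pr3 0 0 0)).
  { intros rs' es' pre E Hpre Hst.
    assert (Hl : length (str rs' es') < length (str rs es)).
    { rewrite E, length_app. destruct pre; [congruence|cbn; lia]. }
    assert (Hc : code (str rs' es') <= code (str rs es)) by (rewrite E, code_app; apply cat_ge).
    apply reach_step with (P rs' es'); auto.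
    - unfold P in *. pose proof (pr3_ge (length es') (length rs') (code (str rs' es'))).
      apply Hst; tauto.
    - apply (IH (length (str rs' es'))); auto; [lia|].
      etransitivity; [|exact HN]. apply pr3_mono; lia. }
  clear HN.
  destruct rs as [|r rs].
  - destruct es as [|e es]; [constructor; exact Hle|].
    destruct e as [r|r e|e1 e2].
    + apply (Hgo [r] es [false; false]); [|discriminate|].
      * rewrite str_nil_cons, str_cons. reflexivity.
      * intros E L1 L2 L3. exists (length es). split; [auto|]. exists 1. split; [auto|].
        exists (code (str [r] es)). split; [auto|]. split; [auto|].
        right; right; right; left. split; auto. left. unfold P. cbn [length]. f_equal.
        rewrite str_nil_cons, str_cons. cbn [enc_oregex app]. now rewrite !code_c0.
    + apply (Hgo [r] (e :: es) [false; true]); [|discriminate|].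
      * rewrite str_nil_cons, str_cons, str_nil_cons. cbn [enc_oregex app]. now rewrite <- app_assoc.
      * intros E L1 L2 L3. exists (S (length es)). split; [auto|]. exists 1. split; [auto|].
        exists (code (str [r] (e :: es))). split; [auto|]. split; [auto|].
        right; right; right; left. split; auto. right. split; [lia|]. unfold P. cbn [length]. f_equal.
        rewrite str_nil_cons, str_cons, str_nil_cons. cbn [enc_oregex app]. rewrite <- app_assoc.
        now rewrite code_c0, code_c1.
    + apply (Hgo [] (e1 :: e2 :: es) [true; false]); [|discriminate|].
      * rewrite !str_nil_cons. cbn [enc_oregex app]. now rewrite <- app_assoc.
      * intros E L1 L2 L3. exists (S (S (length es))). split; [auto|]. exists 0. split; [auto|].
        exists (code (str [] (e1 :: e2 :: es))). split; [auto|]. split; [auto|].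
        right; right; right; right. split; auto. split; [lia|]. unfold P. cbn [length Nat.pred]. f_equal.
        rewrite !str_nil_cons. cbn [enc_oregex app]. rewrite <- app_assoc.
        now rewrite code_c1, code_c0.
  - destruct r as [| |b|r1 r2|r1 r2|r1].
    + apply (Hgo rs es [false; false; false]); [|discriminate|].
      * now rewrite str_cons.
      * intros E L1 L2 L3. exists (length es). split; [auto|]. exists (length rs). split; [auto|].
        exists (code (str rs es)). split; [auto|]. split; [auto|].
        left; left. unfold P. rewrite str_cons. cbn [enc_regex app]. now rewrite !code_c0.
    + apply (Hgo rs es [false; false; true]); [|discriminate|].
      * now rewrite str_cons.
      * intros E L1 L2 L3. exists (length es). split; [auto|]. exists (length rs). split; [auto|].
        exists (code (str rs es)). split; [auto|]. split; [auto|].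
        left; right; left. unfold P. rewrite str_cons. cbn [enc_regex app].
        now rewrite !code_c0, code_c1.
    + apply (Hgo rs es [false; true; false; b]); [|discriminate|].
      * now rewrite str_cons.
      * intros E L1 L2 L3. exists (length es). split; [auto|]. exists (length rs). split; [auto|].
        exists (code (str rs es)). split; [auto|]. split; [auto|].
        left; right; right. unfold P. rewrite str_cons. cbn [enc_regex app].
        rewrite code_c0, code_c1, code_c0.
        destruct b; [right; now rewrite code_c1|left; now rewrite code_c0].
    + apply (Hgo (r1 :: r2 :: rs) es [false; true; true]); [|discriminate|].
      * rewrite !str_cons. cbn [enc_regex app]. now rewrite <- app_assoc.
      * intros E L1 L2 L3. exists (length es). split; [auto|]. exists (S (S (length rs))). split; [auto|].
        exists (code (str (r1 :: r2 :: rs) es)). split; [auto|]. split; [auto|].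
        right; left. split; [lia|]. left. unfold P. cbn [length Nat.pred]. f_equal.
        rewrite !str_cons. cbn [enc_regex app]. rewrite <- app_assoc.
        now rewrite code_c0, !code_c1.
    + apply (Hgo (r1 :: r2 :: rs) es [true; false; false]); [|discriminate|].
      * rewrite !str_cons. cbn [enc_regex app]. now rewrite <- app_assoc.
      * intros E L1 L2 L3. exists (length es). split; [auto|]. exists (S (S (length rs))). split; [auto|].
        exists (code (str (r1 :: r2 :: rs) es)). split; [auto|]. split; [auto|].
        right; left. split; [lia|]. right. unfold P. cbn [length Nat.pred]. f_equal.
        rewrite !str_cons. cbn [enc_regex app]. rewrite <- app_assoc.
        now rewrite code_c1, !code_c0.
    + apply (Hgo (r1 :: rs) es [true; false; true]); [|discriminate|].
      * rewrite !str_cons. reflexivity.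
      * intros E L1 L2 L3. exists (length es). split; [auto|]. exists (S (length rs)). split; [auto|].
        exists (code (str (r1 :: rs) es)). split; [auto|]. split; [auto|].
        right; right; left. split; [lia|]. unfold P. cbn [length]. f_equal.
        rewrite !str_cons. cbn [enc_regex app]. now rewrite code_c1, code_c0, code_c1.
Qed.

Definition is_reg (s : nat) : Prop := parses 0 1 s.
Definition is_oreg (s : nat) : Prop := parses 1 0 s.

Lemma PSP_is_reg s : PS s -> PSP (fun v => is_reg (s v)).
Proof. intros. unfold is_reg. ps. Qed.
Lemma PSP_is_oreg s : PS s -> PSP (fun v => is_oreg (s v)).
Proof. intros. unfold is_oreg. ps. Qed.
#[export] Hint Resolve PSP_is_reg PSP_is_oreg : ps.

Lemma is_reg_spec s : is_reg s <-> exists r, s = code (enc_regex r).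
Proof.
  split.
  - intros H. apply parse_sound in H. destruct H as ([|r [|]] & [|] & H1 & H2 & ->); try discriminate.
    exists r. rewrite str_cons. unfold str. cbn. now rewrite app_nil_r.
  - intros [r ->]. unfold is_reg, parses.
    assert (E : enc_regex r = str [r] []) by (rewrite str_cons; unfold str; cbn; now rewrite app_nil_r).
    rewrite E. eapply (parse_complete _ [r] []); auto.
Qed.

Lemma is_oreg_spec s : is_oreg s <-> exists e, s = code (enc_oregex e).
Proof.
  split.
  - intros H. apply parse_sound in H. destruct H as ([|] & [|e [|]] & H1 & H2 & ->); try discriminate.
    exists e. rewrite str_nil_cons. unfold str. cbn. now rewrite app_nil_r.
  - intros [e ->]. unfold is_oreg, parses.
    assert (E : enc_oregex e = str [] [e]) by (rewrite str_nil_cons; unfold str; cbn; now rewrite app_nil_r).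
    rewrite E. eapply (parse_complete _ [] [e]); auto.
Qed.

(** Polish notation is prefix-free. An edge of the graph that guesses where an operand ends can
    therefore guess it in one way only. *)
Lemma enc_regex_prefix r : forall r' l l', enc_regex r ++ l = enc_regex r' ++ l' -> r = r' /\ l = l'.
Proof.
  induction r as [| |b|r1 IH1 r2 IH2|r1 IH1 r2 IH2|r1 IH1]; intros [| |b'|q1 q2|q1 q2|q1] l l';
    cbn [enc_regex app]; intros H; try discriminate; injection H; clear H; intros; subst; auto;
    rewrite <- ?app_assoc in H.
  - apply IH1 in H. destruct H as [-> H]. apply IH2 in H. destruct H as [-> ->]. auto.
  - apply IH1 in H. destruct H as [-> H]. apply IH2 in H. destruct H as [-> ->]. auto.
  - apply IH1 in H. destruct H as [-> ->]. auto.
Qed.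

Lemma enc_oregex_prefix e : forall e' l l', enc_oregex e ++ l = enc_oregex e' ++ l' -> e = e' /\ l = l'.
Proof.
  induction e as [r|r e IH|e1 IH1 e2 IH2]; intros [r'|r' e'|e1' e2'] l l';
    cbn [enc_oregex app]; intros H; try discriminate; injection H; clear H; intros H;
    rewrite <- ?app_assoc in H.
  - apply enc_regex_prefix in H. destruct H as [-> ->]. auto.
  - apply enc_regex_prefix in H. destruct H as [-> H]. apply IH in H. destruct H as [-> ->]. auto.
  - apply IH1 in H. destruct H as [-> H]. apply IH2 in H. destruct H as [-> ->]. auto.
Qed.

(** * Runs of the stack machine and lassos *)

(** The stack consists of the regular expressions still to be read, above an omega-regular one.
    [OOmega r] stays in place when it pushes its body, so an empty list above it marks a restart. *)
Inductive aeps : list regex -> oregex -> list regex -> oregex -> Prop :=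
  | E_eps ks e : aeps (REps :: ks) e ks e
  | E_cat r1 r2 ks e : aeps (RCat r1 r2 :: ks) e (r1 :: r2 :: ks) e
  | E_un1 r1 r2 ks e : aeps (RUnion r1 r2 :: ks) e (r1 :: ks) e
  | E_un2 r1 r2 ks e : aeps (RUnion r1 r2 :: ks) e (r2 :: ks) e
  | E_st0 r ks e : aeps (RStar r :: ks) e ks e
  | E_st1 r ks e : aeps (RStar r :: ks) e (r :: RStar r :: ks) e
  | E_om r : aeps [] (OOmega r) [r] (OOmega r)
  | E_oc r e : aeps [] (OCat r e) [r] e
  | E_ou1 e1 e2 : aeps [] (OUnion e1 e2) [] e1
  | E_ou2 e1 e2 : aeps [] (OUnion e1 e2) [] e2.

Section Runs.
Variables n D : nat.

Definition ynext (Y : nat) (c : bool) : nat := n * (Y - Nat.b2n c * D).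

(* Y is the scaled remaining target. *)
Inductive apath (Ok : nat -> list regex -> oregex -> Prop) :
  nat -> list regex -> oregex -> list bool -> nat -> list regex -> oregex -> Prop :=
  | ap_refl Y ks e : Ok Y ks e -> apath Ok Y ks e [] Y ks e
  | ap_eps Y ks e ks1 e1 u Y' ks' e' : Ok Y ks e -> aeps ks e ks1 e1 ->
      apath Ok Y ks1 e1 u Y' ks' e' -> apath Ok Y ks e u Y' ks' e'
  | ap_let Y c ks e u Y' ks' e' : Ok Y (RSym c :: ks) e -> Nat.b2n c * D <= Y ->
      ynext Y c <= 2 * D -> apath Ok (ynext Y c) ks e u Y' ks' e' ->
      apath Ok Y (RSym c :: ks) e (c :: u) Y' ks' e'.

Lemma apath_app Ok Y ks e u Y1 ks1 e1 v Y2 ks2 e2 :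
  apath Ok Y ks e u Y1 ks1 e1 -> apath Ok Y1 ks1 e1 v Y2 ks2 e2 ->
  apath Ok Y ks e (u ++ v) Y2 ks2 e2.
Proof. induction 1; cbn [app]; eauto using ap_eps, ap_let. Qed.

(** Serves to express non-emptiness of a cycle in the graph, where words are not recorded: one of
    the edges is a letter edge. *)
Lemma apath_letter Ok Y ks e u Y' ks' e' : apath Ok Y ks e u Y' ks' e' -> u <> [] ->
  exists u1 u2 Y1 c ks1 e1, apath Ok Y ks e u1 Y1 (RSym c :: ks1) e1 /\
    Nat.b2n c * D <= Y1 /\ ynext Y1 c <= 2 * D /\ apath Ok (ynext Y1 c) ks1 e1 u2 Y' ks' e'.
Proof.
  induction 1 as [|Y ks e ks1 e1 u Y' ks' e' HO HE HP IH|]; intros Hu.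
  - congruence.
  - destruct (IH Hu) as (u1 & u2 & Y1 & c & ks2 & e2 & H1 & H2).
    exists u1, u2, Y1, c, ks2, e2. split; eauto using ap_eps.
  - exists [], u, Y, c, ks, e. split; auto. now constructor.
Qed.

Fixpoint yend (Y : nat) (u : list bool) : nat :=
  match u with [] => Y | c :: u' => yend (ynext Y c) u' end.

Fixpoint yfin (Y : nat) (u : list bool) : Prop :=
  match u with
  | [] => Y <= 2 * D
  | c :: u' => Nat.b2n c * D <= Y /\ Y <= 2 * D /\ yfin (ynext Y c) u'
  end.

Lemma yfin_le Y u : yfin Y u -> Y <= 2 * D.
Proof. destruct u; cbn; tauto. Qed.

Lemma yfin_app Y u v : yfin Y (u ++ v) <-> yfin Y u /\ yfin (yend Y u) v.
Proof.
  revert Y. induction u as [|c u IH]; intros Y; cbn.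
  - split; [|tauto]. intros H. split; auto. now apply yfin_le in H.
  - rewrite IH. tauto.
Qed.

Lemma yend_app Y u v : yend Y (u ++ v) = yend (yend Y u) v.
Proof. revert Y. induction u as [|c u IH]; intros Y; cbn; auto. Qed.

Lemma apath_y Ok Y ks e u Y' ks' e' : apath Ok Y ks e u Y' ks' e' -> Y <= 2 * D ->
  yfin Y u /\ yend Y u = Y'.
Proof.
  induction 1; intros HY; cbn; auto. destruct IHapath; auto.
Qed.

Variable M : nat.
Definition OkM (Y : nat) (ks : list regex) (e : oregex) : Prop :=
  Y <= 2 * D /\ length (str ks [e]) <= M.

Lemma length_str_cons r ks e : length (str (r :: ks) [e]) = length (enc_regex r) + length (str ks [e]).
Proof. now rewrite str_cons, length_app. Qed.

Lemma yend_le Y u : yfin Y u -> yend Y u <= 2 * D.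
Proof. revert Y. induction u; cbn; intros Y; [auto|]. intros H. apply IHu. tauto. Qed.

(* Expanding a star re-pushes it, so a run through r needs extra room that is quadratic in |r|. *)
Lemma apath_regex r : forall u Y ks e, regex_lang r u -> yfin Y u ->
  length (str ks [e]) + length (enc_regex r) * length (enc_regex r) <= M ->
  apath OkM Y (r :: ks) e u (yend Y u) ks e.
Proof.
  assert (Hok : forall r ks e Y, Y <= 2 * D ->
    length (str ks [e]) + length (enc_regex r) * length (enc_regex r) <= M -> OkM Y (r :: ks) e).
  { intros r' ks e Y HY HM. split; auto. rewrite length_str_cons. nia. }
  assert (Hok' : forall L ks e Y, Y <= 2 * D ->
    length (str ks [e]) + L <= M -> OkM Y ks e).
  { intros L ks e Y HY HM. split; auto. lia. }
  induction r as [| |b|r1 IH1 r2 IH2|r1 IH1 r2 IH2|r1 IH1]; intros u Y ks e Hu HY HM;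
    cbn [regex_lang] in Hu.
  - contradiction.
  - subst u. cbn in HY |- *. eapply ap_eps; [apply (Hok REps); auto|constructor|].
    constructor. eapply Hok'; eauto.
  - subst u. cbn in HY. destruct HY as (H1 & H2 & H3). cbn [yend].
    apply ap_let; auto. constructor. eapply Hok'; eauto.
  - destruct Hu as (u1 & u2 & -> & Hu1 & Hu2). apply yfin_app in HY. destruct HY as [HY1 HY2].
    rewrite yend_app. pose proof (yfin_le _ _ HY1).
    eapply ap_eps; [apply (Hok (RCat r1 r2)); auto|constructor|].
    cbn [enc_regex] in HM. rewrite !length_app in HM. cbn [length] in HM.
    eapply apath_app; [apply IH1|apply IH2]; auto; rewrite ?length_str_cons; nia.
  - pose proof (yfin_le _ _ HY).
    assert (HM' := HM). cbn [enc_regex] in HM. rewrite !length_app in HM. cbn [length] in HM.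
    destruct Hu as [Hu|Hu].
    + eapply ap_eps; [apply (Hok (RUnion r1 r2)); auto|apply E_un1|]. apply IH1; auto. nia.
    + eapply ap_eps; [apply (Hok (RUnion r1 r2)); auto|apply E_un2|]. apply IH2; auto. nia.
  - destruct Hu as (ws & -> & Hws). revert Y HY. induction Hws as [|x ws Hx Hws IH]; intros Y HY.
    + cbn in HY |- *. eapply ap_eps; [apply (Hok (RStar r1)); auto|apply E_st0|].
      constructor. eapply Hok'; eauto.
    + cbn [concat] in HY |- *. apply yfin_app in HY. destruct HY as [HY1 HY2].
      rewrite yend_app. pose proof (yfin_le _ _ HY1).
      eapply ap_eps; [apply (Hok (RStar r1)); auto|apply E_st1|].
      eapply apath_app; [apply IH1; auto|apply IH; auto].
      rewrite length_str_cons. cbn [enc_regex] in HM |- *. rewrite !length_app in *. cbn [length] in *. nia.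
Qed.

(** * From words to lassos *)

Fixpoint ys (Y : nat) (w : nat -> bool) (i : nat) : nat :=
  match i with 0 => Y | S i' => ynext (ys Y w i') (w i') end.

Definition good (Y : nat) (w : nat -> bool) : Prop :=
  forall i, Nat.b2n (w i) * D <= ys Y w i /\ ys Y w i <= 2 * D.

Lemma good_segment Y w m : good Y w -> forall i,
  yfin (ys Y w i) (map w (seq i m)) /\ yend (ys Y w i) (map w (seq i m)) = ys Y w (i + m).
Proof.
  intros H. induction m as [|m IH]; intros i; cbn [seq map yfin yend].
  - rewrite Nat.add_0_r. split; auto. apply H.
  - destruct (IH (S i)) as [H1 H2]. change (ynext (ys Y w i) (w i)) with (ys Y w (S i)).
    rewrite H2. split; [|f_equal; lia]. destruct (H i). auto.
Qed.

Lemma segment_good Y w m : forall i, yfin (ys Y w i) (map w (seq i m)) ->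
  ys Y w (i + m) = yend (ys Y w i) (map w (seq i m)) /\
  forall j, j < m -> Nat.b2n (w (i + j)) * D <= ys Y w (i + j) /\ ys Y w (i + j) <= 2 * D.
Proof.
  induction m as [|m IH]; intros i; cbn [seq map yfin yend].
  - intros _. rewrite Nat.add_0_r. split; auto. intros; lia.
  - intros (H1 & H2 & H3). change (ynext (ys Y w i) (w i)) with (ys Y w (S i)) in *.
    destruct (IH (S i) H3) as [H4 H5]. rewrite <- H4. split; [f_equal; lia|].
    intros [|j] Hj; [rewrite Nat.add_0_r; auto|].
    replace (i + S j) with (S i + j) by lia. apply H5. lia.
Qed.

Lemma map_seq_eq (w : nat -> bool) a l :
  (forall j, j < length l -> w (a + j) = nth j l false) -> map w (seq a (length l)) = l.
Proof.
  revert a. induction l as [|b l IH]; intros a H; cbn [length seq map]; auto.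
  f_equal.
  - rewrite <- (Nat.add_0_r a). apply (H 0). cbn; lia.
  - apply IH. intros j Hj. replace (S a + j) with (a + S j) by lia. apply (H (S j)). cbn; lia.
Qed.

Lemma prepend_l u w j : j < length u -> prepend u w j = nth j u false.
Proof. intros H. unfold prepend. apply Nat.ltb_lt in H. now rewrite H. Qed.

Lemma prepend_r u w j : prepend u w (length u + j) = w j.
Proof.
  unfold prepend. destruct (Nat.ltb_spec (length u + j) (length u)); [lia|]. f_equal. lia.
Qed.

Lemma good_prepend Y w u w' : good Y w -> (forall i, w i = prepend u w' i) ->
  yfin Y u /\ good (yend Y u) w'.
Proof.
  intros HG Hw.
  assert (E : map w (seq 0 (length u)) = u).
  { apply map_seq_eq. intros j Hj. cbn. rewrite Hw. now apply prepend_l. }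
  destruct (good_segment Y w (length u) HG 0) as [H1 H2]. rewrite E in H1, H2. cbn in H1, H2.
  split; auto.
  assert (Hs : forall i, ys (yend Y u) w' i = ys Y w (length u + i)).
  { induction i as [|i IH]; cbn [ys]; [now rewrite Nat.add_0_r|].
    rewrite Nat.add_succ_r. cbn [ys]. now rewrite IH, Hw, prepend_r. }
  intros i. rewrite Hs, <- (prepend_r u w' i), <- Hw. apply HG.
Qed.

Lemma pigeonhole (f : nat -> nat) b : (forall k, f k <= b) -> exists i j, i < j /\ f i = f j.
Proof.
  intros Hb. apply NNPP. intros Hn.
  assert (length (map f (seq 0 (S (S b)))) <= length (seq 0 (S b))) as H.
  { apply NoDup_incl_length.
    - apply NoDup_map_NoDup_ForallPairs; [|apply seq_NoDup].
      intros x y _ _ E. destruct (Nat.lt_trichotomy x y) as [L|[L|L]]; auto; exfalso; apply Hn.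
      + now exists x, y.
      + now exists y, x.
    - intros y Hy. apply in_map_iff in Hy. destruct Hy as (x & <- & _). apply in_seq.
      specialize (Hb x). lia. }
  rewrite length_map, !length_seq in H. lia.
Qed.

(** At the positions where the omega-power restarts, the remainders lie between 0 and 2D, so two
    coincide, and the stretch between them is the cycle. A regular prefix is consumed together with
    its part of the remainder, after which the suffix is good again. The square pays for the room
    inside a regular part, the linear term for the expression below it on the stack. *)
Lemma lasso_complete e : forall w Y, oregex_lang e w -> good Y w ->
  length (enc_oregex e) * length (enc_oregex e) + length (enc_oregex e) <= M ->
  exists u Y' r v, apath OkM Y [] e u Y' [] (OOmega r) /\
    apath OkM Y' [] (OOmega r) v Y' [] (OOmega r) /\ v <> [].
Proof.
  assert (Hstr : forall e, length (str [] [e]) = length (enc_oregex e)).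
  { intros e'. unfold str. cbn. now rewrite app_nil_r. }
  assert (Hok : forall e Y, Y <= 2 * D ->
    length (enc_oregex e) * length (enc_oregex e) + length (enc_oregex e) <= M -> OkM Y [] e).
  { intros e' Y HY HM. split; auto. rewrite Hstr. lia. }
  induction e as [r|r e IH|e1 IH1 e2 IH2]; intros w Y Hw HG HM; cbn [oregex_lang] in Hw.
  - destruct Hw as (p & Hp0 & Hp & Hseg).
    assert (Hlen : length (enc_oregex (OOmega r)) = 2 + length (enc_regex r)) by reflexivity.
    assert (Hone : forall k, apath OkM (ys Y w (p k)) [] (OOmega r)
                     (segment w (p k) (p (S k))) (ys Y w (p (S k))) [] (OOmega r)).
    { intros k. destruct (good_segment Y w (p (S k) - p k) HG (p k)) as [H1 H2].
      specialize (Hp k). replace (p k + (p (S k) - p k)) with (p (S k)) in H2 by lia.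
      eapply ap_eps; [apply Hok; [apply HG|exact HM]|apply E_om|].
      rewrite <- H2. apply apath_regex; [apply Hseg|exact H1|]. rewrite Hstr. nia. }
    assert (Hmany : forall m k, exists v, apath OkM (ys Y w (p k)) [] (OOmega r)
                     v (ys Y w (p (k + m))) [] (OOmega r) /\ (0 < m -> v <> [])).
    { induction m as [|m IHm]; intros k.
      - exists []. rewrite Nat.add_0_r. split; [|lia]. constructor. apply Hok; auto. apply HG.
      - destruct (IHm (S k)) as (v & H1 & _). exists (segment w (p k) (p (S k)) ++ v). split.
        + eapply apath_app; [apply Hone|]. now rewrite Nat.add_succ_r.
        + intros _ E. apply app_eq_nil in E. destruct E as [E _].
          apply (f_equal (@length bool)) in E. unfold segment in E.
          rewrite length_map, length_seq in E. specialize (Hp k). cbn in E. lia. }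
    destruct (pigeonhole (fun k => ys Y w (p k)) (2 * D)) as (i & j & Hij & E); [intros k; apply HG|].
    destruct (Hmany i 0) as (u & Hu & _). destruct (Hmany (j - i) i) as (v & Hv & Hne).
    replace (i + (j - i)) with j in Hv by lia. rewrite <- E in Hv. rewrite Hp0 in Hu.
    exists u, (ys Y w (p i)), r, v. split; auto. split; auto. apply Hne. lia.
  - destruct Hw as (u & w' & Hu & Hw' & Ew).
    destruct (good_prepend Y w u w' HG Ew) as [H1 H2].
    assert (Hlen : length (enc_oregex (OCat r e)) = 2 + length (enc_regex r) + length (enc_oregex e)).
    { cbn. rewrite length_app. lia. }
    destruct (IH w' (yend Y u) Hw' H2) as (u' & Y' & r' & v & P1 & P2 & P3); [nia|].
    exists (u ++ u'), Y', r', v. split; auto.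
    eapply ap_eps; [apply Hok; [apply yfin_le in H1; auto|exact HM]|apply E_oc|].
    eapply apath_app; [|exact P1]. apply apath_regex; auto. rewrite Hstr. nia.
  - assert (Hlen : length (enc_oregex (OUnion e1 e2)) = 2 + length (enc_oregex e1) + length (enc_oregex e2)).
    { cbn. rewrite length_app. lia. }
    assert (HY : Y <= 2 * D) by apply (HG 0).
    destruct Hw as [Hw|Hw].
    + destruct (IH1 w Y Hw HG) as (u' & Y' & r' & v & P1 & P2 & P3); [nia|].
      exists u', Y', r', v. split; auto. eapply ap_eps; [apply Hok; auto|apply E_ou1|auto].
    + destruct (IH2 w Y Hw HG) as (u' & Y' & r' & v & P1 & P2 & P3); [nia|].
      exists u', Y', r', v. split; auto. eapply ap_eps; [apply Hok; auto|apply E_ou2|auto].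
Qed.

(** * From lassos to words *)

Lemma prepend_app u v w i : prepend (u ++ v) w i = prepend u (prepend v w) i.
Proof.
  unfold prepend. rewrite length_app.
  destruct (Nat.ltb_spec i (length u)), (Nat.ltb_spec i (length u + length v)),
    (Nat.ltb_spec (i - length u) (length v)); try lia;
    first [now apply app_nth1 | now apply app_nth2 | f_equal; lia].
Qed.

Lemma prepend_ext u w w' i : (forall i, w i = w' i) -> prepend u w i = prepend u w' i.
Proof. intros H. unfold prepend. destruct (Nat.ltb i (length u)); auto. Qed.

Lemma oregex_lang_ext e : forall w w', (forall i, w i = w' i) -> oregex_lang e w -> oregex_lang e w'.
Proof.
  induction e as [r|r e IH|e1 IH1 e2 IH2]; intros w w' E; cbn [oregex_lang].
  - intros (p & H1 & H2 & H3). exists p. repeat split; auto. intros k.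
    replace (segment w' (p k) (p (S k))) with (segment w (p k) (p (S k))); auto.
    unfold segment. now apply map_ext.
  - intros (u & w1 & H1 & H2 & H3). exists u, w1. repeat split; auto. intros i. now rewrite <- E.
  - intros [H|H]; [left|right]; eauto.
Qed.

Fixpoint stlang (ks : list regex) (e : oregex) (w : nat -> bool) : Prop :=
  match ks with
  | [] => oregex_lang e w
  | r :: ks' => exists u w', regex_lang r u /\ stlang ks' e w' /\ forall i, w i = prepend u w' i
  end.

Lemma stlang_ext ks e w w' : (forall i, w i = w' i) -> stlang ks e w -> stlang ks e w'.
Proof.
  destruct ks as [|r ks]; intros E; cbn [stlang].
  - now apply oregex_lang_ext.
  - intros (u & w1 & H1 & H2 & H3). exists u, w1. repeat split; auto. intros i. now rewrite <- E.
Qed.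

(** A nonempty u becomes a new first factor. An empty one must be dropped, since factor boundaries
    strictly increase. *)
Lemma oomega_prepend r u w w' : regex_lang r u -> oregex_lang (OOmega r) w' ->
  (forall i, w i = prepend u w' i) -> oregex_lang (OOmega r) w.
Proof.
  intros Hu Hw' E. destruct u as [|b u].
  - eapply oregex_lang_ext; [|exact Hw']. intros i. rewrite E. exact (eq_sym (prepend_r [] w' i)).
  - destruct Hw' as (p & H1 & H2 & H3).
    exists (fun k => match k with 0 => 0 | S k' => length (b :: u) + p k' end). split; auto. split.
    + intros [|k]; [cbn [length]; lia|]. specialize (H2 k). lia.
    + intros [|k].
      * rewrite H1, Nat.add_0_r. unfold segment. rewrite Nat.sub_0_r, map_seq_eq; auto.
        intros j Hj. cbn [Nat.add]. rewrite E. now apply prepend_l.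
      * specialize (H3 k). unfold segment in *.
        replace (length (b :: u) + p (S k) - (length (b :: u) + p k)) with (p (S k) - p k) by lia.
        replace (map w (seq (length (b :: u) + p k) (p (S k) - p k)))
          with (map w' (seq (p k) (p (S k) - p k))); auto.
        generalize (p (S k) - p k) as m. generalize (p k) as a. clear - E.
        intros a m; revert a; induction m as [|m IH]; intros a; cbn [seq map]; auto.
        rewrite IH, E, prepend_r. f_equal. f_equal. now rewrite Nat.add_succ_r.
Qed.

Lemma aeps_sound ks e ks' e' w : aeps ks e ks' e' -> stlang ks' e' w -> stlang ks e w.
Proof.
  destruct 1; cbn [stlang].
  - intros H. exists [], w. split; [reflexivity|]. split; auto. intros i. symmetry. apply (prepend_r [] w i).
  - intros (u1 & w1 & H1 & (u2 & w2 & H2 & H3 & E2) & E1).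
    exists (u1 ++ u2), w2. split; [cbn; eauto|]. split; auto.
    intros i. rewrite E1, prepend_app. now apply prepend_ext.
  - intros (u1 & w1 & H1 & H2 & E1). exists u1, w1. cbn. auto.
  - intros (u1 & w1 & H1 & H2 & E1). exists u1, w1. cbn. auto.
  - intros H. exists [], w. split; [exists []; auto|]. split; auto. intros i. symmetry. apply (prepend_r [] w i).
  - intros (u1 & w1 & H1 & (u2 & w2 & (ws & -> & Hws) & H3 & E2) & E1).
    exists (u1 ++ concat ws), w2. split; [exists (u1 :: ws); auto|]. split; auto.
    intros i. rewrite E1, prepend_app. now apply prepend_ext.
  - intros (u1 & w1 & H1 & H2 & E1). eapply oomega_prepend; eauto.
  - intros (u1 & w1 & H1 & H2 & E1). cbn. eauto.
  - cbn. auto.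
  - cbn. auto.
Qed.

Lemma apath_sound Ok Y ks e u Y' ks' e' w : apath Ok Y ks e u Y' ks' e' ->
  stlang ks' e' w -> stlang ks e (prepend u w).
Proof.
  induction 1; intros Hw.
  - eapply stlang_ext; [|exact Hw]. intros i. symmetry. apply (prepend_r [] w i).
  - eapply aeps_sound; eauto.
  - exists [c], (prepend u w). split; [reflexivity|]. split; auto.
    intros i. apply (prepend_app [c] u w i).
Qed.

Fixpoint catlang (ks : list regex) (u : list bool) : Prop :=
  match ks with
  | [] => u = []
  | r :: ks' => exists u1 u2, u = u1 ++ u2 /\ regex_lang r u1 /\ catlang ks' u2
  end.

(** For the induction the initial stack is arbitrary: the run finishes it, then reads one word of r,
    possibly empty, for each restart. The cycle is the case of the empty stack. *)
Lemma cycle_words Ok Y ks e v Y' ks' e' r : apath Ok Y ks e v Y' ks' e' ->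
  e = OOmega r -> ks' = [] -> e' = OOmega r ->
  exists u ws, v = u ++ concat ws /\ catlang ks u /\ Forall (regex_lang r) ws.
Proof.
  induction 1 as [Y ks e|Y ks e ks1 e1 u Y' ks' e' HO HE HP IH|Y c ks e u Y' ks' e' HO H1 H2 HP IH];
    intros E1 E2 E3; subst.
  - now exists [], [].
  - inversion HE; subst; destruct IH as (u1 & ws & -> & Hc & Hws); auto; cbn [catlang] in *.
    + exists u1, ws. split; auto. split; auto. exists [], u1. cbn. auto.
    + destruct Hc as (x1 & x2 & -> & Hx1 & x3 & x4 & -> & Hx3 & Hx4).
      exists (x1 ++ x3 ++ x4), ws. split; auto. split; auto.
      exists (x1 ++ x3), x4. rewrite app_assoc. cbn. eauto 8.
    + destruct Hc as (x1 & x2 & -> & Hx1 & Hx2). exists (x1 ++ x2), ws. split; auto. split; auto.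
      exists x1, x2. cbn. auto.
    + destruct Hc as (x1 & x2 & -> & Hx1 & Hx2). exists (x1 ++ x2), ws. split; auto. split; auto.
      exists x1, x2. cbn. auto.
    + exists u1, ws. split; auto. split; auto. exists [], u1. split; auto. split; auto. now exists [].
    + destruct Hc as (x1 & x2 & -> & Hx1 & x3 & x4 & -> & (xs & -> & Hxs) & Hx4).
      exists (x1 ++ concat xs ++ x4), ws. split; auto. split; auto.
      exists (x1 ++ concat xs), x4. rewrite app_assoc. split; auto. split; auto. now exists (x1 :: xs); auto.
    + destruct Hc as (x1 & x2 & -> & Hx1 & ->). exists [], (x1 :: ws).
      rewrite app_nil_r. cbn. auto.
  - destruct IH as (u1 & ws & -> & Hc & Hws); auto. exists (c :: u1), ws. split; auto. split; auto.
    exists [c], u1. cbn. auto.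
Qed.

Definition periodic (v : list bool) (i : nat) : bool := nth (i mod length v) v false.

Lemma periodic_segment v c pre x post : v = pre ++ x ++ post -> x <> [] ->
  map (periodic v) (seq (c * length v + length pre) (length x)) = x.
Proof.
  intros E Hx. apply map_seq_eq. intros j Hj. unfold periodic.
  assert (Hl : length v = length pre + length x + length post) by (rewrite E, !length_app; lia).
  replace (c * length v + length pre + j) with ((length pre + j) + c * length v) by lia.
  rewrite Nat.Div0.mod_add, Nat.mod_small by lia.
  rewrite E, app_nth2 by lia. replace (length pre + j - length pre) with j by lia.
  now apply app_nth1.
Qed.

Lemma oomega_periodic r ws : Forall (regex_lang r) ws -> concat ws <> [] ->
  oregex_lang (OOmega r) (periodic (concat ws)).
Proof.
  intros Hws Hne.
  (* Empty factors are removed, as boundaries must strictly increase; one factor survives because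
     the concatenation is not empty. *)
  set (xs := filter (fun x : list bool => negb (length x =? 0)) ws).
  assert (Hc : concat ws = concat xs).
  { unfold xs. clear. induction ws as [|x ws IH]; auto. cbn. destruct x; cbn; now rewrite IH. }
  assert (Hxs : Forall (regex_lang r) xs).
  { apply Forall_forall. intros x Hx. apply filter_In in Hx. eapply Forall_forall in Hws; [exact Hws|tauto]. }
  assert (Hxn : Forall (fun x => x <> []) xs).
  { apply Forall_forall. intros x Hx. apply filter_In in Hx. destruct Hx as [_ Hx].
    intros ->. discriminate. }
  rewrite Hc in *. assert (xs <> []) by (intros E; rewrite E in Hne; now apply Hne).
  clearbody xs. clear ws Hws Hc. set (v := concat xs) in *.
  (* The state is the current position with the factors left in the current period. A list about to
     run out is refilled with [xs] at once, so it is never empty. *)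
  set (nxt := fun s : nat * list (list bool) =>
     match snd s with
     | [] => s
     | x :: rem => (fst s + length x, match rem with [] => xs | _ => rem end)
     end).
  set (s := fun k => Nat.iter k nxt (0, xs)).
  assert (Hinv : forall k, exists pre c, pre ++ snd (s k) = xs /\ snd (s k) <> [] /\
            fst (s k) = c * length v + length (concat pre)).
  { induction k as [|k (pre & c & H1 & H2 & H3)]; [now exists [], 0|].
    change (s (S k)) with (nxt (s k)). unfold nxt.
    destruct (snd (s k)) as [|x [|y rem]] eqn:E; [congruence| |]; cbn [fst snd].
    - exists [], (S c). split; auto. split; auto. rewrite H3. unfold v. rewrite <- H1, concat_app, length_app.
      cbn [concat length]. rewrite app_nil_r. lia.
    - exists (pre ++ [x]), c. split; [now rewrite <- app_assoc|]. split; [discriminate|].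
      rewrite H3, concat_app, length_app. cbn [concat]. rewrite app_nil_r. lia. }
  assert (Hnext : forall k, exists x, regex_lang r x /\ x <> [] /\ fst (s (S k)) = fst (s k) + length x /\
            map (periodic v) (seq (fst (s k)) (length x)) = x).
  { intros k. destruct (Hinv k) as (pre & c & H1 & H2 & H3).
    change (s (S k)) with (nxt (s k)). unfold nxt.
    destruct (snd (s k)) as [|x rem] eqn:E; [congruence|]. exists x. cbn [fst].
    assert (Hin : In x xs) by (rewrite <- H1; apply in_elt).
    split; [eapply Forall_forall in Hxs; eauto|].
    assert (x <> []) by (eapply Forall_forall in Hxn; eauto).
    split; auto. split; auto. rewrite H3. apply periodic_segment with (concat rem); auto.
    unfold v. rewrite <- H1, concat_app. reflexivity. }
  exists (fun k => fst (s k)). split; [reflexivity|]. split.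
  - intros k. destruct (Hnext k) as (x & _ & Hx & -> & _). destruct x; [congruence|cbn; lia].
  - intros k. destruct (Hnext k) as (x & Hr & _ & -> & Hseg). unfold segment.
    replace (fst (s k) + length x - fst (s k)) with (length x) by lia. now rewrite Hseg.
Qed.

(** The remainder is back at [yend Y u] after each copy of v, so every copy meets the same
    inequalities as the first. *)
Lemma good_lasso Y u v : yfin Y u -> yfin (yend Y u) v -> yend (yend Y u) v = yend Y u -> v <> [] ->
  good Y (prepend u (periodic v)).
Proof.
  intros Hu Hv E Hne. set (w := prepend u (periodic v)).
  assert (Hlv : 0 < length v) by (destruct v; [congruence|cbn; lia]).
  assert (Eu : map w (seq 0 (length u)) = u).
  { apply map_seq_eq. intros j Hj. now apply prepend_l. }
  assert (Hb : forall c, map w (seq (length u + c * length v) (length v)) = v).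
  { intros c. apply map_seq_eq. intros j Hj. unfold w. rewrite <- Nat.add_assoc, prepend_r.
    unfold periodic. rewrite Nat.add_comm, Nat.Div0.mod_add, Nat.mod_small; auto. }
  destruct (segment_good Y w (length u) 0) as [H1 H2]; [now rewrite Eu|].
  cbn [Nat.add] in H1, H2. rewrite Eu in H1.
  assert (H1' : ys Y w (length u) = yend Y u) by exact H1.
  assert (Hc : forall c, ys Y w (length u + c * length v) = yend Y u).
  { induction c as [|c IH]; [now rewrite Nat.add_0_r|].
    destruct (segment_good Y w (length v) (length u + c * length v)) as [H3 _].
    - now rewrite IH, Hb.
    - rewrite IH, Hb in H3. rewrite <- E, <- H3. f_equal. cbn [Nat.mul]. lia. }
  intros i. destruct (Nat.lt_ge_cases i (length u)) as [L|L]; [auto|].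
  set (q := (i - length u) / length v).
  assert (Hi : i = length u + q * length v + (i - length u) mod length v).
  { pose proof (Nat.div_mod (i - length u) (length v) ltac:(lia)). unfold q. nia. }
  destruct (segment_good Y w (length v) (length u + q * length v)) as [_ H3].
  - now rewrite Hc, Hb.
  - rewrite Hi. apply H3. apply Nat.mod_upper_bound. lia.
Qed.

Lemma lasso_sound Ok Y e u Y' r v : Y <= 2 * D -> apath Ok Y [] e u Y' [] (OOmega r) ->
  apath Ok Y' [] (OOmega r) v Y' [] (OOmega r) -> v <> [] ->
  exists w, oregex_lang e w /\ good Y w.
Proof.
  intros HY P1 P2 Hv. exists (prepend u (periodic v)). split.
  - apply (apath_sound _ _ _ _ _ _ _ _ (periodic v) P1). cbn [stlang].
    destruct (cycle_words _ _ _ _ _ _ _ _ r P2) as (u0 & ws & E & Hc & Hws); auto.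
    cbn in Hc. subst u0. cbn [app] in E. rewrite E in *. now apply oomega_periodic.
  - destruct (apath_y _ _ _ _ _ _ _ _ P1 HY) as [H1 H2].
    assert (HY' : Y' <= 2 * D) by (rewrite <- H2; now apply yend_le).
    destruct (apath_y _ _ _ _ _ _ _ _ P2 HY') as [H3 H4].
    apply good_lasso; rewrite ?H2; auto.
Qed.
End Runs.

(** * The graph on codes *)

(** The height is stored because the tags of regular and omega-regular expressions overlap: it tells
    which kind the string begins with. *)
Definition nd (Y : nat) (ks : list regex) (e : oregex) : nat :=
  pr3 Y (length ks) (code (str ks [e])).

(** In Polish notation a concatenation expands by dropping its tag, since its operands already stand
    in order. Union and star have to delimit operands, which [is_reg] does. When a star is repeated,
    its whole string z stays behind the pushed body. *)
Definition eps_regex (k z k' z' : nat) : Prop :=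
  (z = cb0 (cb0 (cb1 z')) /\ k = S k') \/
  (z = cb0 (cb1 (cb1 z')) /\ k' = S k) \/
  (exists u, u <= z /\ exists w, w <= z /\ exists q, q <= z /\
     (z = cb1 (cb0 (cb0 (cat u (cat w q)))) /\ is_reg u /\ is_reg w /\ k' = k /\
      (z' = cat u q \/ z' = cat w q))) \/
  (exists u, u <= z /\ exists q, q <= z /\
     (z = cb1 (cb0 (cb1 (cat u q))) /\ is_reg u /\
      ((k = S k' /\ z' = q) \/ (k' = S k /\ z' = cat u z)))).

Definition eps_oregex (z k' z' : nat) : Prop :=
  (exists u, u <= z /\ (z = cb0 (cb0 u) /\ is_reg u /\ k' = 1 /\ z' = cat u z)) \/
  (z = cb0 (cb1 z') /\ k' = 1) \/
  (exists u, u <= z /\ exists w, w <= z /\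
     (z = cb1 (cb0 (cat u w)) /\ is_oreg u /\ is_oreg w /\ k' = 0 /\ (z' = u \/ z' = w))).

Definition eps_rel (x y : nat) : Prop :=
  exists Y, Y <= x /\ exists k, k <= x /\ exists z, z <= x /\ exists k', k' <= y /\ exists z', z' <= y /\
    (x = pr3 Y k z /\ y = pr3 Y k' z' /\
     ((1 <= k /\ eps_regex k z k' z') \/ (k = 0 /\ eps_oregex z k' z'))).

Definition let_rel (n D x y : nat) : Prop :=
  exists Y, Y <= x /\ exists Y', Y' <= y /\ exists k, k <= y /\ exists z, z <= y /\
    (y = pr3 Y' k z /\ Y' <= 2 * D /\
     ((x = pr3 Y (S k) (cb0 (cb1 (cb0 (cb0 z)))) /\ Y' = n * Y) \/
      (x = pr3 Y (S k) (cb0 (cb1 (cb0 (cb1 z)))) /\ D <= Y /\ Y' = n * (Y - D)))).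

Definition graph_rel (n D x y : nat) : Prop := eps_rel x y \/ let_rel n D x y.

(** Nodes of height 0 with tag 00 are the restarts. The cycle must use a letter edge, from x to y,
    because a loop of silent moves would spell no infinite word. *)
Definition lasso (n D N P E : nat) : Prop :=
  P <= 2 * D /\
  exists Y, Y <= N /\ exists u, u <= N /\ exists x, x <= N /\ exists y, y <= N /\
    (reach (graph_rel n D) N (pr3 P 0 E) (pr3 Y 0 (cb0 (cb0 u))) /\
     reach (graph_rel n D) N (pr3 Y 0 (cb0 (cb0 u))) x /\ let_rel n D x y /\
     reach (graph_rel n D) N y (pr3 Y 0 (cb0 (cb0 u)))).

Lemma PSP_eps_regex k z k' z' : PS k -> PS z -> PS k' -> PS z' ->
  PSP (fun v => eps_regex (k v) (z v) (k' v) (z' v)).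
Proof. intros. unfold eps_regex. ps. Qed.

Lemma PSP_eps_oregex z k' z' : PS z -> PS k' -> PS z' ->
  PSP (fun v => eps_oregex (z v) (k' v) (z' v)).
Proof. intros. unfold eps_oregex. ps. Qed.
#[export] Hint Resolve PSP_eps_regex PSP_eps_oregex : ps.

Lemma PSP_eps_rel x y : PS x -> PS y -> PSP (fun v => eps_rel (x v) (y v)).
Proof. intros. unfold eps_rel. ps. Qed.

Lemma PSP_let_rel n D x y : PS n -> PS D -> PS x -> PS y ->
  PSP (fun v => let_rel (n v) (D v) (x v) (y v)).
Proof. intros. unfold let_rel. ps. Qed.
#[export] Hint Resolve PSP_eps_rel PSP_let_rel : ps.

Lemma PSP_graph_reach n D N x y : PS n -> PS D -> PS N -> PS x -> PS y ->
  PSP (fun v => reach (graph_rel (n v) (D v)) (N v) (x v) (y v)).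
Proof.
  intros. apply (PSP_reach _ _ _ (fun x y v => graph_rel (n v) (D v) x y)); auto.
  unfold graph_rel. ps.
Qed.
#[export] Hint Resolve PSP_graph_reach : ps.

Lemma PSP_lasso n D N P E : PS n -> PS D -> PS N -> PS P -> PS E ->
  PSP (fun v => lasso (n v) (D v) (N v) (P v) (E v)).
Proof. intros. unfold lasso. ps. Qed.
#[export] Hint Resolve PSP_lasso : ps.

Lemma eps_rel_sound Y ks e y : eps_rel (nd Y ks e) y ->
  exists ks' e', aeps ks e ks' e' /\ y = nd Y ks' e'.
Proof.
  intros (Y1 & _ & k & _ & z & _ & k' & _ & z' & _ & Ex & -> & H).
  apply pr3_inj in Ex. destruct Ex as (<- & <- & <-). destruct (code_surj z') as [l' ->].
  assert (Hfin : forall ks' e', aeps ks e ks' e' -> length ks' = k' -> l' = str ks' [e'] ->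
     exists ks' e', aeps ks e ks' e' /\ pr3 Y k' (code l') = nd Y ks' e').
  { intros ks' e' H1 <- ->. now exists ks', e'. }
  destruct H as [[Hk H]|[Hk H]].
  - destruct ks as [|r ks]; [cbn in Hk; lia|]. rewrite str_cons in H.
    destruct H as [[E Ek]|[[E Ek]|[(u & _ & w & _ & q & _ & E & Hu & Hw & Ek & Hz)|(u & _ & q & _ & E & Hu & Hz)]]].
    + rewrite <- code_c1, <- !code_c0 in E. apply code_inj in E.
      destruct r; try discriminate. cbn in E. injection E as E.
      apply (Hfin ks e); [constructor| |auto]. cbn in Ek. lia.
    + rewrite <- !code_c1, <- code_c0 in E. apply code_inj in E.
      destruct r; try discriminate. cbn [enc_regex] in E. rewrite <- !app_assoc in E.
      cbn [app] in E. injection E as E.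
      apply (Hfin (r1 :: r2 :: ks) e); [constructor|cbn in *; lia|]. now rewrite !str_cons.
    + apply is_reg_spec in Hu. apply is_reg_spec in Hw. destruct Hu as [q1 ->], Hw as [q2 ->].
      destruct (code_surj q) as [l ->].
      rewrite <- !code_app, <- !code_c0, <- code_c1 in E. apply code_inj in E.
      destruct r; try discriminate. cbn [enc_regex] in E. rewrite <- !app_assoc in E.
      cbn [app] in E. injection E as E. apply enc_regex_prefix in E. destruct E as [-> E].
      apply enc_regex_prefix in E. destruct E as [-> <-].
      rewrite <- !code_app in Hz. destruct Hz as [Hz|Hz]; apply code_inj in Hz.
      * apply (Hfin (q1 :: ks) e); [constructor|auto|]. now rewrite str_cons.
      * apply (Hfin (q2 :: ks) e); [apply E_un2|auto|]. now rewrite str_cons.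
    + apply is_reg_spec in Hu. destruct Hu as [q1 ->]. destruct (code_surj q) as [l ->].
      rewrite <- str_cons in Hz.
      rewrite <- !code_app, <- code_c1, <- !code_c0, <- code_c1 in E. apply code_inj in E.
      destruct r; try discriminate. cbn [enc_regex] in E. rewrite <- !app_assoc in E.
      cbn [app] in E. injection E as E. apply enc_regex_prefix in E. destruct E as [-> <-].
      destruct Hz as [[Ek Hz]|[Ek Hz]].
      * apply code_inj in Hz. apply (Hfin ks e); [constructor|cbn in Ek; lia|auto].
      * rewrite <- code_app in Hz. apply code_inj in Hz.
        apply (Hfin (q1 :: RStar q1 :: ks) e); [constructor|cbn in *; lia|]. rewrite str_cons. auto.
  - destruct ks as [|r ks]; [|cbn in Hk; lia].
    assert (Es : forall e, str [] [e] = enc_oregex e) by (intros; unfold str; cbn; now rewrite app_nil_r).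
    rewrite Es in H.
    destruct H as [(u & _ & E & Hu & Ek & Hz)|[[E Ek]|(u & _ & w & _ & E & Hu & Hw & Ek & Hz)]].
    + apply is_reg_spec in Hu. destruct Hu as [q1 ->]. rewrite <- !code_c0 in E. apply code_inj in E.
      destruct e; try discriminate. cbn [enc_oregex app] in E. injection E as E.
      pose proof (enc_regex_prefix r q1 [] []) as Hp. rewrite !app_nil_r in Hp.
      destruct (Hp E) as [-> _]. rewrite <- code_app in Hz. apply code_inj in Hz.
      apply (Hfin [q1] (OOmega q1)); [constructor|auto|]. now rewrite str_cons, Es.
    + rewrite <- code_c1, <- code_c0 in E. apply code_inj in E.
      destruct e; try discriminate. cbn [enc_oregex app] in E. injection E as E.
      apply (Hfin [r] e); [constructor|auto|]. now rewrite str_cons, Es.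
    + apply is_oreg_spec in Hu. apply is_oreg_spec in Hw. destruct Hu as [o1 ->], Hw as [o2 ->].
      rewrite <- code_app, <- code_c0, <- code_c1 in E. apply code_inj in E.
      destruct e; try discriminate. cbn [enc_oregex app] in E. injection E as E.
      apply enc_oregex_prefix in E. destruct E as [-> E].
      pose proof (enc_oregex_prefix e2 o2 [] []) as Hp. rewrite !app_nil_r in Hp.
      destruct (Hp E) as [-> _]. destruct Hz as [Hz|Hz]; apply code_inj in Hz.
      * apply (Hfin [] o1); [constructor|auto|]. now rewrite Es.
      * apply (Hfin [] o2); [apply E_ou2|auto|]. now rewrite Es.
Qed.

Lemma nd_ge Y ks e : Y <= nd Y ks e /\ length ks <= nd Y ks e /\ code (str ks [e]) <= nd Y ks e.
Proof. apply pr3_ge. Qed.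

Lemma eps_rel_complete Y ks e ks' e' : aeps ks e ks' e' -> eps_rel (nd Y ks e) (nd Y ks' e').
Proof.
  intros H. pose proof (nd_ge Y ks e) as G1. pose proof (nd_ge Y ks' e') as G2.
  exists Y. split; [tauto|]. exists (length ks). split; [tauto|].
  exists (code (str ks [e])). split; [tauto|]. exists (length ks'). split; [tauto|].
  exists (code (str ks' [e'])). split; [tauto|]. split; [reflexivity|]. split; [reflexivity|].
  clear G1 G2.
  assert (Es : forall e, str [] [e] = enc_oregex e) by (intros; unfold str; cbn; now rewrite app_nil_r).
  assert (Hr : forall r, is_reg (code (enc_regex r))) by (intros r; apply is_reg_spec; now exists r).
  assert (Ho : forall e, is_oreg (code (enc_oregex e))) by (intros e0; apply is_oreg_spec; now exists e0).
  assert (G0 : forall x y, x <= y -> x <= cb0 y) by (unfold cb0; lia).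
  assert (G1 : forall x y, x <= y -> x <= cb1 y) by (unfold cb1; lia).
  assert (C1 : forall x y z, x <= y -> x <= cat y z) by (intros x y z ?; pose proof (cat_ge y z); lia).
  assert (C2 : forall x y z, x <= z -> x <= cat y z) by (intros x y z ?; pose proof (cat_ge y z); lia).
  destruct H as [ks e|r1 r2 ks e|r1 r2 ks e|r1 r2 ks e|r ks e|r ks e|r|r e|e1 e2|e1 e2];
    [left|left|left|left|left|left|right|right|right|right]; (split; [cbn [length]; lia|]).
  - left. rewrite str_cons. cbn [enc_regex app]. now rewrite !code_c0, code_c1.
  - right; left. rewrite !str_cons. cbn [enc_regex]. rewrite <- !app_assoc. cbn [app].
    now rewrite code_c0, !code_c1.
  - right; right; left. rewrite !str_cons. cbn [enc_regex]. rewrite <- !app_assoc. cbn [app].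
    rewrite code_c1, !code_c0, !code_app.
    exists (code (enc_regex r1)). split; [auto 10|]. exists (code (enc_regex r2)). split; [auto 10|].
    exists (code (str ks [e])). split; [auto 10|]. auto 10.
  - right; right; left. rewrite !str_cons. cbn [enc_regex]. rewrite <- !app_assoc. cbn [app].
    rewrite code_c1, !code_c0, !code_app.
    exists (code (enc_regex r1)). split; [auto 10|]. exists (code (enc_regex r2)). split; [auto 10|].
    exists (code (str ks [e])). split; [auto 10|]. auto 10.
  - right; right; right. rewrite !str_cons. cbn [enc_regex]. rewrite <- !app_assoc. cbn [app].
    rewrite code_c1, code_c0, code_c1, !code_app.
    exists (code (enc_regex r)). split; [auto 10|].
    exists (code (str ks [e])). split; [auto 10|]. auto 10.
  - right; right; right. rewrite !str_cons. cbn [enc_regex]. rewrite <- !app_assoc. cbn [app].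
    rewrite !code_app, code_c1, code_c0, code_c1, !code_app.
    exists (code (enc_regex r)). split; [auto 10|].
    exists (code (str ks [e])). split; [auto 10|]. auto 10.
  - left. rewrite str_cons, Es. cbn [enc_oregex app]. rewrite code_app, !code_c0.
    exists (code (enc_regex r)). split; [auto 10|]. auto 10.
  - right; left. rewrite str_cons, !Es. cbn [enc_oregex app]. now rewrite code_c0, code_c1.
  - right; right. rewrite !Es. cbn [enc_oregex app]. rewrite code_c1, code_c0, code_app.
    exists (code (enc_oregex e1)). split; [auto 10|]. exists (code (enc_oregex e2)). split; [auto 10|]. auto 10.
  - right; right. rewrite !Es. cbn [enc_oregex app]. rewrite code_c1, code_c0, code_app.
    exists (code (enc_oregex e1)). split; [auto 10|]. exists (code (enc_oregex e2)). split; [auto 10|]. auto 10.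
Qed.

Lemma let_rel_sound n D Y ks e y : let_rel n D (nd Y ks e) y ->
  exists c ks', ks = RSym c :: ks' /\ Nat.b2n c * D <= Y /\ ynext n D Y c <= 2 * D /\
                y = nd (ynext n D Y c) ks' e.
Proof.
  intros (Y1 & _ & Y' & _ & k & _ & z & _ & -> & HY' & H). destruct (code_surj z) as [l ->].
  destruct H as [[Ex EY]|(Ex & HD & EY)]; apply pr3_inj in Ex; destruct Ex as (<- & Ek & E);
    rewrite <- ?code_c1, <- !code_c0, <- code_c1, <- code_c0 in E; apply code_inj in E;
    (destruct ks as [|r ks]; [discriminate|]); rewrite str_cons in E;
    (destruct r; try discriminate); cbn in E; injection E as -> E; cbn in Ek.
  - exists false, ks. unfold ynext. cbn [Nat.b2n Nat.mul]. rewrite Nat.sub_0_r, <- EY.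
    repeat split; auto; [lia|]. unfold nd. rewrite E. f_equal. lia.
  - exists true, ks. unfold ynext. cbn [Nat.b2n]. rewrite Nat.mul_1_l, <- EY.
    repeat split; auto. unfold nd. rewrite E. f_equal. lia.
Qed.

Lemma let_rel_complete n D Y c ks e : Nat.b2n c * D <= Y -> ynext n D Y c <= 2 * D ->
  let_rel n D (nd Y (RSym c :: ks) e) (nd (ynext n D Y c) ks e).
Proof.
  intros HY HD. pose proof (nd_ge Y (RSym c :: ks) e) as G1. pose proof (nd_ge (ynext n D Y c) ks e) as G2.
  exists Y. split; [tauto|]. exists (ynext n D Y c). split; [tauto|]. exists (length ks). split; [tauto|].
  exists (code (str ks [e])). split; [tauto|]. split; [reflexivity|]. split; auto.
  unfold nd. rewrite str_cons. cbn [enc_regex app length]. rewrite code_c0, code_c1, code_c0.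
  unfold ynext in *. destruct c; cbn [Nat.b2n Nat.mul] in *.
  - right. rewrite code_c1, Nat.add_0_r in *. auto.
  - left. rewrite code_c0, Nat.sub_0_r. auto.
Qed.

Lemma reach_sound n D N x y : reach (graph_rel n D) N x y -> forall Y ks e, x = nd Y ks e ->
  exists u Y' ks' e', y = nd Y' ks' e' /\ apath n D (fun _ _ _ => True) Y ks e u Y' ks' e'.
Proof.
  induction 1 as [x Hx|x y z Hx H1 H2 IH]; intros Y ks e ->.
  - exists [], Y, ks, e. split; auto. now constructor.
  - destruct H1 as [H1|H1].
    + apply eps_rel_sound in H1. destruct H1 as (ks1 & e1 & A & ->).
      destruct (IH Y ks1 e1 eq_refl) as (u & Y' & ks' & e' & -> & P).
      exists u, Y', ks', e'. split; auto. eapply ap_eps; eauto.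
    + apply let_rel_sound in H1. destruct H1 as (c & ks1 & -> & L1 & L2 & ->).
      destruct (IH _ ks1 e eq_refl) as (u & Y' & ks' & e' & -> & P).
      exists (c :: u), Y', ks', e'. split; auto. apply ap_let; auto.
Qed.

Lemma reach_complete n D N Ok Y ks e u Y' ks' e' :
  (forall Y ks e, Ok Y ks e -> nd Y ks e <= N) -> apath n D Ok Y ks e u Y' ks' e' ->
  reach (graph_rel n D) N (nd Y ks e) (nd Y' ks' e').
Proof.
  intros HN. induction 1.
  - constructor. auto.
  - eapply reach_step; [auto|left; eapply eps_rel_complete; eauto|auto].
  - eapply reach_step; [auto|right; apply let_rel_complete; auto|auto].
Qed.

(** L is the length of the encoded expression. The runs that matter keep the stack string within L^2
    + L letters, so Z exceeds its code and its height. *)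
Definition node_bound (D E : nat) : nat :=
  let L := Nat.log2 (S E) in let Z := 2 ^ (L * L + L + 1) in pr3 (2 * D) Z Z.

Lemma PS_node_bound D E : PS D -> PS E -> PS (fun v => node_bound (D v) (E v)).
Proof. intros. unfold node_bound. cbv zeta. ps. Qed.
#[export] Hint Resolve PS_node_bound : ps.

(** From left to right, paths of codes are read back as runs, the edge from x to y contributing the
    letter that makes the cycle word nonempty. Conversely, every node of a run within the room L^2 +
    L lies below [node_bound]. *)
Lemma lasso_spec n D P e :
  lasso n D (node_bound D (code (enc_oregex e))) P (code (enc_oregex e)) <->
  exists w, oregex_lang e w /\ good n D P w.
Proof.
  assert (Es : forall e, str [] [e] = enc_oregex e) by (intros; unfold str; cbn; now rewrite app_nil_r).
  assert (End : forall Y e, pr3 Y 0 (code (enc_oregex e)) = nd Y [] e)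
    by (intros; unfold nd; now rewrite Es).
  set (N := node_bound D (code (enc_oregex e))).
  unfold lasso. rewrite End. split.
  - intros (HP & Y & _ & u & _ & x & _ & y & _ & R1 & R2 & R3 & R4).
    destruct (reach_sound _ _ _ _ _ R1 _ _ _ eq_refl) as (u1 & Y1 & ks1 & e1 & E1 & P1).
    apply pr3_inj in E1. destruct E1 as (<- & Ek & Ez).
    destruct ks1; [|discriminate]. rewrite Es in Ez. destruct (code_surj u) as [l ->].
    rewrite <- !code_c0 in Ez. apply code_inj in Ez.
    destruct e1 as [r| |]; try discriminate. cbn in Ez. injection Ez as ->.
    assert (En : pr3 Y 0 (cb0 (cb0 (code (enc_regex r)))) = nd Y [] (OOmega r)).
    { rewrite <- End. cbn [enc_oregex app]. now rewrite !code_c0. }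
    rewrite En in *.
    destruct (reach_sound _ _ _ _ _ R2 _ _ _ eq_refl) as (v1 & Y2 & ks2 & e2 & -> & P2).
    apply let_rel_sound in R3. destruct R3 as (c & ks3 & -> & L1 & L2 & ->).
    destruct (reach_sound _ _ _ _ _ R4 _ _ _ eq_refl) as (v2 & Y3 & ks4 & e4 & E4 & P4).
    apply pr3_inj in E4. destruct E4 as (<- & Ek4 & E4). destruct ks4; [|discriminate].
    apply code_inj in E4. rewrite !Es in E4.
    pose proof (enc_oregex_prefix (OOmega r) e4 [] []) as Hp. rewrite !app_nil_r in Hp.
    destruct (Hp E4) as [<- _].
    eapply (lasso_sound n D (fun _ _ _ => True) P e u1 Y r (v1 ++ c :: v2)); auto.
    + eapply apath_app; [exact P2|]. apply ap_let; auto.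
    + destruct v1; discriminate.
  - intros (w & Hw & HG).
    set (L := length (enc_oregex e)).
    destruct (lasso_complete n D (L * L + L) e w P Hw HG (le_n _)) as (u & Y & r & v & P1 & P2 & Hv).
    split; [apply (HG 0)|].
    assert (HN : forall Y ks e, OkM D (L * L + L) Y ks e -> nd Y ks e <= N).
    { intros Y0 ks0 e0 [H1 H2]. unfold N, node_bound. rewrite log2_code. fold L.
      pose proof (code_lt (str ks0 [e0])) as H3. pose proof (proj1 (length_le_str ks0 [e0])) as H4.
      pose proof (length_le_code (str ks0 [e0])).
      assert (2 ^ S (length (str ks0 [e0])) <= 2 ^ (L * L + L + 1)) by (apply pow2_mono; lia).
      apply pr3_mono; lia. }
    destruct (apath_letter _ _ _ _ _ _ _ _ _ _ P2 Hv) as (v1 & v2 & Y1 & c & ks1 & e1 & Q1 & L1 & L2 & Q2).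
    apply (reach_complete n D N) in P1; auto. apply (reach_complete n D N) in Q1; auto.
    apply (reach_complete n D N) in Q2; auto.
    assert (En : pr3 Y 0 (cb0 (cb0 (code (enc_regex r)))) = nd Y [] (OOmega r)).
    { rewrite <- End. cbn [enc_oregex app]. now rewrite !code_c0. }
    destruct (reach_le _ _ _ _ P1) as [_ B1]. destruct (reach_le _ _ _ _ Q1) as [_ B2].
    destruct (reach_le _ _ _ _ Q2) as [B3 _].
    exists Y. split; [pose proof (nd_ge Y [] (OOmega r)); lia|].
    exists (code (enc_regex r)). split.
    { pose proof (nd_ge Y [] (OOmega r)) as G. rewrite Es in G. cbn [enc_oregex app] in G.
      rewrite !code_c0 in G. unfold cb0 in G. lia. }
    exists (nd Y1 (RSym c :: ks1) e1). split; auto. exists (nd (ynext n D Y1 c) ks1 e1). split; auto.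
    rewrite En. repeat split; auto. now apply let_rel_complete.
Qed.

(** * Discounted sums and remainders *)

Section Residual.
Local Open Scope R_scope.

Lemma Un_cv_shift u l : Un_cv (fun i => u (S i)) l <-> Un_cv u l.
Proof.
  split; intros H eps He; destruct (H eps He) as [N HN].
  - exists (S N). intros [|k] Hk; [lia|]. apply HN. lia.
  - exists N. intros k Hk. apply HN. lia.
Qed.

Lemma Un_cv_const c : Un_cv (fun _ => c) c.
Proof. intros eps He. exists 0%nat. intros k _. unfold Rdist. rewrite Rminus_diag, Rabs_R0. lra. Qed.

Lemma Un_cv_eq u v l l' : (forall i, u i = v i) -> l = l' -> Un_cv u l -> Un_cv v l'.
Proof. intros E <- H eps He. destruct (H eps He) as [N HN]. exists N. intros k Hk. rewrite <- E. auto. Qed.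

Lemma Un_cv_geom x : 0 < x < 1 -> Un_cv (fun i => x ^ i) 0.
Proof.
  intros Hx eps He. destruct (pow_lt_1_zero x) with (y := eps) as [N HN]; auto.
  { rewrite Rabs_right; lra. }
  exists N. intros k Hk. unfold Rdist. rewrite Rminus_0_r. apply HN. lia.
Qed.

Variables (n : nat) (lam : R).
Hypothesis Hn : (2 <= n)%nat.
Hypothesis Hlam : lam = / INR n.

Lemma lam_n : lam * INR n = 1.
Proof. rewrite Hlam. apply Rinv_l. apply not_0_INR. lia. Qed.

Lemma INR_n_ge2 : 2 <= INR n.
Proof. change 2 with (INR 2). now apply le_INR. Qed.

Lemma lam_bounds : 0 < lam < 1.
Proof. pose proof lam_n. pose proof INR_n_ge2. split; nra. Qed.

Lemma lam_half : 2 * lam <= 1.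
Proof. pose proof lam_n. pose proof INR_n_ge2. pose proof lam_bounds. nra. Qed.

Definition bR (b : bool) : R := INR (Nat.b2n b).

Lemma bR_bounds b : 0 <= bR b <= 1.
Proof. destruct b; cbn; lra. Qed.

(** The real counterpart of [ys], with an untruncated subtraction and with start and slope of any
    sign. *)
Fixpoint rres (s c : R) (w : nat -> bool) (i : nat) : R :=
  match i with O => s | S i' => INR n * (rres s c w i' - bR (w i') * c) end.

Lemma rres_step s c w i : lam ^ S i * rres s c w (S i) = lam ^ i * (rres s c w i - bR (w i) * c).
Proof.
  cbn [rres pow]. replace (lam * lam ^ i * (INR n * (rres s c w i - bR (w i) * c))) with
    ((lam * INR n) * (lam ^ i * (rres s c w i - bR (w i) * c))) by ring.
  rewrite lam_n. ring.
Qed.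

(* [lam^i * rres i] is, up to scaling, the remaining target after i letters minus
   the value of continuing with the letter a forever. *)
Lemma sum_iff_residual t a b d (w : nat -> bool) : 0 < d ->
  infinite_sum (fun i => (if w i then b else a) * lam ^ i) t <->
  Un_cv (fun i => lam ^ i * rres ((t * (INR n - 1) - a * INR n) * d) ((b - a) * (INR n - 1) * d) w i) 0.
Proof.
  intros Hd. set (f := fun i => (if w i then b else a) * lam ^ i).
  set (s := (t * (INR n - 1) - a * INR n) * d). set (c := (b - a) * (INR n - 1) * d).
  assert (E : forall N, lam ^ S N * rres s c w (S N) =
            ((t - sum_f_R0 f N) * (INR n - 1) - lam ^ N * a) * d).
  { assert (Hf : forall i, f i = (a + bR (w i) * (b - a)) * lam ^ i).
    { intros i. unfold f, bR. destruct (w i); cbn; ring. }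
    induction N as [|N IH]; rewrite rres_step.
    - cbn [sum_f_R0 rres pow]. rewrite Hf. cbn [pow]. unfold s, c. ring.
    - rewrite Rmult_minus_distr_l, IH. cbn [sum_f_R0]. rewrite Hf. unfold c.
      replace (lam ^ N * a) with (lam ^ S N * a * INR n).
      + ring.
      + cbn [pow]. replace (lam * lam ^ N * a * INR n) with ((lam * INR n) * (lam ^ N * a)) by ring.
        rewrite lam_n. ring. }
  pose proof lam_bounds as Hl. pose proof INR_n_ge2 as Hn2.
  assert (Hg : Un_cv (fun i => lam ^ i * a) 0).
  { eapply Un_cv_eq; [| |apply CV_mult; [apply (Un_cv_geom lam Hl)|apply (Un_cv_const a)]]; [reflexivity|ring]. }
  rewrite <- Un_cv_shift. split; intros H.
  - change (Un_cv (sum_f_R0 f) t) in H.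
    eapply Un_cv_eq; [intros i; symmetry; apply E| |].
    2: { apply CV_mult; [|apply (Un_cv_const d)]. apply CV_minus; [|exact Hg].
         apply CV_mult; [|apply (Un_cv_const (INR n - 1))].
         apply CV_minus; [apply (Un_cv_const t)|exact H]. }
    ring.
  - change (Un_cv (sum_f_R0 f) t).
    set (g := fun i => lam ^ S i * rres s c w (S i)) in H.
    assert (H2 : Un_cv (fun i => t - (g i * / d + lam ^ i * a) * / (INR n - 1)) (t - (0 * / d + 0) * / (INR n - 1))).
    { apply CV_minus; [apply Un_cv_const|]. apply CV_mult; [|apply Un_cv_const].
      apply CV_plus; [|exact Hg]. apply CV_mult; [exact H|apply Un_cv_const]. }
    eapply Un_cv_eq; [| |exact H2].
    + intros i. unfold g. rewrite E. field. split; lra.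
    + field. split; lra.
Qed.

(** For c >= 0 each letter subtracts a nonnegative amount, so the scaled remainders decrease, and a
    decreasing sequence stays above its limit 0. For c <= 0 they increase, and the first one is
    already at most 0. *)
Lemma residual_sign s c w : Un_cv (fun i => lam ^ i * rres s c w i) 0 ->
  (0 <= c -> forall i, 0 <= rres s c w i) /\ (c <= 0 -> s <= 0).
Proof.
  intros H. pose proof lam_bounds as Hl.
  assert (Hp : forall i, 0 < lam ^ i) by (intros i; apply pow_lt; lra).
  split.
  - intros Hc i.
    assert (Hd : Un_decreasing (fun i => lam ^ i * rres s c w i)).
    { intros k. rewrite rres_step. pose proof (bR_bounds (w k)). specialize (Hp k).
      assert (0 <= bR (w k) * c) by (apply Rmult_le_pos; lra). nra. }
    pose proof (decreasing_ineq _ 0 Hd H i) as Hi. cbn beta in Hi. specialize (Hp i).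
    destruct (Rle_lt_dec 0 (rres s c w i)); auto. exfalso. nra.
  - intros Hc.
    assert (Hd : Un_growing (fun i => lam ^ i * rres s c w i)).
    { intros k. rewrite rres_step. pose proof (bR_bounds (w k)). specialize (Hp k).
      assert (0 <= bR (w k) * (- c)) by (apply Rmult_le_pos; lra). nra. }
    pose proof (growing_ineq _ 0 Hd H 0%nat) as Hi. cbn in Hi. lra.
Qed.

(** The scaled excess over 2c increases towards 0, because one letter takes off at most c and
    [2 * lam <= 1] gives c + lam 2c <= 2c. *)
Lemma residual_upper s c w : 0 <= c -> Un_cv (fun i => lam ^ i * rres s c w i) 0 ->
  forall i, rres s c w i <= 2 * c.
Proof.
  intros Hc H i. pose proof lam_bounds as Hl. pose proof lam_half as Hh.
  assert (Hp : forall i, 0 < lam ^ i) by (intros j; apply pow_lt; lra).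
  assert (Hd : Un_growing (fun i => lam ^ i * rres s c w i - lam ^ i * (2 * c))).
  { intros k. rewrite rres_step. cbn [pow]. pose proof (bR_bounds (w k)). specialize (Hp k).
    assert (bR (w k) * c <= c) by nra.
    assert (lam * (2 * c) <= c) by nra.
    assert (lam ^ k * (bR (w k) * c + lam * (2 * c)) <= lam ^ k * (2 * c)) by (apply Rmult_le_compat_l; lra).
    lra. }
  assert (Hcv : Un_cv (fun i => lam ^ i * rres s c w i - lam ^ i * (2 * c)) 0).
  { eapply Un_cv_eq; [| |apply CV_minus; [exact H|apply CV_mult; [apply (Un_cv_geom lam Hl)|apply (Un_cv_const (2 * c))]]].
    - reflexivity.
    - ring. }
  pose proof (growing_ineq _ 0 Hd Hcv i) as Hi. cbn beta in Hi. specialize (Hp i).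
  destruct (Rle_lt_dec (rres s c w i) (2 * c)); auto. exfalso. nra.
Qed.

(** Forward, the next remainder being nonnegative shows that no subtraction is truncated, so natural
    and real remainders agree. Backward, remainders bounded by 2D times a vanishing geometric factor
    tend to 0. *)
Lemma residual_good P D w :
  Un_cv (fun i => lam ^ i * rres (INR P) (INR D) w i) 0 <-> good n D P w.
Proof.
  pose proof lam_bounds as Hl.
  assert (Hstep : forall i, INR (ys n D P w i) = rres (INR P) (INR D) w i ->
            (Nat.b2n (w i) * D <= ys n D P w i)%nat ->
            INR (ys n D P w (S i)) = rres (INR P) (INR D) w (S i)).
  { intros i E Hle. cbn [ys rres]. unfold ynext. rewrite mult_INR, minus_INR, mult_INR, E by auto. reflexivity. }
  split.
  - intros H. destruct (residual_sign _ _ _ H) as [H1 _].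
    specialize (H1 (pos_INR D)). pose proof (residual_upper _ _ _ (pos_INR D) H) as H2.
    assert (Hbr : forall i, bR (w i) * INR D <= rres (INR P) (INR D) w i).
    { intros i. specialize (H1 (S i)). cbn [rres] in H1. pose proof INR_n_ge2.
      destruct (Rle_lt_dec (bR (w i) * INR D) (rres (INR P) (INR D) w i)); auto. exfalso. nra. }
    assert (E : forall i, INR (ys n D P w i) = rres (INR P) (INR D) w i).
    { induction i as [|i IH]; [reflexivity|]. apply Hstep; auto. apply INR_le.
      rewrite mult_INR, IH. apply Hbr. }
    intros i. split; apply INR_le; rewrite ?mult_INR, E; [apply Hbr|]. apply H2.
  - intros HG.
    assert (E : forall i, INR (ys n D P w i) = rres (INR P) (INR D) w i).
    { induction i as [|i IH]; [reflexivity|]. apply Hstep; auto. apply HG. }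
    intros eps He.
    assert (Hpos : 0 < 2 * INR D + 1) by (pose proof (pos_INR D); lra).
    destruct (Un_cv_geom lam Hl (eps / (2 * INR D + 1))) as [N HN].
    { apply Rdiv_lt_0_compat; lra. }
    exists N. intros k Hk. specialize (HN k Hk). unfold Rdist in *. rewrite Rminus_0_r in *.
    assert (Hp : 0 < lam ^ k) by (apply pow_lt; lra).
    rewrite Rabs_right in HN by lra.
    assert (Hy : 0 <= rres (INR P) (INR D) w k <= 2 * INR D).
    { rewrite <- E. split; [apply pos_INR|]. change 2 with (INR 2). rewrite <- mult_INR. apply le_INR, HG. }
    rewrite Rabs_right by (apply Rle_ge, Rmult_le_pos; lra).
    apply Rle_lt_trans with (lam ^ k * (2 * INR D + 1)); [apply Rmult_le_compat_l; lra|].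
    apply Rmult_lt_reg_r with (/ (2 * INR D + 1)); [now apply Rinv_0_lt_compat|].
    rewrite Rmult_assoc, Rinv_r by lra. lra.
Qed.

Lemma rres_opp s c w i : rres (- s) (- c) w i = - rres s c w i.
Proof. induction i as [|i IH]; cbn [rres]; [reflexivity|]. rewrite IH. ring. Qed.

(** Negating start and slope together negates all remainders, which reduces a negative slope to a
    positive one. The side condition says that the start has the sign of the slope or is 0, and is 0
    if the slope is. *)
Lemma residual_signed S1 S2 C1 C2 w :
  Un_cv (fun i => lam ^ i * rres (INR S1 - INR S2) (INR C1 - INR C2) w i) 0 <->
  (((C2 < C1 /\ S2 <= S1) \/ (C1 < C2 /\ S1 <= S2) \/ (C1 = C2 /\ S1 = S2)) /\
   good n ((C1 - C2) + (C2 - C1)) ((S1 - S2) + (S2 - S1)) w)%nat.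
Proof.
  assert (Hpos : (C2 <= C1)%nat -> (S2 <= S1)%nat ->
    (Un_cv (fun i => lam ^ i * rres (INR S1 - INR S2) (INR C1 - INR C2) w i) 0 <->
    good n ((C1 - C2) + (C2 - C1))%nat ((S1 - S2) + (S2 - S1))%nat w)).
  { intros H1 H2. replace (C1 - C2 + (C2 - C1))%nat with (C1 - C2)%nat by lia.
    replace (S1 - S2 + (S2 - S1))%nat with (S1 - S2)%nat by lia.
    rewrite <- residual_good, !minus_INR by auto. reflexivity. }
  assert (Hneg : (C1 <= C2)%nat -> (S1 <= S2)%nat ->
    (Un_cv (fun i => lam ^ i * rres (INR S1 - INR S2) (INR C1 - INR C2) w i) 0 <->
    good n ((C1 - C2) + (C2 - C1))%nat ((S1 - S2) + (S2 - S1))%nat w)).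
  { intros H1 H2. replace (C1 - C2 + (C2 - C1))%nat with (C2 - C1)%nat by lia.
    replace (S1 - S2 + (S2 - S1))%nat with (S2 - S1)%nat by lia.
    rewrite <- residual_good, !minus_INR by auto.
    assert (E : forall i, lam ^ i * rres (INR S2 - INR S1) (INR C2 - INR C1) w i =
                          - (lam ^ i * rres (INR S1 - INR S2) (INR C1 - INR C2) w i)).
    { intros i. rewrite <- (Ropp_minus_distr (INR S1)), <- (Ropp_minus_distr (INR C1)), rres_opp. ring. }
    split; intros H.
    - eapply Un_cv_eq; [intros i; symmetry; apply E| |apply CV_opp; exact H]. ring.
    - eapply Un_cv_eq; [| |apply CV_opp; exact H].
      + intros i. unfold opp_seq. rewrite E. ring.
      + ring. }
  split.
  - intros H. destruct (residual_sign _ _ _ H) as [H1 H2].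
    assert (Hge : (C2 <= C1 -> S2 <= S1)%nat).
    { intros Hc. apply INR_le. apply le_INR in Hc. specialize (H1 ltac:(lra) 0%nat). cbn in H1. lra. }
    assert (Hle : (C1 <= C2 -> S1 <= S2)%nat).
    { intros Hc. apply INR_le. apply le_INR in Hc. specialize (H2 ltac:(lra)). lra. }
    split; [lia|]. destruct (Nat.le_ge_cases C1 C2); [apply Hneg|apply Hpos]; auto.
  - intros [[[H1 H2]|[[H1 H2]|[H1 H2]]] HG]; [apply Hpos|apply Hneg|apply Hpos]; auto; lia.
Qed.
End Residual.

(** * Instances and the two decision problems *)

Definition qpos (q : Q) : nat := Z.to_nat (Qnum q).
Definition qneg (q : Q) : nat := Z.to_nat (- Qnum q).
Definition qden (q : Q) : nat := Pos.to_nat (Qden q).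

Lemma Q2R_split q : (Q2R q = (INR (qpos q) - INR (qneg q)) / INR (qden q) /\ 0 < INR (qden q))%R.
Proof.
  assert (Hd : (0 < INR (qden q))%R) by (apply lt_0_INR; unfold qden; lia).
  split; auto. unfold Q2R, Rdiv. f_equal.
  - rewrite !INR_IZR_INZ, <- minus_IZR. f_equal. unfold qpos, qneg. lia.
  - f_equal. rewrite INR_IZR_INZ. f_equal. unfold qden. lia.
Qed.

(* The scaled slope (n-1)(b-a) and initial remainder (n-1)t - na, as differences
   [coefC .. bp am - coefC .. bm ap] and [coefS .. tp am - coefS .. tm ap]. *)
Definition coefC (n td ad bd x y : nat) : nat := (n - 1) * td * (x * ad + y * bd).
Definition coefS (n td ad bd x y : nat) : nat := x * (n - 1) * ad * bd + y * n * td * bd.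

Definition solvable (n tp tm td ap am ad bp bm bd E : nat) : Prop :=
  let C1 := coefC n td ad bd bp am in
  let C2 := coefC n td ad bd bm ap in
  let S1 := coefS n td ad bd tp am in
  let S2 := coefS n td ad bd tm ap in
  let D := (C1 - C2) + (C2 - C1) in
  ((C2 < C1 /\ S2 <= S1) \/ (C1 < C2 /\ S1 <= S2) \/ (C1 = C2 /\ S1 = S2)) /\
  lasso n D (node_bound D E) ((S1 - S2) + (S2 - S1)) E.

Lemma solvable_spec n lam t a b e : 2 <= n -> Q2R lam = (/ INR n)%R ->
  solvable n (qpos t) (qneg t) (qden t) (qpos a) (qneg a) (qden a) (qpos b) (qneg b) (qden b)
    (code (enc_oregex e)) <-> CTDS_yes lam t a b e.
Proof.
  intros Hn Hl. unfold solvable. cbv zeta. rewrite lasso_spec. unfold CTDS_yes.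
  set (C1 := coefC n (qden t) (qden a) (qden b) (qpos b) (qneg a)).
  set (C2 := coefC n (qden t) (qden a) (qden b) (qneg b) (qpos a)).
  set (S1 := coefS n (qden t) (qden a) (qden b) (qpos t) (qneg a)).
  set (S2 := coefS n (qden t) (qden a) (qden b) (qneg t) (qpos a)).
  assert (Hw : forall w, disc_sum_eq lam t a b w <->
    (((C2 < C1 /\ S2 <= S1) \/ (C1 < C2 /\ S1 <= S2) \/ (C1 = C2 /\ S1 = S2)) /\
     good n ((C1 - C2) + (C2 - C1)) ((S1 - S2) + (S2 - S1)) w)).
  { intros w. rewrite <- (residual_signed n (Q2R lam) Hn Hl).
    destruct (Q2R_split t) as [Et Ht], (Q2R_split a) as [Ea Ha], (Q2R_split b) as [Eb Hb].
    assert (Hdpos : (0 < INR (qden t) * INR (qden a) * INR (qden b))%R)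
      by (repeat apply Rmult_lt_0_compat; auto).
    (* Multiplying by the product of the three denominators makes start and slope integral; sorting
       positive and negative parts writes each as a difference of natural numbers. *)
    replace (INR S1 - INR S2)%R with ((Q2R t * (INR n - 1) - Q2R a * INR n) *
       (INR (qden t) * INR (qden a) * INR (qden b)))%R.
    2: { rewrite Et, Ea. unfold S1, S2, coefS. rewrite !plus_INR, !mult_INR, !minus_INR by lia.
         change (INR 1) with 1%R. field. lra. }
    replace (INR C1 - INR C2)%R with ((Q2R b - Q2R a) * (INR n - 1) *
       (INR (qden t) * INR (qden a) * INR (qden b)))%R.
    2: { rewrite Eb, Ea. unfold C1, C2, coefC. rewrite !mult_INR, !plus_INR, !mult_INR, !minus_INR by lia.
         change (INR 1) with 1%R. field. lra. }
    rewrite <- (sum_iff_residual n (Q2R lam) Hn Hl _ _ _ _ w Hdpos).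
    unfold disc_sum_eq, infinite_sum.
    assert (Ef : forall k, sum_f_R0 (fun i => (Q2R (weight a b (w i)) * Q2R lam ^ i)%R) k =
                 sum_f_R0 (fun i => ((if w i then Q2R b else Q2R a) * Q2R lam ^ i)%R) k).
    { intros k. apply sum_eq. intros i _. unfold weight. now destruct (w i). }
    split; intros H eps He; destruct (H eps He) as [N HN]; exists N; intros k Hk;
      [rewrite <- Ef|rewrite Ef]; auto. }
  assert (Hb : (0 < Q2R lam < 1)%R) by exact (lam_bounds n (Q2R lam) Hn Hl).
  split.
  - intros [H1 (w & H2 & H3)]. split; auto. exists w. split; auto. now apply Hw.
  - intros [_ (w & H2 & H3)]. apply Hw in H3. destruct H3. eauto.
Qed.

(** Encoded fractions need not be reduced, so the discount 1/n may appear as l/(l n) for any l >=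
    1. *)
Definition is_instance (n tp tm td ap am ad bp bm bd s : nat) : Prop :=
  2 <= n /\ exists l, l <= s /\ exists s0, s0 <= s /\ exists s1, s1 <= s /\
  exists s2, s2 <= s /\ exists s3, s3 <= s /\
  (1 <= l /\ s = cat s0 (cat s1 (cat s2 s3)) /\ is_rat l 0 (l * n) s0 /\
   is_rat tp tm td s1 /\ is_rat ap am ad s2 /\ is_rat bp bm bd s3).

(** A number is at most the code of its encoding, each bit being spelled by two letters. This
    justifies bounding the quantifiers over numerators and denominators by the code of the
    instance. *)
Lemma is_rat_bounds p m d s : is_rat p m d s -> p <= s /\ m <= s /\ d <= s.
Proof.
  assert (Hpos : forall p s, is_pos p s -> p <= s).
  { intros p' s' H. apply is_pos_spec in H. destruct H as (q & -> & ->).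
    induction q; cbn [enc_pos]; rewrite ?code_c0, ?code_c1; unfold cb0, cb1; lia. }
  intros (s1 & _ & s2 & _ & -> & H1 & H2). pose proof (cat_ge s1 s2). apply Hpos in H2.
  destruct H1 as [(-> & -> & _)|[(-> & s' & _ & -> & H1)|(-> & s' & _ & -> & H1)]];
    try apply Hpos in H1; unfold cb0, cb1 in *; lia.
Qed.

Lemma is_instance_spec n tp tm td ap am ad bp bm bd s :
  is_instance n tp tm td ap am ad bp bm bd s <->
  exists lam t a b, 2 <= n /\ Q2R lam = (/ INR n)%R /\ s = code (enc_TDS lam t a b) /\
    tp = qpos t /\ tm = qneg t /\ td = qden t /\ ap = qpos a /\ am = qneg a /\ ad = qden a /\
    bp = qpos b /\ bm = qneg b /\ bd = qden b.
Proof.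
  unfold is_instance, enc_TDS. split.
  - intros (Hn & l & _ & s0 & _ & s1 & _ & s2 & _ & s3 & _ & Hl & -> & H0 & H1 & H2 & H3).
    apply is_rat_spec in H0, H1, H2, H3.
    destruct H0 as (lam & E1 & E2 & E3 & ->), H1 as (t & ? & ? & ? & ->),
      H2 as (a & ? & ? & ? & ->), H3 as (b & ? & ? & ? & ->).
    exists lam, t, a, b. split; auto. split.
    + destruct (Q2R_split lam) as [-> Hd]. unfold qpos, qneg, qden in *.
      rewrite <- E1, <- E2, <- E3 in *. cbn [INR]. rewrite mult_INR.
      apply lt_INR in Hl || apply le_INR in Hl. cbn [INR] in Hl. apply le_INR in Hn. cbn [INR] in Hn.
      field. lra.
    + rewrite !code_app. auto 20.
  - intros (lam & t & a & b & Hn & Hl & -> & -> & -> & -> & -> & -> & -> & -> & -> & ->).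
    split; auto. rewrite !code_app.
    assert (HL : forall x y z, x <= y -> x <= cat y z) by (intros x y z ?; pose proof (cat_ge y z); lia).
    assert (HR : forall x y z, x <= z -> x <= cat y z) by (intros x y z ?; pose proof (cat_ge y z); lia).
    destruct (Q2R_split lam) as [El Hd]. rewrite Hl in El.
    pose proof (le_INR _ _ Hn) as Hn'. cbn [INR] in Hn'.
    assert (Hp : (INR (qpos lam) * INR n - INR (qneg lam) * INR n = INR (qden lam))%R).
    { apply (f_equal (fun x => x * INR n * INR (qden lam))%R) in El. field_simplify in El; [|lra|lra].
      lra. }
    assert (Hz : qneg lam = 0 /\ 1 <= qpos lam).
    { unfold qpos, qneg, qden in *. destruct (Qnum lam) as [|p|p]; cbn [Z.to_nat Z.opp] in *.
      - cbn [INR] in Hp. lra.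
      - lia.
      - exfalso. cbn [INR] in Hp. pose proof (pos_INR (Pos.to_nat p)). nra. }
    destruct Hz as [Hz1 Hz2]. rewrite Hz1 in Hp. cbn [INR] in Hp.
    assert (Hden : qden lam = qpos lam * n) by (apply INR_eq; rewrite mult_INR; lra).
    assert (Hr : forall q, is_rat (qpos q) (qneg q) (qden q) (code (enc_Q q)))
      by (intros q; apply is_rat_spec; now exists q).
    exists (qpos lam). split.
    { apply HL, (is_rat_bounds _ _ _ _ (Hr lam)). }
    exists (code (enc_Q lam)). split; [auto 8|].
    exists (code (enc_Q t)). split; [auto 8|].
    exists (code (enc_Q a)). split; [auto 8|].
    exists (code (enc_Q b)). split; [auto 8|].
    split; auto. split; auto. rewrite <- Hden, <- Hz1. auto.
Qed.

Lemma PSP_solvable n tp tm td ap am ad bp bm bd E :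
  PS n -> PS tp -> PS tm -> PS td -> PS ap -> PS am -> PS ad -> PS bp -> PS bm -> PS bd -> PS E ->
  PSP (fun v => solvable (n v) (tp v) (tm v) (td v) (ap v) (am v) (ad v) (bp v) (bm v) (bd v) (E v)).
Proof. intros. unfold solvable, coefC, coefS. cbv zeta. ps. Qed.

Lemma PSP_is_instance n tp tm td ap am ad bp bm bd s :
  PS n -> PS tp -> PS tm -> PS td -> PS ap -> PS am -> PS ad -> PS bp -> PS bm -> PS bd -> PS s ->
  PSP (fun v => is_instance (n v) (tp v) (tm v) (td v) (ap v) (am v) (ad v) (bp v) (bm v) (bd v) (s v)).
Proof. intros. unfold is_instance. ps. Qed.
#[export] Hint Resolve PSP_solvable PSP_is_instance : ps.

(* [E] is the code of the omega-regular expression, [s] that of the rest of the instance. *)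
Definition accepts (s E : nat) : Prop :=
  exists n, n <= s /\ exists tp, tp <= s /\ exists tm, tm <= s /\ exists td, td <= s /\
  exists ap, ap <= s /\ exists am, am <= s /\ exists ad, ad <= s /\
  exists bp, bp <= s /\ exists bm, bm <= s /\ exists bd, bd <= s /\
  (is_instance n tp tm td ap am ad bp bm bd s /\ solvable n tp tm td ap am ad bp bm bd E).

Lemma PSP_accepts s E : PS s -> PS E -> PSP (fun v => accepts (s v) (E v)).
Proof. intros. unfold accepts. ps. Qed.
#[export] Hint Resolve PSP_accepts : ps.

Lemma is_instance_bounds n tp tm td ap am ad bp bm bd s :
  is_instance n tp tm td ap am ad bp bm bd s ->
  n <= s /\ tp <= s /\ tm <= s /\ td <= s /\ ap <= s /\ am <= s /\ ad <= s /\
  bp <= s /\ bm <= s /\ bd <= s.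
Proof.
  intros (_ & l & _ & s0 & B0 & s1 & B1 & s2 & B2 & s3 & B3 & Hl & _ & H0 & H1 & H2 & H3).
  apply is_rat_bounds in H0, H1, H2, H3.
  assert (n <= l * n) by nia. lia.
Qed.

Lemma accepts_spec x e : accepts (code x) (code (enc_oregex e)) <->
  exists n lam t a b, 2 <= n /\ Q2R lam = (/ INR n)%R /\ x = enc_TDS lam t a b /\ CTDS_yes lam t a b e.
Proof.
  unfold accepts. split.
  - intros (n & _ & tp & _ & tm & _ & td & _ & ap & _ & am & _ & ad & _ & bp & _ & bm & _ & bd & _ & HI & HS).
    apply is_instance_spec in HI.
    destruct HI as (lam & t & a & b & Hn & Hl & Hx & -> & -> & -> & -> & -> & -> & -> & -> & ->).
    apply code_inj in Hx. exists n, lam, t, a, b. split; auto. split; auto. split; auto.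
    now apply (solvable_spec n lam t a b e Hn Hl).
  - intros (n & lam & t & a & b & Hn & Hl & -> & Hy).
    apply (solvable_spec n lam t a b e Hn Hl) in Hy.
    assert (HI : is_instance n (qpos t) (qneg t) (qden t) (qpos a) (qneg a) (qden a)
                   (qpos b) (qneg b) (qden b) (code (enc_TDS lam t a b))).
    { apply is_instance_spec. exists lam, t, a, b. auto 20. }
    pose proof (is_instance_bounds _ _ _ _ _ _ _ _ _ _ _ HI) as HB.
    exists n. split; [tauto|]. exists (qpos t). split; [tauto|]. exists (qneg t). split; [tauto|].
    exists (qden t). split; [tauto|]. exists (qpos a). split; [tauto|]. exists (qneg a). split; [tauto|].
    exists (qden a). split; [tauto|]. exists (qpos b). split; [tauto|]. exists (qneg b). split; [tauto|].
    exists (qden b). split; [tauto|]. auto.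
Qed.

Lemma PSPACE_of_PSP (P : nat -> Prop) (L : list bool -> Prop) :
  PSP (fun v => P (nth 0 v 0)) -> (forall x, P (code x) <-> L x) -> PSPACE L.
Proof.
  intros [b [Hb HP]] HL. apply (PSPACE_of_PS L _ Hb). intros x.
  rewrite <- HL, <- (HP [code x]). destruct (b [code x]); cbn; intuition congruence.
Qed.

(** TDS is decided as CTDS with this fixed expression. *)
Definition any_word : oregex := OOmega (RUnion (RSym false) (RSym true)).

Lemma any_word_lang w : oregex_lang any_word w.
Proof.
  exists (fun k => k). split; auto. split; auto. intros k. unfold segment.
  replace (S k - k) with 1 by lia. cbn. destruct (w k); auto.
Qed.

Lemma TDS_in_PSPACE : PSPACE TDS_inv_lang.
Proof.
  apply (PSPACE_of_PSP (fun s => accepts s (code (enc_oregex any_word)))); [ps|].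
  intros x. rewrite accepts_spec. unfold TDS_inv_lang, TDS_yes, CTDS_yes.
  split; intros (n & lam & t & a & b & Hn & Hl & Hx & Hb & w & Hw); exists n, lam, t, a, b;
    repeat (split; auto); exists w; [tauto|]. split; auto using any_word_lang.
Qed.

Lemma CTDS_in_PSPACE : PSPACE CTDS_inv_lang.
Proof.
  apply (PSPACE_of_PSP (fun x => exists s, s <= x /\ exists E, E <= x /\
           (x = cat s E /\ is_oreg E /\ accepts s E))); [ps|].
  intros x. split.
  - intros (s & _ & E & _ & Hx & HE & HA). apply is_oreg_spec in HE. destruct HE as [e ->].
    destruct (code_surj s) as [l ->]. rewrite <- code_app in Hx. apply code_inj in Hx.
    apply accepts_spec in HA. destruct HA as (n & lam & t & a & b & Hn & Hl & -> & Hy).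
    exists n, lam, t, a, b, e. auto.
  - intros (n & lam & t & a & b & e & Hn & Hl & -> & Hy). unfold enc_CTDS. rewrite code_app.
    exists (code (enc_TDS lam t a b)). split; [apply cat_ge|].
    exists (code (enc_oregex e)). split; [apply cat_ge|]. split; auto. split.
    + apply is_oreg_spec. now exists e.
    + apply accepts_spec. exists n, lam, t, a, b. auto.
Qed.

Theorem theorem15 : PSPACE TDS_inv_lang /\ PSPACE CTDS_inv_lang.
Proof. exact (conj TDS_in_PSPACE CTDS_in_PSPACE). Qed.
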